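(* Let $S_0,\sigma:\mathbb{R}\to\mathbb{R}$ be such that $(S_0,\sigma)$ satisfies A1, A2 and A3 (with $S=S_0$). Suppose the null hypothesis $H_0: S=S_0$ holds, i.e. for each $\varepsilon>0$ the process $X=X^\varepsilon$ solves $$X_t=x_0+\int_0^t S_0(X_s)\,ds+\varepsilon\int_0^t\sigma(X_s)\,dW_s,\quad t\in[0,T],$$ and that $X$ is observed according to the Sampling Scheme. Let $$U^\varepsilon(u)=\varepsilon^{-1}\sum_{i=1}^{n(\varepsilon)}1_{[0,u]}(t_i^\varepsilon)\left[X_{t_i^\varepsilon}-X_{t_{i-1}^\varepsilon}-S_0(X_{t_{i-1}^\varepsilon})|t_i^\varepsilon-t_{i-1}^\varepsilon|\right],\quad u\in[0,T].$$ Suppose that $\widehat{\Sigma}^\varepsilon$ is a consistent estimator for $\Sigma_{S_0,\sigma}$, i.e. random variables with $\widehat{\Sigma}^\varepsilon\to\Sigma_{S_0,\sigma}$ in probability as $\varepsilon\downarrow0$. Then, as $\varepsilon\downarrow 0$, $$\frac{\sup_{u\in[0,T]}|U^\varepsilon(u)|}{\widehat{\Sigma}^\varepsilon}\longrightarrow \sup_{t\in[0,1]}|B_t|\quad\text{in distribution},$$ where $t\mapsto B_t$ is a standard Brownian motion.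
   Context: Setting: $T>0$ and $x_0\in\mathbb{R}$ are fixed; $W$ is a standard Wiener process on a stochastic basis $(\Omega,\mathcal F,(\mathcal F_t)_{t\in[0,T]},P)$. For functions $S,\sigma:\mathbb{R}\to\mathbb{R}$ and $\varepsilon>0$, $X=X^\varepsilon$ is the unique strong solution of $X_t=x_0+\int_0^tS(X_s)ds+\varepsilon\int_0^t\sigma(X_s)dW_s$, $t\in[0,T]$ (the dependence on $\varepsilon$ is suppressed). $x^S$ denotes the solution of $dx^S_t/dt=S(x^S_t)$, $x^S_0=x_0$, on $[0,T]$. Conditions on $(S,\sigma)$: A1: there is $C>0$ with $|S(x)-S(y)|\le C|x-y|$ and $|\sigma(x)-\sigma(y)|\le C|x-y|$ for all $x,y\in\mathbb{R}$. A2: $\sup_{s\in[0,T]}E|X_s|^2<\infty$ (for each $\varepsilon$). A3: $\Sigma_{S,\sigma}:=\sqrt{\int_0^T\sigma(x^S_t)^2dt}>0$. Sampling Scheme: for each $\varepsilon$, $X$ is observed at deterministic times $0=t_0^\varepsilon<t_1^\varepsilon<\cdots<t_{n(\varepsilon)}^\varepsilon=T$ such that $h_\varepsilon:=\max_{1\le i\le n(\varepsilon)}|t_i^\varepsilon-t_{i-1}^\varepsilon|=o(\varepsilon^2)$ as $\varepsilon\downarrow0$. *)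

(* Defs.v *)
From HB Require Import structures.
From mathcomp Require Import all_boot all_order all_algebra.
From mathcomp Require Import all_classical all_reals all_analysis.
Set Implicit Arguments.
Unset Strict Implicit.
Unset Printing Implicit Defensive.
Import Order.TTheory GRing.Theory Num.Theory.
Import numFieldNormedType.Exports.
Local Open Scope classical_set_scope.
Local Open Scope ring_scope.

(* A process is a map [Z : R -> Omega -> R], time first;
   only its values at times in the stated interval `[0, T] matter. *)

Section stochastic_basis.
Context {d : measure_display} {Omega : measurableType d} {R : realType}.
Implicit Types (P : probability Omega R) (F : R -> set (set Omega)).
Implicit Types (T eps : R) (W X H I Z : R -> Omega -> R) (S sigma : R -> R).

Definition filtration F T : Prop :=
  [/\ forall t : R, t \in `[0, T] -> sigma_algebra [set: Omega] (F t),
      forall t : R, t \in `[0, T] -> F t `<=` measurable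
    & forall s t : R, 0 <= s -> s <= t -> t <= T -> F s `<=` F t].

(* Measurability of a real random variable with respect to a sub-sigma-algebra
   [G] of Omega, rather than the sigma-algebra of the type. *)
Definition measurable_wrt (G : set (set Omega)) (f : Omega -> R) : Prop :=
  forall B : set R, measurable B -> G (f @^-1` B).

Definition adapted F T Z : Prop :=
  forall t : R, t \in `[0, T] -> measurable_wrt (F t) (Z t).

Definition continuous_paths T Z : Prop :=
  forall w, {within `[0, T], continuous (fun t => Z t w)}.

Definition independent_of P (G : set (set Omega)) (f : Omega -> R) : Prop :=
  forall A (B : set R), G A -> measurable B ->
    P (A `&` f @^-1` B) = (P A * P (f @^-1` B))%E.

(* The second argument of [normal_prob] is the standard deviation. *)
Definition wiener_process P F T W : Prop :=
  [/\ adapted F T W,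
      continuous_paths T W,
      {ae P, forall w, W 0 w = 0},
      (forall s t : R, 0 <= s -> s < t -> t <= T ->
         forall B : set R, measurable B ->
           P ((W t \- W s) @^-1` B) = normal_prob 0 (Num.sqrt (t - s)) B)
    & (forall s t : R, 0 <= s -> s < t -> t <= T ->
         independent_of P (F s) (W t \- W s))].

Definition natural_filtration Z : R -> set (set Omega) := fun t =>
  <<s [set A | exists (s : R) (B : set R),
        [/\ s \in `[0, t], measurable B & A = Z s @^-1` B]] >>.

Definition brownian_motion P T Z : Prop :=
  (forall t : R, t \in `[0, T] -> measurable_fun [set: Omega] (Z t)) /\
  wiener_process P (natural_filtration Z) T Z.

(* The simple process equal to [sp_val i] on ]sp_time i, sp_time i.+1],
   for i < sp_size. *)
Record simple_process := SimpleProcess {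
  sp_size : nat;
  sp_time : nat -> R;
  sp_val : nat -> Omega -> R }.

Definition simple_wf F T (phi : simple_process) : Prop :=
  [/\ sp_time phi 0%N = 0,
      sp_time phi (sp_size phi) = T,
      forall i, (i < sp_size phi)%N -> sp_time phi i < sp_time phi i.+1,
      forall i, (i < sp_size phi)%N ->
        measurable_wrt (F (sp_time phi i)) (sp_val phi i)
    & forall i, (i < sp_size phi)%N ->
        exists M : R, forall w, `|sp_val phi i w| <= M].

Definition simple_fun (phi : simple_process) : R -> Omega -> R := fun s w =>
  \sum_(i < sp_size phi)
    \1_(`]sp_time phi i, sp_time phi i.+1]%classic) s * sp_val phi i w.

Definition simple_integral W (phi : simple_process) : R -> Omega -> R :=
  fun t w => \sum_(i < sp_size phi) sp_val phi i w *
    (W (Num.min t (sp_time phi i.+1)) w - W (Num.min t (sp_time phi i)) w).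

(* [I] is a continuous version of the Ito integral process
   t |-> \int_0^t H_s dW_s on [0, T], for H adapted, jointly measurable and in
   L^2(ds x P): the L^2(P)-limit of the integrals of simple processes
   approximating H in L^2(ds x P). *)
Definition ito_integral P F T W H I : Prop :=
  [/\ [/\ adapted F T H,
          measurable_fun (`[0, T] `*` [set: Omega])
            (fun p : R * Omega => H p.1 p.2)
        & (\int[P]_w \int[lebesgue_measure]_(s in `[0%R, T])
             ((H s w) ^+ 2)%:E < +oo)%E],
      adapted F T I, continuous_paths T I
    & exists phi : nat -> simple_process,
      [/\ forall k, simple_wf F T (phi k),
          (\int[P]_w \int[lebesgue_measure]_(s in `[0%R, T])
             ((simple_fun (phi k) s w - H s w) ^+ 2)%:E)%E @[k --> \oo] --> 0%E
        & forall t : R, t \in `[0, T] ->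
          ('E_P[fun w => ((simple_integral W (phi k) t w - I t w) ^+ 2)%R])%E
            @[k --> \oo] --> 0%E]].

Definition sde_solution P F T W (x0 : R) S sigma eps X : Prop :=
  [/\ adapted F T X, continuous_paths T X
    & exists2 I, ito_integral P F T W (fun s w => sigma (X s w)) I
      & {ae P, forall w, forall t : R, t \in `[0, T] ->
          X t w = x0 + \int[lebesgue_measure]_(s in `[0, t]) S (X s w)
                  + eps * I t w}].

(* Convergence of Y_eps in probability to a constant, as eps decreases to 0. *)
Definition cvg_in_probability P (Y : R -> Omega -> R) (c : R) : Prop :=
  forall delta : R, 0 < delta ->
    P [set w | delta < `|Y eps w - c| ] @[eps --> 0^'+] --> 0%E.

Definition cvg_in_distribution P (Y : R -> Omega -> R)
    {d' : measure_display} {Omega' : measurableType d'}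
    (Q : probability Omega' R) (Z : Omega' -> R) : Prop :=
  forall f : R -> R, continuous f -> (exists M : R, forall x : R, `|f x| <= M) ->
    ('E_P[fun w => f (Y eps w)])%E @[eps --> 0^'+]
      --> ('E_Q[fun w => f (Z w)])%E.

End stochastic_basis.

Section model.
Context {R : realType}.
Implicit Types (T : R) (S sigma x : R -> R).

Definition lipschitz_coefficients S sigma : Prop :=
  exists2 C : R, 0 < C & forall x y : R,
    `|S x - S y| <= C * `|x - y| /\ `|sigma x - sigma y| <= C * `|x - y|.

Definition bounded_second_moments {d} {Omega : measurableType d}
    (P : probability Omega R) T (X : R -> Omega -> R) : Prop :=
  (ereal_sup [set 'E_P[fun w => (`|X s w| ^+ 2)%R] | s in `[0%R, T]] < +oo)%E.

(* The derivative is one-sided at the endpoints 0 and T. *)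
Definition ode_solution T (x0 : R) S x : Prop :=
  x 0 = x0 /\
  forall t : R, t \in `[0, T] ->
    (x s - x t) / (s - t) @[s --> within `[0, T] t^'] --> S (x t).

Definition limit_sd T sigma x : R :=
  Num.sqrt (\int[lebesgue_measure]_(t in `[0, T]) (sigma (x t)) ^+ 2).

(* For each eps > 0, the observation times are [t eps i], i = 0 .. n eps. *)
Definition mesh (n : R -> nat) (t : R -> nat -> R) : R -> R := fun eps =>
  \big[Num.max/0]_(i < n eps) `|t eps i.+1 - t eps i|.

Definition sampling_scheme T (n : R -> nat) (t : R -> nat -> R) : Prop :=
  (forall eps : R, 0 < eps ->
     [/\ t eps 0%N = 0, t eps (n eps) = T
       & forall i, (i < n eps)%N -> t eps i < t eps i.+1]) /\
  mesh n t =o_ (0^'+) (fun eps : R => eps ^+ 2).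

Definition score_process {Omega : Type} S (n : R -> nat) (t : R -> nat -> R)
    (X : R -> R -> Omega -> R) (eps u : R) (w : Omega) : R :=
  eps^-1 * \sum_(i < n eps) \1_(`[0, u]%classic) (t eps i.+1) *
    (X eps (t eps i.+1) w - X eps (t eps i) w
     - S (X eps (t eps i) w) * `|t eps i.+1 - t eps i|).

End model.

(* Main.v *)
Require Import Defs.
From HB Require Import structures.
From mathcomp Require Import all_boot all_order all_algebra.
From mathcomp Require Import all_classical all_reals all_analysis.
From mathcomp Require Import measurable_realfun ring lra.
Set Implicit Arguments.
Unset Strict Implicit.
Unset Printing Implicit Defensive.
Import Order.TTheory GRing.Theory Num.Theory.
Import numFieldNormedType.Exports.
Local Open Scope classical_set_scope.
Local Open Scope ring_scope.

(** Let [x] be the deterministic path, [Sig] the limiting standard deviation and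
[I] the Ito integral in the equation of [X]. The score is a step function of
time ([sup_score]), whose values are [eps^-1 Z_k], where [Z_k] is the sum of the first [k]
residuals [X_{t_{i+1}} - X_{t_i} - S(X_{t_i}) (t_{i+1} - t_i)]. By the equation,
a residual is [eps (I_{t_{i+1}} - I_{t_i})] plus a drift error, so that
[eps^-1 Z_k = M_k + N_k + D_k] with the Gaussian martingale
[M_k = \sum_(i < k) sigma(x_{t_i}) (W_{t_{i+1}} - W_{t_i})], the Ito error
[N_k = I_{t_k} - I_0 - M_k] and the accumulated drift error [D_k].

The last two terms are negligible, uniformly in [k]. Gronwall's lemma gives
[E |X_s - x_s|^2 = O(eps^2)] ([err_E2]), and since the mesh is eventually at
most [eps^2], the increments of [X] over a step are [O(eps^2)] in mean square
([incr_E2]). Hence the absolute drift errors add up to [O(eps)] in mean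
([bad_drift_prob]). Along the grid [N] is a martingale with
[E N_n^2 = O(eps^2)], so that Kolmogorov's inequality controls its maximum
([maximal_ineq], [bad_ito_prob]). Of the Ito integral, this uses an isometry up
to a constant ([ito_bound]) and the orthogonality of increments to the past
([ito_mart]); both pass to the limit from simple processes.

The increments of [M] are independent and Gaussian. Divided by the square root
of [V = \sum_i sigma(x_{t_i})^2 (t_{i+1} - t_i)], the maximum of [|M_k|] has the
law of the maximum of a Brownian motion over the times [V_k / V]
([chain_law], [gauss_sup_law]). These times become dense in the unit interval, so
that the maximum tends to [sup |B|] along every path ([brownian_grid_expect]),
whereas [V] tends to [Sig^2] ([qvar_approx]).

What remains is Slutsky's argument ([studentized_close]): when the estimator and
[sqrt V] are both within [delta] of [Sig] and the Gaussian maximum is at most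
[K], the statistic and the normalized Gaussian maximum differ by
[O((1 + K) delta)]. The level [K] comes from the tightness of [sup |B|], and
[delta] from the uniform continuity of the test function on compact sets. *)

(** * Freezing an independent variable *)

Section freezing.
Context {d : measure_display} {Omega : measurableType d} {R : realType}.
Variable P : probability Omega R.
Local Open Scope ereal_scope.

Lemma sub_sigma_measurable {d1} {T1 : measurableType d1} (G : set (set Omega))
    (U : Omega -> T1) :
  sigma_algebra setT G -> G `<=` measurable ->
  @measurable_fun _ _ (g_sigma_algebraType G) T1 setT U ->
  measurable_fun setT U.
Proof.
move=> sG Gm mU _ B mB; apply: Gm.
have := mU measurableT B mB.
by rewrite measurable_g_measurableTypeE.
Qed.

Lemma measurable_wrtP (G : set (set Omega)) (f : Omega -> R) :
  sigma_algebra setT G ->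
  measurable_wrt G f <-> @measurable_fun _ _ (g_sigma_algebraType G) _ setT f.
Proof.
move=> sG; split=> [mf _ B mB|mf B mB].
  by rewrite setTI measurable_g_measurableTypeE//; exact: mf.
have := mf measurableT B mB.
by rewrite setTI measurable_g_measurableTypeE.
Qed.

(** This replaces conditional expectations: the pair [(U, Z)] has the product
law by independence, so that [Z] can be integrated out with [U] frozen, in
either order. *)
Lemma freezing {d1} {T1 : measurableType d1} (G : set (set Omega))
    (U : Omega -> T1) (Z : Omega -> R) (g : T1 * R -> \bar R) :
  sigma_algebra setT G -> G `<=` measurable ->
  @measurable_fun _ _ (g_sigma_algebraType G) T1 setT U ->
  measurable_fun setT Z -> independent_of P G Z ->
  measurable_fun [set: T1 * R] g -> (forall p, 0 <= g p) ->
  \int[P]_w g (U w, Z w) = \int[P]_w \int[P]_v g (U w, Z v) /\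
  \int[P]_w g (U w, Z w) = \int[P]_v \int[P]_w g (U w, Z v).
Proof.
move=> sG Gm mGU mZ ind mg g0.
have mU := sub_sigma_measurable sG Gm mGU.
pose fU : {mfun Omega >-> T1} := HB.pack U (isMeasurableFun.Build _ _ _ _ _ mU).
pose fZ : {mfun Omega >-> R} := HB.pack Z (isMeasurableFun.Build _ _ _ _ _ mZ).
have mUZ : measurable_fun setT (fun w => (U w, Z w)).
  exact/measurable_fun_pairP.
pose fUZ : {mfun Omega >-> (T1 * R)%type} :=
  HB.pack (fun w => (U w, Z w)) (isMeasurableFun.Build _ _ _ _ _ mUZ).
have E X : measurable X ->
    (distribution P fU \x distribution P fZ) X = distribution P fUZ X.
  apply: product_measure_unique => A B mA mB.
  rewrite /distribution /pushforward /=.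
  rewrite -ind//.
  have := mGU measurableT A mA.
  by rewrite setTI measurable_g_measurableTypeE.
have -> : \int[P]_w g (U w, Z w) =
    \int[distribution P fU \x distribution P fZ]_p g p.
  rewrite (@eq_measure_integral _ _ _ setT (distribution P fUZ)); last first.
    by move=> A mA _; exact: E.
  by rewrite ge0_integral_distribution//; exact/measurable_EFinP.
split.
  rewrite fubini_tonelli1// ge0_integral_distribution//.
  - apply: eq_integral => z _.
    apply: (@ge0_integral_distribution _ _ _ _ _ P fZ (fun y => g (U z, y))).
      by apply: measurableT_comp => //; exact: measurable_pair1.
    by [].
  - exact: measurable_fun_fubini_tonelli_F.
  - by move=> x; apply: integral_ge0.
rewrite fubini_tonelli2// ge0_integral_distribution//.
- apply: eq_integral => z _.
  apply: (@ge0_integral_distribution _ _ _ _ _ P fU (fun x => g (x, Z z))).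
    by apply: measurableT_comp => //; exact: measurable_pair2.
  by [].
- exact: measurable_fun_fubini_tonelli_G.
- by move=> x; apply: integral_ge0.
Qed.

End freezing.

(** * Centred Gaussian variables *)

Section density.
Context {d : measure_display} {T : measurableType d} {R : realType}.
Local Open Scope ereal_scope.
Import HBNNSimple.

(** The density is known through the measure of sets only; the formula extends
from indicators to simple functions, then by monotone convergence. *)
Lemma ge0_integral_density (m mu : {measure set T -> \bar R}) (p : T -> R)
    (f : T -> \bar R) :
  measurable_fun setT p -> (forall x, (0 <= p x)%R) ->
  (forall A, measurable A -> m A = \int[mu]_(x in A) (p x)%:E) ->
  measurable_fun setT f -> (forall x, 0 <= f x) ->
  \int[m]_x f x = \int[mu]_x (f x * (p x)%:E).
Proof.
move=> mp p0 hm mf f0.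
pose f_ := nnsfun_approx measurableT mf.
have H n : \int[m]_x (f_ n x)%:E = \int[mu]_x ((f_ n x)%:E * (p x)%:E).
  under [LHS]eq_integral do rewrite fimfunE -fsumEFin//.
  rewrite [LHS]ge0_integral_fsum//; last 2 first.
    - by move=> r; exact/measurable_EFinP/measurableT_comp.
    - by move=> k x _; rewrite EFinM nnfun_muleindic_ge0.
  under [RHS]eq_integral.
    move=> x xD; rewrite fimfunE -fsumEFin// muleC ge0_mule_fsumr; last first.
      by move=> r; rewrite EFinM nnfun_muleindic_ge0.
    over.
  rewrite [RHS]ge0_integral_fsum//; last 2 first.
    - move=> r; apply/emeasurable_funM; first exact/measurable_EFinP.
      suff : measurable_fun setT (fun x => (r * \1_(f_ n @^-1` [set r]) x)%R).
        by move/measurable_EFinP.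
      by apply: measurable_funM.
    - move=> k x _; rewrite EFinM mule_ge0//; last by rewrite nnfun_muleindic_ge0.
      by rewrite lee_fin.
  apply: eq_fsbigr => r rr.
  have r0 : (0 <= r)%R.
    by move: rr; rewrite inE => -[x _ <-]; exact: fun_ge0.
  under [LHS]eq_integral do rewrite EFinM.
  rewrite ge0_integralZl//; last exact/measurable_EFinP/measurable_indic.
  rewrite integral_indic//= setIT hm//.
  under [RHS]eq_integral do rewrite EFinM muleCA.
  rewrite [RHS]ge0_integralZl//; last 2 first.
    - apply: emeasurable_funM; first exact/measurable_EFinP.
      exact/measurable_EFinP/measurable_indic.
    - by move=> x _; rewrite mule_ge0// lee_fin.
  congr (_ * _); rewrite integral_mkcond; apply: eq_integral => x _.
  rewrite patchE indicE; case: ifPn => h; first by rewrite mule1.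
  by rewrite mule0.
transitivity (lim (\int[m]_x (f_ n x)%:E @[n --> \oo])).
  rewrite -monotone_convergence//=.
  - apply: eq_integral => ? /[!inE] xD; apply/esym/cvg_lim => //=.
    exact: cvg_nnsfun_approx.
  - by move=> n; exact/measurable_EFinP/measurable_funTS.
  - by move=> n ? _; rewrite lee_fin.
  - by move=> ? _ ? ? mn; rewrite lee_fin; exact/lefP/nd_nnsfun_approx.
under eq_fun do rewrite H.
rewrite -monotone_convergence//=.
- apply: eq_integral => x /[!inE] xD.
  under eq_fun do rewrite muleC.
  rewrite limeMl//.
    rewrite muleC; congr (_ * _); apply/cvg_lim => //=.
    exact: cvg_nnsfun_approx.
  by apply/cvg_ex; exists (f x); exact: cvg_nnsfun_approx.
- by move=> n; apply: emeasurable_funM; exact/measurable_EFinP.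
- by move=> n ? _; rewrite mule_ge0// lee_fin.
- move=> ? _ ? ? mn; apply: lee_wpmul2r; first by rewrite lee_fin.
  by rewrite lee_fin; exact/lefP/nd_nnsfun_approx.
Qed.
End density.

Section gaussian.
Context {R : realType}.
Notation mu := (@lebesgue_measure R).
Local Open Scope ereal_scope.

Lemma lebesgue_scale_ocitv (c a b : R) : (c != 0)%R ->
  `|c|%:E * mu ((fun x : R => c * x)%R @^-1` `]a, b]%classic) = mu `]a, b]%classic.
Proof.
move=> c0; have [cp|cn|] := ltgtP c 0%R; last by move=> /eqP; rewrite (negbTE c0).
- have -> : (fun x : R => c * x)%R @^-1` `]a, b]%classic = `[(b / c)%R, (a / c)%R[%classic.
    apply/seteqP; split => x /=; rewrite !in_itv/= => /andP[h1 h2]; apply/andP; split.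
    + by rewrite ler_ndivrMr// mulrC.
    + by rewrite ltr_ndivlMr// mulrC.
    + by rewrite mulrC -ltr_ndivlMr//.
    + by rewrite mulrC -ler_ndivrMr//.
  rewrite !lebesgue_measure_itv/= !lte_fin ltr_ndivlMr// divfK//.
  case: ifPn => // ab; last by rewrite mule0.
  by rewrite -!EFinD -EFinM ltr0_norm//; congr EFin; field.
- have -> : (fun x : R => c * x)%R @^-1` `]a, b]%classic = `](a / c)%R, (b / c)%R]%classic.
    apply/seteqP; split => x /=; rewrite !in_itv/= => /andP[h1 h2]; apply/andP; split.
    + by rewrite ltr_pdivrMr// mulrC.
    + by rewrite ler_pdivlMr// mulrC.
    + by rewrite mulrC -ltr_pdivrMr//.
    + by rewrite mulrC -ler_pdivlMr//.
  rewrite !lebesgue_measure_itv/= !lte_fin ltr_pdivlMr// divfK//.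
  case: ifPn => // ab; last by rewrite mule0.
  by rewrite -!EFinD -EFinM gtr0_norm//; congr EFin; field.
Qed.

(** Lebesgue measure is determined by its values on half-open intervals, where
scaling is a computation. *)
Lemma lebesgue_scale (c : R) (f : R -> \bar R) : (c != 0)%R ->
  measurable_fun [set: R] f -> (forall x, 0 <= f x) ->
  \int[mu]_x (f (c * x)%R * `|c|%:E) = \int[mu]_x f x.
Proof.
move=> c0 mf f0.
have mc : measurable_fun [set: measurableTypeR R] (fun x : measurableTypeR R => (c * x)%R : measurableTypeR R).
  exact: mulrl_measurable.
have c0' : (0 <= `|c|)%R by [].
pose m := mscale (NngNum c0') (pushforward mu ( *%R c : measurableTypeR R -> measurableTypeR R)).
have E (A : set R) : measurable A -> mu A = m mc A.
  apply: lebesgue_measure_unique => X [[a b] /= _ <-].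
  by rewrite /m /mscale /= /pushforward -(lebesgue_scale_ocitv a b c0).
under eq_integral do rewrite muleC.
have mfc : measurable_fun [set: measurableTypeR R] (fun x => f (c * x)%R).
  exact: (measurableT_comp mf mc).
rewrite ge0_integralZl//.
transitivity (\int[m mc]_x f x).
  rewrite ge0_integral_mscale//=.
  by rewrite ge0_integral_pushforward.
by apply: eq_measure_integral => A mA _; apply/esym/E.
Qed.

Lemma normal_pdf_scale (s c x : R) : (0 < s)%R -> (c != 0)%R ->
  (normal_pdf 0 (`|c| * s) (c * x) * `|c| = normal_pdf 0 s x)%R.
Proof.
move=> s0 c0; have c1 : (0 < `|c|)%R by rewrite normr_gt0.
rewrite !normal_pdfE ?gt_eqF ?mulr_gt0//.
rewrite /normal_peak /normal_fun !subr0 mulrAC; congr (_ * expR _)%R.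
  rewrite exprMn -!(mulrA (`|c| ^+ 2)%R) -[in LHS]mulrnAr sqrtrM ?sqr_ge0// sqrtr_sqr normr_id.
  by rewrite invfM mulrAC mulVf ?mul1r// gt_eqF.
rewrite !exprMn real_normK ?num_real// !mulr2n; field.
by rewrite -!mulr2n !mulrn_eq0 !sqrf_eq0/= mulf_eq0 negb_or c0 gt_eqF.
Qed.

Section law.
Context {d : measure_display} {Omega : measurableType d} (P : probability Omega R).

Definition normal_law (s : R) (Z : Omega -> R) :=
  forall B : set R, measurable B -> P (Z @^-1` B) = normal_prob 0 s B.

Lemma normal_law_integral s Z (f : R -> \bar R) : measurable_fun setT Z ->
  normal_law s Z -> measurable_fun [set: R] f -> (forall x, 0 <= f x) ->
  \int[P]_w f (Z w) = \int[mu]_x (f x * (normal_pdf 0 s x)%:E).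
Proof.
move=> mZ hZ mf f0.
have mZ' : @measurable_fun _ _ Omega (measurableTypeR R) setT Z by exact: mZ.
pose fZ : {mfun Omega >-> measurableTypeR R} :=
  HB.pack Z (isMeasurableFun.Build _ _ _ _ _ mZ').
rewrite -(@ge0_integral_density _ (measurableTypeR R) R (distribution P fZ))//.
- by rewrite ge0_integral_distribution.
- exact: measurable_normal_pdf.
- by move=> x; exact: normal_pdf_ge0.
Qed.

Lemma normal_law_scale s c Z : measurable_fun setT Z ->
  (0 < s)%R -> (c != 0)%R -> normal_law s Z ->
  normal_law (`|c| * s) (fun w => c * Z w)%R.
Proof.
move=> mZ s0 c0 hZ B mB.
have mc : measurable_fun [set: R] ( *%R c) by exact: mulrl_measurable.
have mcB : measurable ( *%R c @^-1` B).
  by rewrite -[X in measurable X]setTI; exact: mc.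
rewrite -[LHS]/(P (Z @^-1` ( *%R c @^-1` B))) hZ// /normal_prob.
rewrite integral_mkcond [RHS]integral_mkcond.
rewrite -[RHS](lebesgue_scale c0)//; last 2 first.
- apply/(measurable_restrictT _ _).1 => //.
  by apply/measurable_EFinP/measurable_funTS; exact: measurable_normal_pdf.
- by move=> x; rewrite patchE; case: ifPn => // _; rewrite lee_fin normal_pdf_ge0.
apply: eq_integral => x _; rewrite !patchE.
rewrite (_ : (x \in *%R c @^-1` B) = ((c * x)%R \in B)); last first.
  by apply/idP/idP; rewrite !inE.
case: ifPn => _; last by rewrite mul0e.
by rewrite -EFinM normal_pdf_scale.
Qed.

End law.

Definition gauss_var_ext : \bar R := \int[mu]_x ((x ^+ 2)%:E * (normal_pdf 0 1 x)%:E).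

(** The bound [y exp(- y) <= 1] with [y = x^2 / 4] trades half of the Gaussian
decay for the factor [x^2], which leaves a Gaussian density of variance 2. *)
Lemma gauss_var_ext_lty : gauss_var_ext < +oo.
Proof.
pose s : R := Num.sqrt 2.
have s0 : (0 < s)%R by rewrite sqrtr_gt0.
pose K : R := (4 * normal_peak 1 / normal_peak s)%R.
have K0 : (0 <= K)%R by rewrite divr_ge0// ?mulr_ge0// normal_peak_ge0.
apply: (@le_lt_trans _ _ (\int[mu]_x (K%:E * (normal_pdf 0 s x)%:E))).
  apply: ge0_le_integral => //.
  - by move=> x _; rewrite mule_ge0// lee_fin ?sqr_ge0// normal_pdf_ge0.
  - apply: emeasurable_funM; apply/measurable_EFinP; last exact: measurable_normal_pdf.
    exact: exprn_measurable.
  - apply: emeasurable_funM; apply/measurable_EFinP; last exact: measurable_normal_pdf.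
    exact: measurable_cst.
  - move=> x _; rewrite -!EFinM lee_fin.
    rewrite !normal_pdfE ?gt_eqF// /normal_fun subr0 sqr_sqrtr// expr1n.
    set y : R := (x ^+ 2 / 4)%R.
    have -> : (- x ^+ 2 / (1 *+ 2) = (- y) + (- y))%R.
      by rewrite /y !mulr2n; field.
    have -> : (- x ^+ 2 / (2 *+ 2) = - y :> R)%R by rewrite /y !mulr2n; field.
    have -> : (x ^+ 2 = 4 * y)%R by rewrite /y; field.
    have ps : normal_peak s != 0%R by rewrite gt_eqF ?normal_peak_gt0 ?gt_eqF.
    have -> : (K * (normal_peak s * expR (- y)) =
       4 * normal_peak 1 * expR (- y))%R by rewrite /K; field.
    rewrite expRD; set e := expR (- y).
    have e0 : (0 < e)%R by exact: expR_gt0.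
    have ye : (y * e <= 1)%R.
      rewrite /e expRN ler_pdivrMr ?expR_gt0// mul1r.
      by rewrite (le_trans _ (expR_ge1Dx y))// lerDr.
    have p1 := normal_peak_ge0 (1 : R).
    rewrite (_ : (4 * y * (_ * _) = 4 * normal_peak 1 * e * (y * e))%R); last by ring.
    by rewrite ler_piMr// !mulr_ge0// ltW.
under eq_integral do rewrite muleC.
rewrite integralZr//=; last exact: integrable_normal_pdf.
by rewrite integral_normal_pdf mul1e ltry.
Qed.

Lemma gauss_var_ext_ge0 : 0 <= gauss_var_ext.
Proof. by apply: integral_ge0 => x _; rewrite mule_ge0// lee_fin ?sqr_ge0// normal_pdf_ge0. Qed.

(** The second moment of the standard Gaussian stays an unspecified finite
constant, because all the estimates hold up to constants. *)
Definition gauss_var : R := fine gauss_var_ext.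

Lemma gauss_varE : gauss_var_ext = gauss_var%:E.
Proof. by rewrite fineK// ge0_fin_numE ?gauss_var_ext_lty// gauss_var_ext_ge0. Qed.

Lemma gauss_var_ge0 : (0 <= gauss_var)%R.
Proof. by rewrite fine_ge0// gauss_var_ext_ge0. Qed.

Lemma normal_law_sqr {d} {Omega : measurableType d} (P : probability Omega R) s Z :
  measurable_fun setT Z -> (0 < s)%R -> normal_law P s Z ->
  \int[P]_w ((Z w) ^+ 2)%:E = (gauss_var * s ^+ 2)%:E.
Proof.
move=> mZ s0 hZ.
have mx2 : measurable_fun [set: R] (fun x : R => (x ^+ 2)%:E).
  by apply/measurable_EFinP; exact: exprn_measurable.
rewrite (normal_law_integral (f := fun x => (x ^+ 2)%:E) mZ hZ)//; last first.
  by move=> x; rewrite lee_fin sqr_ge0.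
rewrite -(lebesgue_scale (c := s)) ?gt_eqF//; last 2 first.
- apply: emeasurable_funM => //; apply/measurable_EFinP; exact: measurable_normal_pdf.
- by move=> x; rewrite mule_ge0// lee_fin ?sqr_ge0// normal_pdf_ge0.
transitivity (\int[mu]_x ((s ^+ 2)%:E * ((x ^+ 2)%:E * (normal_pdf 0 1 x)%:E))).
  apply: eq_integral => x _; rewrite -!EFinM; congr EFin.
  rewrite -(normal_pdf_scale x (s := 1) (c := s)) ?gt_eqF// mulr1.
  by rewrite gtr0_norm// exprMn; ring.
rewrite ge0_integralZl//.
- by rewrite -/gauss_var_ext gauss_varE -EFinM mulrC.
- apply: emeasurable_funM => //; apply/measurable_EFinP; exact: measurable_normal_pdf.
- by move=> x _; rewrite mule_ge0// lee_fin ?sqr_ge0// normal_pdf_ge0.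
- by rewrite lee_fin sqr_ge0.
Qed.

End gaussian.

(** * Square integrable variables *)

Section same_law.
Context {d d' : measure_display} {Omega : measurableType d}
  {Omega' : measurableType d'} {R : realType}.
Variables (P : probability Omega R) (Q : probability Omega' R).

Lemma same_law_integral (Z : Omega -> R) (Z' : Omega' -> R) (f : R -> \bar R) :
  measurable_fun setT Z -> measurable_fun setT Z' ->
  (forall B : set R, measurable B -> P (Z @^-1` B) = Q (Z' @^-1` B)) ->
  measurable_fun setT f -> (forall x, (0 <= f x)%E) ->
  (\int[P]_w f (Z w) = \int[Q]_w f (Z' w))%E.
Proof.
move=> mZ mZ' h mf f0.
pose fZ : {mfun Omega >-> R} := HB.pack Z (isMeasurableFun.Build _ _ _ _ _ mZ).
pose fZ' : {mfun Omega' >-> R} := HB.pack Z' (isMeasurableFun.Build _ _ _ _ _ mZ').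
transitivity (\int[distribution P fZ]_x f x)%E.
  by rewrite ge0_integral_distribution.
transitivity (\int[distribution Q fZ']_x f x)%E; last by rewrite ge0_integral_distribution.
by apply: eq_measure_integral => A mA _; apply: h.
Qed.
End same_law.

Section L2.
Context {d : measure_display} {Omega : measurableType d} {R : realType}.
Variable P : probability Omega R.
Implicit Types f g : Omega -> R.

Definition L2 f := measurable_fun setT f /\ (\int[P]_w ((f w) ^+ 2)%:E < +oo)%E.

Notation integ f := (P.-integrable setT (fun w => (f w)%:E)).

Lemma integ_eq f g : integ f -> f =1 g -> integ g.
Proof. by move=> h /funext <-. Qed.

Lemma integ_le f g : measurable_fun setT f -> integ g ->
  (forall w, `|f w| <= g w) -> integ f.
Proof.
move=> mf ig fg; apply: le_integrable ig => //; first exact/measurable_EFinP.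
by move=> w _ /=; rewrite lee_fin (le_trans (fg w))// ler_norm.
Qed.

Lemma integ_D f g : integ f -> integ g -> integ (fun w => f w + g w).
Proof.
by move=> h1 h2; exact: (integrableD measurableT h1 h2).
Qed.

Lemma integ_Z k f : integ f -> integ (fun w => k * f w).
Proof.
by move=> h; exact: (integrableZl measurableT k h).
Qed.

Lemma integ_cst (k : R) : integ (fun _ => k).
Proof. exact: finite_measure_integrable_cst. Qed.

Lemma integ_meas f : integ f -> measurable_fun setT f.
Proof. by move=> /integrableP[/measurable_EFinP]. Qed.

Lemma integ_sum (I : Type) (s : seq I) (F : I -> Omega -> R) :
  (forall i, integ (F i)) -> integ (fun w => \sum_(i <- s) F i w).
Proof.
move=> h; elim: s => [|a s IH].
  by apply: (integ_eq (integ_cst 0)) => w; rewrite big_nil.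
apply: (integ_eq (integ_D (h a) IH)) => w.
by rewrite big_cons.
Qed.

Lemma Rint_sum (I : Type) (s : seq I) (F : I -> Omega -> R) :
  (forall i, integ (F i)) ->
  \int[P]_w (\sum_(i <- s) F i w) = \sum_(i <- s) \int[P]_w F i w.
Proof.
move=> h; elim: s => [|a s IH].
  rewrite big_nil; under eq_Rintegral do rewrite big_nil.
  by rewrite Rintegral_cst// mul0r.
rewrite big_cons -IH -RintegralD//; [|exact: h|exact: integ_sum].
by apply: eq_Rintegral => w _; rewrite big_cons.
Qed.

Lemma L2_sqr f : L2 f -> integ (fun w => f w ^+ 2).
Proof.
move=> [mf h]; apply/integrableP; split.
  by apply/measurable_EFinP; exact: measurable_funX.
by under eq_integral do rewrite /= ger0_norm ?sqr_ge0//.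
Qed.

Lemma sqr_L2 f : measurable_fun setT f -> integ (fun w => f w ^+ 2) -> L2 f.
Proof.
move=> mf /integrableP[_ h]; split => //; move: h.
by under eq_integral do rewrite /= ger0_norm ?sqr_ge0//.
Qed.

Lemma L2_le f g : measurable_fun setT f -> L2 g ->
  (forall w, `|f w| <= `|g w|) -> L2 f.
Proof.
move=> mf [mg h] fg; split => //; apply: le_lt_trans h.
apply: ge0_le_integral => //.
- by move=> w _; rewrite lee_fin sqr_ge0.
- by apply/measurable_EFinP; exact: measurable_funX.
- by apply/measurable_EFinP; exact: measurable_funX.
- move=> w _; rewrite lee_fin -(real_normK (num_real (f w))).
  by rewrite -(real_normK (num_real (g w))) lerXn2r// ?nnegrE.
Qed.

Lemma L2M f g : L2 f -> L2 g -> integ (fun w => f w * g w).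
Proof.
move=> hf hg; apply: (integ_le _ (integ_D (L2_sqr hf) (L2_sqr hg))).
  by apply: measurable_funM; [case: hf|case: hg].
move=> w; rewrite ler_norml; apply/andP; split; last by nra.
by nra.
Qed.

Lemma L2D f g : L2 f -> L2 g -> L2 (fun w => f w + g w).
Proof.
move=> hf hg; apply: sqr_L2.
  by apply: measurable_funD; [case: hf|case: hg].
have h := integ_D (integ_D (L2_sqr hf) (integ_Z 2 (L2M hf hg))) (L2_sqr hg).
apply: (integ_eq h) => w.
by rewrite sqrrD mulr_natl.
Qed.

Lemma L2Z k f : L2 f -> L2 (fun w => k * f w).
Proof.
move=> hf; apply: sqr_L2; first by apply: measurable_funM => //; case: hf.
apply: (integ_eq (integ_Z (k ^+ 2) (L2_sqr hf))) => w.
by rewrite exprMn.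
Qed.

Lemma L2B f g : L2 f -> L2 g -> L2 (fun w => f w - g w).
Proof.
move=> hf hg; have := L2D hf (L2Z (-1) hg).
by under [X in L2 X -> _]eq_fun do rewrite mulN1r.
Qed.

Lemma L2_cst k : L2 (fun _ => k).
Proof. by apply: sqr_L2 => //; exact: integ_cst. Qed.

Lemma L2_bddM (c : Omega -> R) f (M : R) : measurable_fun setT c -> (forall w, `|c w| <= M) ->
  L2 f -> L2 (fun w => c w * f w).
Proof.
move=> mc cM hf; apply: (L2_le _ (L2Z M hf)).
  by apply: measurable_funM => //; case: hf.
move=> w; rewrite !normrM ler_wpM2r// (le_trans (cM w))// ler_norm//.
Qed.

Lemma L2_integ f : L2 f -> integ f.
Proof.
move=> hf; have := L2M (L2_cst 1) hf.
by under [X in _.-integrable _ X -> _]eq_fun do rewrite mul1r.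
Qed.

Lemma L2_sum (I : Type) (s : seq I) (F : I -> Omega -> R) :
  (forall i, L2 (F i)) -> L2 (fun w => \sum_(i <- s) F i w).
Proof.
move=> h; elim: s => [|a s IH].
  by under eq_fun do rewrite big_nil; exact: L2_cst.
by under eq_fun do rewrite big_cons; exact: L2D.
Qed.

End L2.
Notation integ P f := (integrable P setT (fun w => (f w)%:E)).

Section independence.
Context {d : measure_display} {Omega : measurableType d} {R : realType}.
Variable P : probability Omega R.

Lemma symmetric_mean0 (Z : Omega -> R) : integ P Z ->
  (forall B : set R, measurable B -> P (Z @^-1` B) = P ((fun w => - Z w) @^-1` B)) ->
  \int[P]_w Z w = 0.
Proof.
move=> iZ sym; have mZ := integ_meas iZ.
have mmax : measurable_fun [set: R] (fun x : R => (Num.max x 0)%:E).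
  by apply/measurable_EFinP; exact: measurable_maxr.
have e : (\int[P]_w (Num.max (Z w) 0)%:E = \int[P]_w (Num.max (- Z w) 0)%:E)%E.
  rewrite (@same_law_integral _ _ _ _ _ P P Z (fun w => - Z w) (fun x => (Num.max x 0)%:E))//.
    exact: measurable_funN.
  by move=> x; rewrite lee_fin le_max lexx orbT.
rewrite /Rintegral integralE.
have -> : (\int[P]_x ((fun w => (Z w)%:E)^\+) x = \int[P]_w (Num.max (Z w) 0)%:E)%E.
  by apply: eq_integral => w _; rewrite funeposE /= EFin_max.
have -> : (\int[P]_x ((fun w => (Z w)%:E)^\-) x = \int[P]_w (Num.max (Z w) 0)%:E)%E.
  by rewrite e; apply: eq_integral => w _; rewrite funenegE /= EFin_max.
rewrite subee//; apply: integrable_fin_num => //.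
apply: (@integ_le _ _ _ P (fun w => Num.max (Z w) 0) (fun w => `|Z w|)).
- exact: measurable_maxr.
- exact: integrable_norm.
- by move=> w; rewrite ger0_norm ?le_max ?lexx ?orbT// ge_max ler_norm normr_ge0.
Qed.

Lemma indep_comp (G : set (set Omega)) (Z : Omega -> R) (f : R -> R) :
  measurable_fun [set: R] f -> independent_of P G Z ->
  independent_of P G (fun w => f (Z w)).
Proof.
move=> mf ind A B GA mB; apply: (ind A (f @^-1` B)) => //.
by rewrite -[X in measurable X]setTI; exact: mf.
Qed.

Variables (G : set (set Omega)) (sG : sigma_algebra setT G) (Gm : G `<=` measurable).

Lemma wrt_meas (Y : Omega -> R) : measurable_wrt G Y -> measurable_fun setT Y.
Proof.
by move=> /(measurable_wrtP _ sG) h; exact: (sub_sigma_measurable sG Gm).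
Qed.

(** Freezing is about non-negative functions, so it is applied to the four products
of positive and negative parts; [u 1] and [u (-1)] are these parts. *)
Lemma indep_expect (Y Z : Omega -> R) : measurable_wrt G Y -> integ P Y ->
  integ P Z -> independent_of P G Z ->
  integ P (fun w => Y w * Z w) /\
  \int[P]_w (Y w * Z w) = \int[P]_w Y w * \int[P]_w Z w.
Proof.
move=> GY iY iZ ind.
have mY := wrt_meas GY; have mZ := integ_meas iZ.
have GY' := (measurable_wrtP _ sG).1 GY.
pose u (s x : R) := Num.max (s * x) 0.
have mu s : measurable_fun [set: R] (u s).
  by apply: measurable_maxr => //; exact: mulrl_measurable.
have u0 s x : 0 <= u s x by rewrite le_max lexx orbT.
have split_u x : x = u 1 x - u (-1) x.
  by rewrite /u mul1r mulN1r; case: (leP x 0) => h; case: (leP (- x) 0) => h'; lra.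
have iu s (X : Omega -> R) : `|s| = 1 -> integ P X -> integ P (fun w => u s (X w)).
  move=> s1 iX; apply: (@integ_le _ _ _ P _ (fun w => `|X w|)).
  - exact: measurableT_comp (mu s) (integ_meas iX).
  - exact: integrable_norm.
  - move=> w; rewrite ger0_norm// ge_max normr_ge0 andbT.
    by rewrite (le_trans (ler_norm _))// normrM s1 mul1r.
have prod s r : `|s| = 1 -> `|r| = 1 -> integ P (fun w => u s (Y w) * u r (Z w)) /\
    \int[P]_w (u s (Y w) * u r (Z w)) = \int[P]_w u s (Y w) * \int[P]_w u r (Z w).
  move=> s1 r1; have iY' := iu s Y s1 iY; have iZ' := iu r Z r1 iZ.
  have e : (\int[P]_w (u s (Y w) * u r (Z w))%:E =
      (\int[P]_w u s (Y w) * \int[P]_w u r (Z w))%:E)%E.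
    have mg : measurable_fun [set: R * R] (fun p : R * R => (u s p.1 * u r p.2)%:E).
      by apply/measurable_EFinP; apply: measurable_funM; apply: measurableT_comp.
    rewrite (freezing (g := fun p : R * R => (u s p.1 * u r p.2)%:E) sG Gm GY' mZ ind mg _).1; last first.
      by move=> p; rewrite lee_fin mulr_ge0.
    have fZ : (\int[P]_v (u r (Z v))%:E)%E \is a fin_num by exact: integrable_fin_num.
    have fY : (\int[P]_v (u s (Y v))%:E)%E \is a fin_num by exact: integrable_fin_num.
    rewrite EFinM /Rintegral !fineK// -[X in _ = (_ * X)%E](fineK fZ) -integralZr//.
    apply: eq_integral => w _; rewrite fineK//=.
    under eq_integral do rewrite EFinM.
    rewrite ge0_integralZl//; first by apply/measurable_EFinP; exact: integ_meas iZ'.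
      by move=> v _; rewrite lee_fin.
    by rewrite lee_fin.
  split; last by rewrite [LHS]/Rintegral e.
  apply/integrableP; split.
    by apply/measurable_EFinP; apply: measurable_funM; apply: measurableT_comp.
  under eq_integral do rewrite /= ger0_norm ?mulr_ge0//.
  by rewrite e ltry.
have n1 : `|1 : R| = 1 by rewrite normr1.
have nN1 : `|-1 : R| = 1 by rewrite normrN1.
have [i1 e1] := prod 1 1 n1 n1; have [i2 e2] := prod 1 (-1) n1 nN1.
have [i3 e3] := prod (-1) 1 nN1 n1; have [i4 e4] := prod (-1) (-1) nN1 nN1.
have i12 := integ_D i1 i4; have i34 := integ_D i2 i3.
have eB (X : Omega -> R) : integ P X -> \int[P]_w X w = \int[P]_w u 1 (X w) - \int[P]_w u (-1) (X w).
  move=> iX; rewrite -RintegralB//; [|exact: iu|exact: iu].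
  by apply: eq_Rintegral => w _; rewrite -split_u.
have E w : Y w * Z w = (u 1 (Y w) * u 1 (Z w) + u (-1) (Y w) * u (-1) (Z w)) -
    (u 1 (Y w) * u (-1) (Z w) + u (-1) (Y w) * u 1 (Z w)).
  by rewrite {1}(split_u (Y w)) {1}(split_u (Z w)); ring.
have iE := integrableB measurableT i12 i34.
split; first by apply: (integ_eq (f := fun w => (_ + _) - (_ + _)) iE) => w; rewrite E.
under eq_Rintegral do rewrite E.
rewrite RintegralB// RintegralD// RintegralD//.
by rewrite e1 e2 e3 e4 (eB Y iY) (eB Z iZ); ring.
Qed.

End independence.

(** * Integrals of step processes *)

Section elementary.
Context {d : measure_display} {Omega : measurableType d} {R : realType}.
Variables (P : probability Omega R) (F : R -> set (set Omega)) (T : R)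
  (W : R -> Omega -> R).
Hypotheses (hF : filtration F T) (hW : wiener_process P F T W).
Notation mu := (@lebesgue_measure R).

Lemma Rint_zero (Y : Omega -> R) : (forall w, Y w = 0) -> \int[P]_w Y w = 0.
Proof. by move=> /funext ->; rewrite Rintegral_cst ?mul0r. Qed.

Lemma filt_sigma t : 0 <= t <= T -> sigma_algebra setT (F t).
Proof. by move=> h; case: hF => + _ _; apply; rewrite in_itv. Qed.

Lemma filt_meas t : 0 <= t <= T -> F t `<=` measurable.
Proof. by move=> h; case: hF => _ + _; apply; rewrite in_itv. Qed.

Lemma wrt_le s t (Y : Omega -> R) : 0 <= s -> s <= t -> t <= T ->
  measurable_wrt (F s) Y -> measurable_wrt (F t) Y.
Proof. by case: hF => _ _ h s0 st tT mY B mB; apply: (h s t) => //; exact: mY. Qed.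

Lemma wrt_measurable s (Y : Omega -> R) : 0 <= s <= T ->
  measurable_wrt (F s) Y -> measurable_fun setT Y.
Proof. by move=> h; apply: wrt_meas; [exact: filt_sigma|exact: filt_meas]. Qed.

Lemma wrt_M s (X Y : Omega -> R) : 0 <= s <= T ->
  measurable_wrt (F s) X -> measurable_wrt (F s) Y ->
  measurable_wrt (F s) (fun w => X w * Y w).
Proof.
move=> h /(measurable_wrtP _ (filt_sigma h)) mX /(measurable_wrtP _ (filt_sigma h)) mY.
by apply/(measurable_wrtP _ (filt_sigma h)); exact: measurable_funM.
Qed.

Lemma wrt_B s (X Y : Omega -> R) : 0 <= s <= T ->
  measurable_wrt (F s) X -> measurable_wrt (F s) Y ->
  measurable_wrt (F s) (fun w => X w - Y w).
Proof.
move=> h /(measurable_wrtP _ (filt_sigma h)) mX /(measurable_wrtP _ (filt_sigma h)) mY.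
by apply/(measurable_wrtP _ (filt_sigma h)); exact: measurable_funB.
Qed.

Lemma wrt_cst s (c : R) : 0 <= s <= T -> measurable_wrt (F s) (fun _ : Omega => c).
Proof.
by move=> h; apply/(measurable_wrtP _ (filt_sigma h)); exact: measurable_cst.
Qed.

Lemma W_wrt t : 0 <= t <= T -> measurable_wrt (F t) (W t).
Proof. by move=> h; case: hW => + _ _ _ _; apply; rewrite in_itv. Qed.

Lemma W_meas t : 0 <= t <= T -> measurable_fun setT (W t).
Proof. by move=> h; apply: (wrt_measurable h); exact: W_wrt. Qed.

Section increment.
Variables (s t : R) (s0 : 0 <= s) (st : s <= t) (tT : t <= T).
Let Z : Omega -> R := fun w => W t w - W s w.
Let s0T : 0 <= s <= T. Proof. by rewrite s0 (le_trans st). Qed.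
Let t0T : 0 <= t <= T. Proof. by rewrite tT (le_trans s0). Qed.

Lemma inc_meas : measurable_fun setT Z.
Proof. by apply: measurable_funB; exact: W_meas. Qed.

Lemma inc_wrt : measurable_wrt (F t) Z.
Proof.
by apply: wrt_B => //; [exact: W_wrt|apply: (wrt_le s0 st tT); exact: W_wrt].
Qed.

Lemma inc_law : s < t -> normal_law P (Num.sqrt (t - s)) Z.
Proof. by move=> st'; case: hW => _ _ _ h _; exact: h. Qed.

Lemma inc_sqr_e : (\int[P]_w ((Z w) ^+ 2)%:E = (gauss_var * (t - s))%:E)%E.
Proof.
move: st; rewrite le_eqVlt => /orP[/eqP e|st'].
  rewrite (eq_integral (cst 0)%E) ?integral0 ?e ?subrr ?mulr0// => w _.
  by rewrite /Z e subrr expr0n.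
rewrite (normal_law_sqr inc_meas _ (inc_law st')) ?sqrtr_gt0 ?subr_gt0//.
by rewrite sqr_sqrtr// subr_ge0.
Qed.

Lemma inc_L2 : L2 P Z.
Proof. by split; [exact: inc_meas|rewrite inc_sqr_e ltry]. Qed.

Lemma inc_indep : s < t -> independent_of P (F s) Z.
Proof. by move=> st'; case: hW => _ _ _ _ h; exact: h. Qed.

Lemma inc_mean0 (Y : Omega -> R) : measurable_wrt (F s) Y -> integ P Y ->
  integ P (fun w => Y w * Z w) /\ \int[P]_w (Y w * Z w) = 0.
Proof.
move=> mY iY; move: st; rewrite le_eqVlt => /orP[/eqP e|st'].
  have -> : (fun w => (Y w * Z w)%:E) = fun=> 0%:E.
    by apply/funext => w; rewrite /Z e subrr mulr0.
  split; first exact: integ_cst.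
  by apply: Rint_zero => w; rewrite /Z e subrr mulr0.
have Z0 : \int[P]_w Z w = 0.
  apply: symmetric_mean0 => [|D mD]; first exact/L2_integ/inc_L2.
  rewrite (inc_law st')//.
  have sq0 : 0 < Num.sqrt (t - s) by rewrite sqrtr_gt0 subr_gt0.
  have := @normal_law_scale _ _ _ P _ (-1) _ inc_meas sq0 _ (inc_law st').
  rewrite normrN1 mul1r => H.
  have -> : (fun w => - Z w) = (fun w => -1 * Z w).
    by apply/funext => w; rewrite mulN1r.
  by rewrite H// oppr_eq0 oner_eq0.
have [iYZ e] := indep_expect (filt_sigma s0T) (filt_meas s0T) mY iY (L2_integ inc_L2) (inc_indep st').
by split => //; rewrite e Z0 mulr0.
Qed.

Lemma inc_sqr (Y : Omega -> R) M : measurable_wrt (F s) Y -> (forall w, `|Y w| <= M) ->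
  \int[P]_w (Y w * Z w ^+ 2) = gauss_var * ((\int[P]_w Y w) * (t - s)).
Proof.
move=> mY YM; move: st; rewrite le_eqVlt => /orP[/eqP e|st'].
  rewrite Rint_zero ?e ?subrr ?mulr0// => w.
  by rewrite /Z e subrr expr0n mulr0.
have iY : integ P Y.
  by apply: (integ_le _ (integ_cst P M)) => //; exact: (wrt_measurable s0T mY).
have ind := indep_comp (@exprn_measurable R setT 2) (inc_indep st').
rewrite (indep_expect (filt_sigma s0T) (filt_meas s0T) mY iY (L2_sqr inc_L2) ind).2.
by rewrite [X in _ * X]/Rintegral inc_sqr_e /= mulrCA.
Qed.

End increment.

(** The process with value [ev] on ]ea, eb] and 0 elsewhere. Empty intervals are
allowed, and [ev] need be known at time [ea] only when the interval is not
empty: thus the type is stable by restriction to a subinterval, which may move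
[ea] back to a time before [ev] is known. *)
Record elem := Elem {
  ea : R; eb : R; ev : Omega -> R;
  ea_ge0 : 0 <= ea; ea_le : ea <= eb; eb_le : eb <= T;
  ev_wrt : ea < eb -> measurable_wrt (F ea) ev;
  ev_meas : measurable_fun setT ev;
  ev_bdd : exists M, forall w, `|ev w| <= M }.

Implicit Types (e : elem) (l : seq elem).

Definition elem_inc e w := ev e w * (W (eb e) w - W (ea e) w).
Definition step_int l w := \sum_(e <- l) elem_inc e w.
Definition step_proc l s w := \sum_(e <- l) \1_(`]ea e, eb e]%classic) s * ev e w.
Definition overlap e1 e2 :=
  Num.max 0 (Num.min (eb e1) (eb e2) - Num.max (ea e1) (ea e2)).

Lemma ea_itv e : 0 <= ea e <= T.
Proof. by rewrite ea_ge0 (le_trans (ea_le e))// eb_le. Qed.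

Lemma elem_inc_L2 e : L2 P (elem_inc e).
Proof.
have [M hM] := ev_bdd e.
apply: (L2_bddM (ev_meas e) hM).
by apply: inc_L2; [exact: ea_ge0|exact: ea_le|exact: eb_le].
Qed.

Lemma step_int_L2 l : L2 P (step_int l).
Proof. by apply: L2_sum => e; exact: elem_inc_L2. Qed.

Lemma overlapC e1 e2 : overlap e1 e2 = overlap e2 e1.
Proof. by rewrite /overlap minC [Num.max (ea _) _]maxC. Qed.

(** The endpoints split the product of the two increments into a square over
the overlap of the intervals, which contributes its length, and products of an
increment with a variable known before it, which have mean 0. *)
Lemma elem_inc_pair_le e1 e2 : ea e1 <= ea e2 ->
  \int[P]_w (elem_inc e1 w * elem_inc e2 w) = gauss_var * ((\int[P]_w (ev e1 w * ev e2 w)) * overlap e1 e2).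
Proof.
case: e1 => a1 b1 v1 a10 ab1 b1T v1w v1m [M1 vM1].
case: e2 => a2 b2 v2 a20 ab2 b2T v2w v2m [M2 vM2].
rewrite /overlap /elem_inc /= => a12; rewrite (max_r a12).
move: (ab1); rewrite le_eqVlt => /orP[/eqP e1|lt1].
  rewrite Rint_zero; last by move=> w; rewrite -e1 subrr mulr0 mul0r.
  by rewrite max_l ?mulr0// subr_le0 ge_min -e1 a12.
move: (ab2); rewrite le_eqVlt => /orP[/eqP e2|lt2].
  rewrite Rint_zero; last by move=> w; rewrite -e2 subrr !mulr0.
  by rewrite max_l ?mulr0// subr_le0 ge_min -e2 lexx orbT.
have a2T : 0 <= a2 <= T by rewrite a20 (le_trans ab2).
pose z w := v1 w * v2 w.
have zw : measurable_wrt (F a2) z.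
  apply: wrt_M => //; last exact: v2w.
  by apply: (wrt_le a10 a12) => //; [case/andP: a2T|exact: v1w].
have zm := wrt_measurable a2T zw.
have zM w : `|z w| <= M1 * M2 by rewrite normrM ler_pM.
have [b1a2|a2b1] := leP b1 a2.
  rewrite max_l; last by rewrite subr_le0 ge_min b1a2.
  rewrite !mulr0.
  under eq_Rintegral => w _ do rewrite mulrACA mulrA.
  have b1i : 0 <= b1 <= T by rewrite b1T (le_trans a10).
  apply: (inc_mean0 a20 ab2 b2T _ _).2.
    by apply: wrt_M => //; apply: (wrt_le _ b1a2) => //; [case/andP: b1i|case/andP: a2T|exact: inc_wrt].
  by apply: L2_integ; apply: (L2_bddM zm zM); exact: inc_L2.
(* The intervals overlap on ]a2, m]; after [m], only one of them goes on, up to [M]. *)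
pose m := Num.min b1 b2; pose M := Num.max b1 b2.
have a2m : a2 <= m by rewrite le_min (ltW a2b1) ab2.
have mM : m <= M by rewrite ge_min le_max lexx.
have MT : M <= T by rewrite ge_max b1T.
have mT : m <= T := le_trans mM MT.
have m0 : 0 <= m := le_trans a20 a2m.
rewrite max_r ?subr_ge0//.
pose A w := z w * (W a2 w - W a1 w).
pose B w := z w * (W m w - W a2 w).
have decomp w : v1 w * (W b1 w - W a1 w) * (v2 w * (W b2 w - W a2 w)) =
   A w * (W b2 w - W a2 w) + (z w * (W m w - W a2 w) ^+ 2 + B w * (W M w - W m w)).
  rewrite /A /B /z /m /M; case: (leP b1 b2) => _; ring.
have LA : L2 P A by apply: (L2_bddM zm zM); apply: inc_L2 => //; case/andP: a2T.
have LB : L2 P B by apply: (L2_bddM zm zM); exact: inc_L2.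
have [iA A0] : integ P (fun w => A w * (W b2 w - W a2 w)) /\ \int[P]_w (A w * (W b2 w - W a2 w)) = 0.
  apply: inc_mean0 => //; last exact: L2_integ.
  by apply: wrt_M => //; apply: inc_wrt => //; case/andP: a2T.
have [iB B0] : integ P (fun w => B w * (W M w - W m w)) /\ \int[P]_w (B w * (W M w - W m w)) = 0.
  apply: inc_mean0 => //; last exact: L2_integ.
  apply: wrt_M; first by rewrite m0 mT.
    exact: (wrt_le a20 a2m mT zw).
  exact: inc_wrt.
have iC : integ P (fun w => z w * (W m w - W a2 w) ^+ 2).
  have := L2M LB (inc_L2 a20 a2m mT).
  by under [X in _.-integrable _ X -> _]eq_fun do rewrite -mulrA -expr2.
under eq_Rintegral do rewrite decomp.
rewrite RintegralD//; last exact: integ_D.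
rewrite RintegralD// A0 B0 add0r addr0.
by rewrite (inc_sqr a20 a2m mT zw zM).
Qed.

Lemma elem_inc_pair e1 e2 :
  \int[P]_w (elem_inc e1 w * elem_inc e2 w) = gauss_var * ((\int[P]_w (ev e1 w * ev e2 w)) * overlap e1 e2).
Proof.
have [h|h] := leP (ea e1) (ea e2); first exact: elem_inc_pair_le.
under eq_Rintegral do rewrite mulrC.
rewrite elem_inc_pair_le ?ltW// overlapC; congr (_ * (_ * _)).
by apply: eq_Rintegral => w _; rewrite mulrC.
Qed.

Lemma ev_pair_integ e1 e2 : integ P (fun w => ev e1 w * ev e2 w).
Proof.
have [M1 h1] := ev_bdd e1; have [M2 h2] := ev_bdd e2.
apply: (integ_le _ (integ_cst P (M1 * M2))).
  by apply: measurable_funM; exact: ev_meas.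
by move=> w; rewrite normrM ler_pM.
Qed.

(** Pairing the intervals through the length of their overlap yields the
isometry for arbitrary lists, with no common subdivision of the intervals. *)
Definition energy l : R :=
  \sum_(e1 <- l) \sum_(e2 <- l) (\int[P]_w (ev e1 w * ev e2 w)) * overlap e1 e2.

Lemma step_int_sqr l : \int[P]_w (step_int l w ^+ 2) = gauss_var * energy l.
Proof.
have E w : step_int l w ^+ 2 = \sum_(e1 <- l) \sum_(e2 <- l) elem_inc e1 w * elem_inc e2 w.
  by rewrite /step_int expr2 big_distrlr.
under eq_Rintegral do rewrite E.
have i e1 e2 : integ P (fun w => elem_inc e1 w * elem_inc e2 w).
  by apply: L2M; exact: elem_inc_L2.
rewrite Rint_sum => [|e1]; last exact: integ_sum.
rewrite /energy mulr_sumr; apply: eq_bigr => e1 _.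
rewrite Rint_sum// mulr_sumr; apply: eq_bigr => e2 _.
exact: elem_inc_pair.
Qed.

Lemma overlapE e1 e2 :
  (\int[mu]_(s in `[0%R, T]) (\1_(`]ea e1, eb e1]%classic) s * \1_(`]ea e2, eb e2]%classic) s)%:E
   = (overlap e1 e2)%:E)%E.
Proof.
transitivity (\int[mu]_(s in `[0%R, T])
    (\1_(`]ea e1, eb e1]%classic `&` `]ea e2, eb e2]%classic) s)%:E)%E.
  by apply: eq_integral => s _; rewrite indicI.
rewrite integral_indic//; last exact: measurableI.
transitivity (mu `]Num.max (ea e1) (ea e2), Num.min (eb e1) (eb e2)]%classic).
  congr (mu _); apply/seteqP; split => s /=; rewrite !in_itv/=.
    move=> [[/andP[h1 h2] /andP[h3 h4]] _].
    have k1 : Num.max (ea e1) (ea e2) < s by rewrite gt_max h1 h3.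
    have k2 : s <= Num.min (eb e1) (eb e2) by rewrite le_min h2 h4.
    by rewrite k1 k2.
  rewrite gt_max le_min => /andP[/andP[h1 h3] /andP[h2 h4]].
  rewrite h1 h2 h3 h4; split => //.
  by rewrite (le_trans (ea_ge0 e1) (ltW h1)) (le_trans h2 (eb_le e1)).
rewrite lebesgue_measure_itv/= lte_fin /overlap.
set a := Num.max (ea _) _; set b := Num.min _ _.
case: (ltP a b) => h; first by rewrite -EFinD (max_r (x := 0))// subr_ge0 ltW.
by rewrite (max_l (x := 0))// subr_le0.
Qed.

Lemma step_proc_sqr_path l w :
  (\int[mu]_(s in `[0%R, T]) ((step_proc l s w) ^+ 2)%:E =
   (\sum_(e1 <- l) \sum_(e2 <- l) ev e1 w * ev e2 w * overlap e1 e2)%:E)%E.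
Proof.
pose h e1 e2 s := (\1_(`]ea e1, eb e1]%classic) s * \1_(`]ea e2, eb e2]%classic) s : R).
have E s : ((step_proc l s w) ^+ 2)%:E =
   (\sum_(e1 <- l) \sum_(e2 <- l) (ev e1 w * ev e2 w)%:E * (h e1 e2 s)%:E)%E.
  rewrite /step_proc expr2 big_distrlr /= -sumEFin; apply: eq_bigr => e1 _.
  rewrite -sumEFin; apply: eq_bigr => e2 _.
  by rewrite -EFinM; congr EFin; rewrite /h; ring.
have ih e1 e2 : mu.-integrable `[0%R, T] (fun s => (h e1 e2 s)%:E).
  apply/integrableP; split.
    by apply/measurable_EFinP; apply: measurable_funM; exact: measurable_indic.
  have h0 s : 0 <= h e1 e2 s by rewrite mulr_ge0// indicE.
  by under eq_integral do rewrite /= ger0_norm//; rewrite /h overlapE ltry.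
have ih' e1 e2 : mu.-integrable `[0%R, T] (fun s => (ev e1 w * ev e2 w)%:E * (h e1 e2 s)%:E)%E.
  exact: integrableZl.
under eq_integral do rewrite E.
rewrite integral_sum// => [|e1]; last exact: integrable_sum.
rewrite -sumEFin; apply: eq_bigr => e1 _.
rewrite integral_sum// -sumEFin; apply: eq_bigr => e2 _.
by rewrite integralZl// /h overlapE.
Qed.

Lemma step_proc_sqr l :
  (\int[P]_w \int[mu]_(s in `[0%R, T]) ((step_proc l s w) ^+ 2)%:E = (energy l)%:E)%E.
Proof.
under eq_integral do rewrite step_proc_sqr_path.
have i e1 e2 : integ P (fun w => ev e1 w * ev e2 w * overlap e1 e2).
  have := integ_Z (overlap e1 e2) (ev_pair_integ e1 e2).
  by under [X in _.-integrable _ X -> _]eq_fun do rewrite mulrC.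
have i2 e1 : integ P (fun w => \sum_(e2 <- l) ev e1 w * ev e2 w * overlap e1 e2).
  exact: integ_sum.
rewrite -[LHS]fineK; last first.
  by apply: (@integrable_fin_num _ _ _ P setT) => //; exact: integ_sum.
congr EFin; rewrite -[LHS]/(\int[P]_w _)%R Rint_sum//.
apply: eq_bigr => e1 _; rewrite Rint_sum//; apply: eq_bigr => e2 _.
by rewrite RintegralZr//; exact: ev_pair_integ.
Qed.

Lemma step_isometry l :
  (\int[P]_w ((step_int l w) ^+ 2)%:E =
   gauss_var%:E * \int[P]_w \int[mu]_(s in `[0%R, T]) ((step_proc l s w) ^+ 2)%:E)%E.
Proof.
rewrite step_proc_sqr -EFinM -step_int_sqr /Rintegral fineK//.
by apply: integrable_fin_num => //; exact/L2_sqr/step_int_L2.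
Qed.

End elementary.

(** * Joint measurability and Tonelli *)

(** Processes are measurable over a set [A] of times only, so that Tonelli's
theorem applies to their extension by 0. *)
Section tonelli.
Context {d : measure_display} {Omega : measurableType d} {R : realType}.
Variables (P : probability Omega R).
Notation mu := (@lebesgue_measure R).
Local Open Scope ereal_scope.
Variables (A : set R) (mA : measurable A) (g : R -> Omega -> \bar R).
Hypothesis mg : measurable_fun (A `*` [set: Omega]) (fun p : R * Omega => g p.1 p.2).
Hypothesis g0 : forall s w, 0 <= g s w.

Let gp := (fun p : R * Omega => g p.1 p.2) \_ (A `*` [set: Omega]).

Let mgp : measurable_fun [set: measurableTypeR R * Omega] gp.
Proof.
have mAT : measurable (A `*` [set: Omega] : set (R * Omega)).
  exact: measurableX.
exact: ((measurable_restrictT (fun p : R * Omega => g p.1 p.2) mAT).1 mg).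
Qed.

Let gp0 p : 0 <= gp p.
Proof. by rewrite /gp patchE; case: ifPn. Qed.

Let gpE s w : gp (s, w) = (g ^~ w \_ A) s.
Proof.
rewrite /gp !patchE; case: ifPn; rewrite ?inE ?notin_setE /= => h.
  by rewrite ifT// inE; case: h.
by rewrite ifF//; apply/negbTE; rewrite notin_setE => h'; apply: h.
Qed.

Lemma tonelli_meas_w : measurable_fun setT (fun w => \int[mu]_(s in A) g s w).
Proof.
have := measurable_fun_fubini_tonelli_G (m1 := mu) gp mgp gp0.
apply: eq_measurable_fun => w _; rewrite /fubini_G [RHS]integral_mkcond.
by apply: eq_integral => s _; rewrite gpE.
Qed.

Lemma tonelli_meas_s : measurable_fun A (fun s => \int[P]_w g s w).
Proof.
have h := measurable_fun_fubini_tonelli_F (m2 := P) gp mgp gp0.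
apply: (eq_measurable_fun (fubini_F P gp)); last exact: measurable_funTS h.
move=> s /set_mem sA; rewrite /fubini_F.
by apply: eq_integral => w _; rewrite gpE patchE mem_set.
Qed.

Lemma tonelli_section w : measurable_fun A (g ^~ w).
Proof.
suff h : measurable_fun [set: R] (g ^~ w \_ A).
  exact: ((measurable_restrictT (g ^~ w) mA).2 h).
apply: (eq_measurable_fun (gp \o (fun s => (s, w)))).
  by move=> s _; rewrite /= gpE.
exact: (measurableT_comp mgp (@measurable_pair2 _ _ (measurableTypeR R) Omega w)).
Qed.

Lemma tonelli_swap :
  \int[P]_w \int[mu]_(s in A) g s w = \int[mu]_(s in A) \int[P]_w g s w.
Proof.
transitivity (\int[P]_w \int[mu]_s gp (s, w)).
  apply: eq_integral => w _; rewrite [LHS]integral_mkcond.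
  by apply: eq_integral => s _; rewrite gpE.
rewrite -(fubini_tonelli (m1 := mu) (m2 := P) gp)// [RHS]integral_mkcond.
apply: eq_integral => s _; rewrite patchE; case: ifPn => sA.
  by apply: eq_integral => w _; rewrite gpE patchE sA.
rewrite (eq_integral (cst 0)) ?integral0// => w _.
by rewrite gpE patchE (negbTE sA).
Qed.

End tonelli.

(** * Restricted step processes and simple processes *)

Lemma le_of_steps {R : numDomainType} (n : nat) (t : nat -> R) :
  (forall i, (i < n)%N -> t i <= t i.+1) ->
  forall i j, (i <= j)%N -> (j <= n)%N -> t i <= t j.
Proof.
move=> h i; elim=> [|j IH]; first by rewrite leqn0 => /eqP ->.
rewrite leq_eqVlt => /orP[/eqP ->//|ij] jn.
by rewrite (le_trans (IH ij (ltnW jn)))// h.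
Qed.

Section ito.
Context {d : measure_display} {Omega : measurableType d} {R : realType}.
Variables (P : probability Omega R) (F : R -> set (set Omega)) (T : R)
  (W : R -> Omega -> R).
Hypotheses (hF : filtration F T) (hW : wiener_process P F T W).
Notation mu := (@lebesgue_measure R).
Notation elem := (elem F T).
Implicit Types (e : elem) (l : seq elem).

Definition clamp (s t x : R) := Num.max s (Num.min x t).

Lemma clamp_homo s t x y : x <= y -> clamp s t x <= clamp s t y.
Proof.
move=> xy; rewrite /clamp ge_max !le_max lexx /=; apply/orP; right.
by rewrite le_min ge_min xy ge_min lexx !orbT.
Qed.

Lemma clamp_ge s t x : s <= clamp s t x. Proof. by rewrite le_max lexx. Qed.
Lemma clamp_le s t x : s <= t -> clamp s t x <= t.
Proof. by move=> st; rewrite ge_max st ge_min lexx orbT. Qed.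

Lemma clamp_ltP s t x y : s <= t -> x <= y -> clamp s t x < clamp s t y ->
  x < y /\ x <= clamp s t x.
Proof.
move=> st xy; rewrite /clamp.
case: (leP x t) => hx; case: (leP y t) => hy; rewrite ?ltxx//.
- rewrite lt_max !gt_max; case/orP => /andP[h1 h2]; first by rewrite ltxx in h1.
  by rewrite h2 le_max lexx orbT.
- by move=> _; rewrite (le_lt_trans hx hy) le_max lexx orbT.
- by exfalso; lra.
Qed.

Section clampE.
Variables (s t : R) (s0 : 0 <= s) (st : s <= t) (tT : t <= T).

Lemma clampE_wrt e : clamp s t (ea e) < clamp s t (eb e) ->
  measurable_wrt (F (clamp s t (ea e))) (ev e).
Proof.
move=> h; have [h1 h2] := clamp_ltP st (ea_le e) h.
apply: (wrt_le hF (ea_ge0 e) h2 (le_trans (clamp_le _ st) tT)).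
exact: ev_wrt.
Qed.

(** Restriction of an elementary process to ]s, t]: both endpoints are clamped. *)
Definition clampE e : elem :=
  Elem (le_trans s0 (clamp_ge s t (ea e))) (clamp_homo s t (ea_le e))
    (le_trans (clamp_le _ st) tT) (@clampE_wrt e) (ev_meas e) (ev_bdd e).

Lemma W_clamp x w : W (clamp s t x) w = W (Num.min t x) w - W (Num.min s x) w + W s w.
Proof.
rewrite /clamp; case: (leP x t) => xt; case: (leP s x) => sx;
  rewrite ?(max_r st); try ring.
by have := lt_trans xt (lt_le_trans sx st); rewrite ltxx.
Qed.

Lemma ind_clamp e u : \1_(`]ea (clampE e), eb (clampE e)]%classic) u =
  \1_(`]s, t]%classic) u * \1_(`]ea e, eb e]%classic) u :> R.
Proof.
rewrite !indicE !mem_setE -natrM mulnb; congr (_ %:R); congr nat_of_bool.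
rewrite !in_itv /= /clamp gt_max le_max gt_min le_min.
by apply/idP/idP => H; lra.
Qed.

End clampE.

Section negE.
Variable e : elem.
Lemma negE_wrt : ea e < eb e -> measurable_wrt (F (ea e)) (fun w => - ev e w).
Proof.
move=> h; have /(measurable_wrtP _ (filt_sigma hF (ea_itv e))) m := ev_wrt h.
by apply/(measurable_wrtP _ (filt_sigma hF (ea_itv e))); exact: measurable_funN.
Qed.
Lemma negE_meas : measurable_fun setT (fun w => - ev e w).
Proof. by apply: measurable_funN; exact: ev_meas. Qed.
Lemma negE_bdd : exists M, forall w, `| - ev e w| <= M.
Proof. by have [M h] := ev_bdd e; exists M => w; rewrite normrN. Qed.
Definition negE : elem := Elem (ea_ge0 e) (ea_le e) (eb_le e) negE_wrt negE_meas negE_bdd.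
End negE.

Lemma step_int_cat l1 l2 w : step_int W (l1 ++ l2) w = step_int W l1 w + step_int W l2 w.
Proof. by rewrite /step_int big_cat. Qed.

Lemma step_int_neg l w : step_int W (map negE l) w = - step_int W l w.
Proof.
by rewrite /step_int big_map -sumrN; apply: eq_bigr => e _; rewrite /elem_inc /= mulNr.
Qed.

Lemma step_proc_cat l1 l2 s w : step_proc (l1 ++ l2) s w = step_proc l1 s w + step_proc l2 s w.
Proof. by rewrite /step_proc big_cat. Qed.

Lemma step_proc_neg l s w : step_proc (map negE l) s w = - step_proc l s w.
Proof.
by rewrite /step_proc big_map -sumrN; apply: eq_bigr => e _; rewrite /= mulrN.
Qed.

Section stopped.
Variables (s t : R) (s0 : 0 <= s) (st : s <= t) (tT : t <= T).

Definition clampL l : seq elem := map (clampE s0 st tT) l.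

Lemma step_proc_clamp l u w : step_proc (clampL l) u w = \1_(`]s, t]%classic) u * step_proc l u w.
Proof.
rewrite /step_proc big_map mulr_sumr; apply: eq_bigr => e _.
by rewrite (ind_clamp s0 st tT) mulrA.
Qed.

Lemma step_int_clamp l w : step_int W (clampL l) w = \sum_(e <- l) ev e w *
   ((W (Num.min t (eb e)) w - W (Num.min t (ea e)) w) -
    (W (Num.min s (eb e)) w - W (Num.min s (ea e)) w)).
Proof.
rewrite /step_int big_map; apply: eq_bigr => e _; rewrite /elem_inc /= !W_clamp//.
by congr (_ * _); ring.
Qed.

End stopped.

Lemma step_int_wrt l t : 0 <= t <= T -> (forall e, List.In e l -> eb e <= t) ->
  measurable_wrt (F t) (step_int W l).
Proof.
move=> tT; elim: l => [|e l IH] h.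
  rewrite (_ : step_int W [::] = fun=> 0); first exact: (wrt_cst hF).
  by apply/funext => w; rewrite /step_int big_nil.
rewrite (_ : step_int W (e :: l) = fun w => elem_inc W e w - - step_int W l w); last first.
  by apply/funext => w; rewrite /step_int big_cons opprK.
apply: (wrt_B hF) => //; last first.
  have -> : (fun w => - step_int W l w) = (fun w => 0 - step_int W l w).
    by apply/funext => w; rewrite sub0r.
  apply: (wrt_B hF) => //; first exact: (wrt_cst hF).
  by apply: IH => e' h'; apply: h; right.
have ebt : eb e <= t by apply: h; left.
have tT' : t <= T by case/andP: tT.
have [lt|ge] := ltP (ea e) (eb e); last first.
  have eab : ea e = eb e by apply/eqP; rewrite eq_le ge ea_le.
  rewrite (_ : elem_inc W e = fun=> 0); first exact: (wrt_cst hF).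
  by apply/funext => w; rewrite /elem_inc eab subrr mulr0.
apply: (wrt_M hF) => //.
  apply: (wrt_le hF (ea_ge0 e) (le_trans (ea_le e) ebt) tT').
  exact: ev_wrt.
apply: (wrt_le hF (le_trans (ea_ge0 e) (ea_le e)) ebt tT').
by apply: (inc_wrt hF hW); [exact: ea_ge0|exact: ea_le|exact: eb_le].
Qed.

Lemma step_proc_meas l : measurable_fun [set: R * Omega] (fun p => step_proc l p.1 p.2).
Proof.
apply: measurable_sum => e; apply: measurable_funM.
  by apply: measurableT_comp => //; exact: measurable_indic.
by apply: measurableT_comp => //; exact: ev_meas.
Qed.

Section simple.
Variables (phi : simple_process) (wf : simple_wf F T phi).

Lemma sp_le i j : (i <= j)%N -> (j <= sp_size phi)%N -> sp_time phi i <= sp_time phi j.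
Proof.
case: wf => _ _ h _ _; apply: (le_of_steps (t := sp_time phi)) => k kn.
exact/ltW/h.
Qed.

Lemma sp_ge0 i : (i <= sp_size phi)%N -> 0 <= sp_time phi i.
Proof. by move=> h; have := sp_le (leq0n i) h; case: wf => ->. Qed.

Lemma sp_leT i : (i <= sp_size phi)%N -> sp_time phi i <= T.
Proof. by move=> h; have := sp_le h (leqnn _); case: wf => _ ->. Qed.

Section simple_elem.
Variable i : 'I_(sp_size phi).
Lemma simple_elem_le : sp_time phi i <= sp_time phi i.+1.
Proof. exact: sp_le. Qed.
Lemma simple_elem_wrt : measurable_wrt (F (sp_time phi i)) (sp_val phi i).
Proof. by case: wf => _ _ _ + _; apply. Qed.
Lemma simple_elem_meas : measurable_fun setT (sp_val phi i).
Proof.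
apply: (wrt_measurable hF _ simple_elem_wrt).
by rewrite sp_ge0 ?sp_leT// ltnW.
Qed.
Lemma simple_elem_bdd : exists M, forall w, `|sp_val phi i w| <= M.
Proof. by case: wf => _ _ _ _; apply. Qed.
Definition simple_elem : elem := Elem (sp_ge0 (ltnW (ltn_ord i))) simple_elem_le
  (sp_leT (ltn_ord i)) (fun _ => simple_elem_wrt) simple_elem_meas simple_elem_bdd.
End simple_elem.

Definition simple_elems := map simple_elem (index_enum 'I_(sp_size phi)).

Lemma step_proc_elems s w : step_proc simple_elems s w = simple_fun phi s w.
Proof. by rewrite /step_proc big_map. Qed.

Lemma step_int_elems s t (s0 : 0 <= s) (st : s <= t) (tT : t <= T) w :
  step_int W (clampL s0 st tT simple_elems) w = simple_integral W phi t w - simple_integral W phi s w.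
Proof.
rewrite step_int_clamp big_map /simple_integral -sumrB; apply: eq_bigr => i _ /=.
by rewrite mulrBr.
Qed.
End simple.

End ito.

(** * Mean square norms *)

Section E2.
Context {d : measure_display} {Omega : measurableType d} {R : realType}.
Variables (P : probability Omega R) (T : R).
Notation mu := (@lebesgue_measure R).
Local Open Scope ereal_scope.

(** Mean square norms take extended real values, so that bounds can be chained
before anything is known to be finite. *)
Definition E2 (f : Omega -> R) := \int[P]_w ((f w) ^+ 2)%:E.
Definition D2 (K : R -> Omega -> R) :=
  \int[P]_w \int[mu]_(s in `[0%R, T]) ((K s w) ^+ 2)%:E.
Definition joint_meas (K : R -> Omega -> R) :=
  measurable_fun (`[0%R, T]%classic `*` [set: Omega])
     (fun p : R * Omega => K p.1 p.2).

Lemma E2_ge0 f : 0 <= E2 f.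
Proof. by apply: integral_ge0 => w _; rewrite lee_fin sqr_ge0. Qed.

Lemma D2_ge0 f : 0 <= D2 f.
Proof.
by apply: integral_ge0 => w _; apply: integral_ge0 => s _; rewrite lee_fin sqr_ge0.
Qed.

Lemma msqr {d'} {T' : measurableType d'} (D : set T') (f : T' -> R) :
  measurable_fun D f -> measurable_fun D (fun w => ((f w) ^+ 2)%:E).
Proof. by move=> mf; apply/measurable_EFinP; exact: measurable_funX. Qed.

Lemma E2_le2 (f g h : Omega -> R) : measurable_fun setT f -> measurable_fun setT g ->
  measurable_fun setT h ->
  (forall w, (f w ^+ 2 <= 2 * g w ^+ 2 + 2 * h w ^+ 2)%R) ->
  E2 f <= 2%:E * E2 g + 2%:E * E2 h.
Proof.
move=> mf mg mh fgh; rewrite /E2.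
have g0 (f' : Omega -> R) w : [set: Omega] w -> 0 <= ((f' w) ^+ 2)%:E by rewrite lee_fin sqr_ge0.
rewrite -ge0_integralZl//; [|exact: msqr|exact: g0].
rewrite -ge0_integralZl//; [|exact: msqr|exact: g0].
have M (f' : Omega -> R) : measurable_fun setT f' -> measurable_fun setT (fun x => 2%:E * ((f' x) ^+ 2)%:E).
  move=> m; have := msqr m => msq.
  by apply: emeasurable_funM => //; exact: measurable_cst.
rewrite -ge0_integralD//; try by move=> w _; rewrite mule_ge0// lee_fin sqr_ge0.
- apply: ge0_le_integral => //.
  + exact: g0.
  + exact: msqr.
  + by apply: emeasurable_funD; exact: M.
  + by move=> w _; rewrite -!EFinM -EFinD lee_fin fgh.
- exact: M.
- exact: M.
Qed.

Lemma jmsqr K : joint_meas K -> measurable_fun (`[0%R, T]%classic `*` [set: Omega])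
     (fun p : R * Omega => ((K p.1 p.2) ^+ 2)%:E).
Proof. by move=> h; exact: msqr. Qed.

Let sq0 (K : R -> Omega -> R) s w : 0 <= ((K s w) ^+ 2)%:E.
Proof. by rewrite lee_fin sqr_ge0. Qed.
Let mIT : measurable (`[0%R, T]%classic : set R). Proof. by []. Qed.

Lemma D2_meas K : joint_meas K ->
  measurable_fun setT (fun w => \int[mu]_(s in `[0%R, T]) ((K s w) ^+ 2)%:E).
Proof.
move=> h; apply: (tonelli_meas_w mIT (g := fun s w => ((K s w) ^+ 2)%:E)) => //.
exact: jmsqr.
Qed.

Lemma D2_sec K w : joint_meas K -> measurable_fun (`[0%R, T]) (fun s => ((K s w) ^+ 2)%:E).
Proof.
move=> h; apply: (tonelli_section mIT (g := fun s w => ((K s w) ^+ 2)%:E)) => //.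
exact: jmsqr.
Qed.

Lemma D2_swap K : joint_meas K ->
  D2 K = \int[mu]_(s in `[0%R, T]) E2 (K s).
Proof.
move=> h; apply: (tonelli_swap P mIT (g := fun s w => ((K s w) ^+ 2)%:E)) => //.
exact: jmsqr.
Qed.

Lemma D2_le2 (f g h : R -> Omega -> R) : joint_meas f -> joint_meas g -> joint_meas h ->
  (forall s w, (f s w ^+ 2 <= 2 * g s w ^+ 2 + 2 * h s w ^+ 2)%R) ->
  D2 f <= 2%:E * D2 g + 2%:E * D2 h.
Proof.
move=> mf mg mh fgh; rewrite /D2.
have i0 (K : R -> Omega -> R) w : [set: Omega] w -> 0 <= \int[mu]_(s in `[0%R, T]) ((K s w) ^+ 2)%:E.
  by move=> _; apply: integral_ge0.
rewrite -ge0_integralZl//; [|exact: D2_meas|exact: i0].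
rewrite -ge0_integralZl//; [|exact: D2_meas|exact: i0].
have M K : joint_meas K -> measurable_fun setT (fun w => 2%:E * \int[mu]_(s in `[0%R, T]) ((K s w) ^+ 2)%:E).
  by move=> m; apply: emeasurable_funM; [exact: measurable_cst|exact: D2_meas].
rewrite -ge0_integralD//; try by move=> w _; rewrite mule_ge0//; apply: integral_ge0.
- apply: ge0_le_integral => //.
  + exact: i0.
  + exact: D2_meas.
  + by apply: emeasurable_funD; exact: M.
  + move=> w _.
    rewrite -ge0_integralZl//; last exact: D2_sec.
    rewrite -ge0_integralZl//; last exact: D2_sec.
    have M' K : joint_meas K -> measurable_fun (`[0%R, T]) (fun s => 2%:E * ((K s w) ^+ 2)%:E).
      by move=> m; apply: emeasurable_funM; [exact: measurable_cst|exact: D2_sec].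
    rewrite -ge0_integralD//; try by move=> s _; rewrite mule_ge0.
    * apply: ge0_le_integral => //.
      - exact: D2_sec.
      - by apply: emeasurable_funD; exact: M'.
      - by move=> s _; rewrite -!EFinM -EFinD lee_fin fgh.
    * exact: M'.
    * exact: M'.
- exact: M.
- exact: M.
Qed.

End E2.

(** * Isometry bound for the Ito integral *)

Section ito_bound.
Context {d : measure_display} {Omega : measurableType d} {R : realType}.
Variables (P : probability Omega R) (F : R -> set (set Omega)) (T : R)
  (W : R -> Omega -> R).
Hypotheses (hF : filtration F T) (hW : wiener_process P F T W).
Notation mu := (@lebesgue_measure R).
Notation elem := (elem F T).
Implicit Types (e : elem) (l : seq elem).
Variables (H I : R -> Omega -> R) (hI : ito_integral P F T W H I).
Local Notation E2 := (E2 P).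
Local Notation D2 := (D2 P T).
Local Notation joint_meas := (joint_meas T).

Lemma I_wrt t : 0 <= t <= T -> measurable_wrt (F t) (I t).
Proof. by move=> h; case: hI => _ + _ _; apply; rewrite in_itv. Qed.

Lemma I_meas t : 0 <= t <= T -> measurable_fun setT (I t).
Proof. by move=> h; apply: (wrt_measurable hF h); exact: I_wrt. Qed.

Lemma integrand_joint_meas : joint_meas H. Proof. by case: hI => -[]. Qed.

(** Once simple processes are lists of elementary ones, the approximants and
their restrictions to ]s, t] can be subtracted by concatenation. *)
Lemma ito_approx : exists phi : nat -> seq elem,
  [/\ (D2 (fun s w => (step_proc (phi k) s w - H s w)%R) @[k --> \oo] --> 0)%E &
   forall s t (s0 : 0 <= s) (st : s <= t) (tT : t <= T),
    (E2 (fun w => (I t w - I s w - step_int W (clampL hF s0 st tT (phi k)) w)%R) @[k --> \oo] --> 0)%E].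
Proof.
case: hI => _ _ _ [phi [wf c1 c2]].
exists (fun k => simple_elems hF (wf k)); split.
  suff -> : (fun k => D2 (fun s w => step_proc (simple_elems hF (wf k)) s w - H s w)) =
    (fun k => \int[P]_w \int[mu]_(s in `[0%R, T]) ((simple_fun (phi k) s w - H s w) ^+ 2)%:E)%E by [].
  apply/funext => k; apply: eq_integral => w _; apply: eq_integral => s _.
  by rewrite step_proc_elems.
move=> s t s0 st tT.
have s0T : s \in `[0, T] by rewrite in_itv /= s0 (le_trans st).
have t0T : t \in `[0, T] by rewrite in_itv /= tT (le_trans s0).
have mI u : u \in `[0, T] -> measurable_fun setT (I u).
  by rewrite in_itv /= => h; exact: I_meas.
have mS k u : u \in `[0, T] -> measurable_fun setT (simple_integral W (phi k) u).
  rewrite in_itv /= => /andP[u0 uT].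
  have <- : step_int W (clampL hF (lexx 0) u0 uT (simple_elems hF (wf k))) = simple_integral W (phi k) u.
    apply/funext => w; rewrite step_int_elems.
    suff -> : simple_integral W (phi k) 0 w = 0 by rewrite subr0.
    apply: big1 => i _; rewrite !min_l ?subrr ?mulr0//.
      by apply: (sp_ge0 (wf k)); rewrite ltnW.
    exact: (sp_ge0 (wf k)).
  by case: (step_int_L2 hF hW (clampL hF (lexx 0) u0 uT (simple_elems hF (wf k)))).
pose b u k := E2 (fun w => simple_integral W (phi k) u w - I u w).
have bc u : u \in `[0, T] -> (b u k @[k --> \oo] --> 0)%E.
  by move=> hu; have := c2 u hu; rewrite unlock.
apply: (@squeeze_cvge _ _ _ _ (cst 0%E) _ (fun k => 2%:E * b t k + 2%:E * b s k)%E).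
- near=> k; rewrite E2_ge0 /=.
  apply: E2_le2.
  + apply: measurable_funB; first by apply: measurable_funB; exact: mI.
    by case: (step_int_L2 hF hW (clampL hF s0 st tT (simple_elems hF (wf k)))).
  + by apply: measurable_funB; [exact: mS|exact: mI].
  + by apply: measurable_funB; [exact: mS|exact: mI].
  + move=> w; rewrite step_int_elems; set x := I t w; set y := I s w.
    set x' := simple_integral _ _ t w; set y' := simple_integral _ _ s w.
    have := sqr_ge0 ((x' - x) + (y' - y)); nra.
- exact: cvg_cst.
- rewrite (_ : 0%E = 2%:E * 0 + 2%:E * 0)%E; last by rewrite !mule0 adde0.
  by apply: cvgeD; [rewrite !mule0|apply: cvgeZl => //; exact: bc|apply: cvgeZl => //; exact: bc].
Unshelve. all: by end_near. Qed.

Lemma E2_step_int l : E2 (step_int W l) = (gauss_var%:E * D2 (step_proc l))%E.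
Proof. exact: step_isometry. Qed.

Definition window (s t : R) (K : R -> Omega -> R) u w := \1_(`]s, t]%classic) u * K u w.

Lemma joint_meas_window s t (K : R -> Omega -> R) : joint_meas K -> joint_meas (window s t K).
Proof.
move=> h; apply: measurable_funM => //.
by apply: measurable_funTS; apply: measurableT_comp => //; exact: measurable_indic.
Qed.

Lemma joint_meas_step_proc l : joint_meas (step_proc l).
Proof. by apply: measurable_funTS; exact: step_proc_meas. Qed.

Lemma joint_measB (K1 K2 : R -> Omega -> R) : joint_meas K1 -> joint_meas K2 -> joint_meas (fun s w => K1 s w - K2 s w).
Proof. by move=> h1 h2; exact: measurable_funB. Qed.

(** The left-hand side is a limit of integrals of step processes close to
[H - step_proc l] on ]s, t]. The factor 4 comes from two uses of
[(a + b)^2 <= 2 a^2 + 2 b^2]. *)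
Lemma ito_bound s t (s0 : 0 <= s) (st : s <= t) (tT : t <= T) l :
  (E2 (fun w => (I t w - I s w - step_int W (clampL hF s0 st tT l) w)%R) <=
   (4 * gauss_var)%:E * D2 (window s t (fun u w => (H u w - step_proc l u w)%R)))%E.
Proof.
have [phi [c1 c2]] := ito_approx.
set X := E2 _; set Y := D2 _.
pose a k := E2 (fun w => I t w - I s w - step_int W (clampL hF s0 st tT (phi k)) w).
pose b k := D2 (fun s w => step_proc (phi k) s w - H s w).
pose C k := clampL hF s0 st tT (phi k) ++ map (negE hF) (clampL hF s0 st tT l).
have s0T : 0 <= s <= T by rewrite s0 (le_trans st).
have t0T : 0 <= t <= T by rewrite tT (le_trans s0).
have mJ l' : measurable_fun setT (step_int W l') by case: (step_int_L2 hF hW l').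
have mII : measurable_fun setT (fun w => I t w - I s w).
  by apply: measurable_funB; exact: I_meas.
have Y0 : (0 <= Y)%E by exact: D2_ge0.
have b0 k : (0 <= b k)%E by exact: D2_ge0.
have gauss_var0 := @gauss_var_ge0 R.
have H1 k0 : (X <= 2%:E * a k0 + 2%:E * E2 (step_int W (C k0)))%E.
  apply: E2_le2 => //; try by apply: measurable_funB.
  move=> w; rewrite /C step_int_cat step_int_neg.
  set x := I t w - I s w; set j := step_int _ _ w; set j' := step_int _ _ w.
  have := sqr_ge0 ((x - j') - (j' - j)); nra.
have H2 k : (D2 (step_proc (C k)) <= 2%:E * b k + 2%:E * Y)%E.
  apply: D2_le2.
  - exact: joint_meas_step_proc.
  - by apply: joint_measB; [exact: joint_meas_step_proc|exact: integrand_joint_meas].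
  - by apply: joint_meas_window; apply: joint_measB; [exact: integrand_joint_meas|exact: joint_meas_step_proc].
  - move=> u w; rewrite /C step_proc_cat step_proc_neg !step_proc_clamp /window.
    set x := step_proc _ u w; set y := step_proc _ u w; set h := H u w.
    rewrite indicE; case: (_ \in _).
      rewrite !mul1r; have := sqr_ge0 ((x - h) - (h - y)); nra.
    rewrite !mul0r subr0 expr0n /=.
    by have := sqr_ge0 (x - h); lra.
have H3 k : (X <= (2%:E * a k + (4 * gauss_var)%:E * b k) + (4 * gauss_var)%:E * Y)%E.
  apply: (le_trans (H1 k)); rewrite -addeA; apply: leeD2l.
  rewrite E2_step_int.
  apply: (@le_trans _ _ (2%:E * (gauss_var%:E * (2%:E * b k + 2%:E * Y)))%E).
    by apply: lee_wpmul2l => //; apply: lee_wpmul2l; rewrite ?lee_fin.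
  rewrite ge0_muleDr ?mule_ge0// ge0_muleDr; last 2 first.
  - by rewrite mule_ge0// ?lee_fin// mule_ge0.
  - by rewrite mule_ge0// ?lee_fin// mule_ge0.
  rewrite !muleA -!EFinM (_ : 2 * gauss_var * 2 = 4 * gauss_var :> R)//; ring.
have cu : ((2%:E * a k + (4 * gauss_var)%:E * b k) + (4 * gauss_var)%:E * Y @[k --> \oo] --> (4 * gauss_var)%:E * Y)%E.
  rewrite -[X in (_ --> X)%E]add0e.
  apply: cvgeD.
  - exact: fin_num_adde_defr.
  - rewrite (_ : 0%E = 2%:E * 0 + (4 * gauss_var)%:E * 0)%E; last by rewrite !mule0 adde0.
    apply: cvgeD; first by rewrite !mule0.
      by apply: cvgeZl => //; apply: c2.
    by apply: cvgeZl => //; apply: c1.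
  - exact: cvg_cst.
by apply: (cvge_ge _ cu); apply: nearW => k'; exact: H3.
Qed.

Lemma integrand_fin : (D2 H < +oo)%E.
Proof. by case: hI => -[]. Qed.

Lemma Iinc_L2 s t : 0 <= s -> s <= t -> t <= T -> L2 P (fun w => I t w - I s w).
Proof.
move=> s0 st tT; split.
  by apply: measurable_funB; apply: I_meas; rewrite ?s0 ?tT ?(le_trans st)// (le_trans s0).
have := @ito_bound s t s0 st tT [::].
rewrite (_ : (fun w => _ - step_int W (clampL hF s0 st tT [::]) w) = (fun w => I t w - I s w)); last first.
  by apply/funext => w; rewrite /step_int big_nil subr0.
move=> h; apply: (le_lt_trans h).
apply: (@le_lt_trans _ _ ((4 * gauss_var)%:E * D2 H)%E); last first.
  by rewrite lte_mul_pinfty// ?lee_fin ?mulr_ge0 ?gauss_var_ge0//; exact: integrand_fin.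
apply: lee_wpmul2l; first by rewrite lee_fin mulr_ge0 ?gauss_var_ge0.
apply: ge0_le_integral => //.
- by move=> w _; apply: integral_ge0 => u _; rewrite lee_fin sqr_ge0.
- apply: D2_meas; apply: joint_meas_window.
  by apply: joint_measB; [exact: integrand_joint_meas|exact: joint_meas_step_proc].
- exact: D2_meas integrand_joint_meas.
- move=> w _; apply: ge0_le_integral => //.
  + by move=> u _; rewrite lee_fin sqr_ge0.
  + apply: D2_sec; apply: joint_meas_window.
    by apply: joint_measB; [exact: integrand_joint_meas|exact: joint_meas_step_proc].
  + exact: D2_sec integrand_joint_meas.
  + move=> u _; rewrite lee_fin /window /step_proc big_nil subr0 exprMn.
    by rewrite ler_piMl ?sqr_ge0// indicE; case: (_ \in _); rewrite ?expr1n ?expr0n.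
Qed.

(** The integrals of the simple approximants all vanish at time 0. *)
Lemma I0_ae : {ae P, forall w, I 0 w = 0}.
Proof.
case: hI => _ _ _ [phi [wf _ c2]].
have T0 : 0 <= T.
  by have [? e2 _ _ _] := wf 0%N; have := sp_ge0 (wf 0%N) (leqnn _); rewrite e2.
have I0m : measurable_fun setT (I 0) by apply: I_meas; rewrite lexx T0.
have := c2 0; rewrite in_itv /= lexx T0 => /(_ isT); rewrite unlock.
rewrite (_ : (fun k => _) = cst (E2 (I 0))); last first.
  apply/funext => k; apply: eq_integral => w _ /=.
  suff -> : simple_integral W (phi k) 0 w = 0 by rewrite sub0r sqrrN.
  apply: big1 => i _; rewrite !min_l ?subrr ?mulr0//.
    by apply: (sp_ge0 (wf k)); rewrite ltnW.
  exact: (sp_ge0 (wf k)).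
move=> c; have e0 : E2 (I 0) = 0%E.
  by have := cvg_unique _ c (cvg_cst (E2 (I 0))) => /(_ (@ereal_hausdorff _)) ->.
have h : (\int[P]_w `|((I 0 w) ^+ 2)%:E| = 0)%E.
  by rewrite -e0; apply: eq_integral => w _; rewrite gee0_abs// lee_fin sqr_ge0.
have := (ae_eq_integral_abs P measurableT (msqr I0m)).1 h.
apply: filterS => w /(_ Logic.I) /= [] /eqP.
by rewrite sqrf_eq0 => /eqP.
Qed.

End ito_bound.

(** * Kolmogorov's inequality and orthogonality *)

Section maximal.
Context {d : measure_display} {Omega : measurableType d} {R : realType}.
Variables (P : probability Omega R) (n : nat) (G : nat -> set (set Omega))
  (N : nat -> Omega -> R) (delta : R).
Hypotheses (sG : forall k, (k <= n)%N -> sigma_algebra setT (G k))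
  (Gm : forall k, (k <= n)%N -> G k `<=` measurable)
  (Gle : forall j k, (j <= k)%N -> (k <= n)%N -> G j `<=` G k)
  (NG : forall k, (k <= n)%N -> measurable_wrt (G k) (N k))
  (NL2 : forall k, (k <= n)%N -> L2 P (N k))
  (mart : forall k (Y : Omega -> R), (k <= n)%N -> measurable_wrt (G k) Y -> L2 P Y ->
     \int[P]_w ((N n w - N k w) * Y w) = 0)
  (delta0 : 0 < delta).

Let ex k : Omega -> R := \1_[set w | delta < `|N k w|].
(** The indicator that [|N_j| > delta] for some [j < k]. In recursive form its
increment [c k] visibly depends on [N_0, ..., N_k] only. *)
Fixpoint exceeded k : Omega -> R := fun w =>
  if k is k'.+1 then exceeded k' w + (1 - exceeded k' w) * ex k' w else 0.
Let c k w := (1 - exceeded k w) * ex k w.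

Let ex01 k w : ex k w = 0 \/ ex k w = 1.
Proof. by rewrite /ex indicE; case: (_ \in _); [right|left]. Qed.

Let exc01 k w : exceeded k w = 0 \/ exceeded k w = 1.
Proof.
elim: k => [|k IH] /=; first by left.
by case: IH => ->; case: (ex01 k w) => ->; rewrite ?subr0 ?subrr ?mul1r ?mul0r ?add0r ?addr0; tauto.
Qed.

Let c01 k w : c k w = 0 \/ c k w = 1.
Proof.
rewrite /c; case: (exc01 k w) => ->; case: (ex01 k w) => ->;
 rewrite ?subr0 ?subrr ?mul1r ?mul0r; tauto.
Qed.

Let ex_wrt k : (k <= n)%N -> @measurable_fun _ _ (g_sigma_algebraType (G k)) _ setT (ex k).
Proof.
move=> kn; apply: measurable_indic.
have mN := (measurable_wrtP _ (sG kn)).1 (NG kn).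
have h := measurableT_comp (@normr_measurable R setT) mN.
have := h measurableT `]delta, +oo[%classic (measurable_itv _).
rewrite setTI (_ : _ @^-1` _ = [set w | delta < `|N k w|])//.
by apply/seteqP; split => w /=; rewrite in_itv/= andbT.
Qed.

Let upgrade j k (f : Omega -> R) : (j <= k)%N -> (k <= n)%N ->
  @measurable_fun _ _ (g_sigma_algebraType (G j)) _ setT f ->
  @measurable_fun _ _ (g_sigma_algebraType (G k)) _ setT f.
Proof.
move=> jk kn /(measurable_wrtP _ (sG (leq_trans jk kn))) h.
by apply/(measurable_wrtP _ (sG kn)) => B mB; apply: (Gle jk kn); exact: h.
Qed.

Let exc_wrt k : (k <= n)%N -> @measurable_fun _ _ (g_sigma_algebraType (G k)) _ setT (exceeded k).
Proof.
elim: k => [|k IH] kn; first exact: measurable_cst.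
have kn' := ltnW kn.
apply: (upgrade (leqnSn k) kn).
apply: measurable_funD; first exact: IH.
apply: measurable_funM; last exact: ex_wrt.
by apply: measurable_funB; [exact: measurable_cst|exact: IH].
Qed.

Let c_wrt k : (k <= n)%N -> measurable_wrt (G k) (c k).
Proof.
move=> kn; apply/(measurable_wrtP _ (sG kn)); apply: measurable_funM; last exact: ex_wrt.
by apply: measurable_funB; [exact: measurable_cst|exact: exc_wrt].
Qed.

Let c_meas k : (k <= n)%N -> measurable_fun setT (c k).
Proof. by move=> kn; apply: (wrt_meas (sG kn) (Gm kn)); exact: c_wrt. Qed.

Let c_bdd k w : `|c k w| <= 1.
Proof. by case: (c01 k w) => ->; rewrite ?normr0 ?normr1. Qed.

Let step k : (k <= n)%N ->
  delta ^+ 2 * \int[P]_w c k w <= \int[P]_w (c k w * N n w ^+ 2).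
Proof.
move=> kn.
have ic : integ P (c k).
  by apply: (integ_le (c_meas kn) (integ_cst P 1)) => w.
have LcN : L2 P (fun w => c k w * N k w).
  exact: (L2_bddM (c_meas kn) (c_bdd k) (NL2 kn)).
have LD : L2 P (fun w => N n w - N k w) by apply: L2B; exact: NL2.
have LcD : L2 P (fun w => c k w * (N n w - N k w)).
  exact: (L2_bddM (c_meas kn) (c_bdd k) LD).
have i1 := L2M LcN (NL2 kn).
have i2 := L2M LD LcN.
have i3 := L2M LcD LD.
have cNG : measurable_wrt (G k) (fun w => c k w * N k w).
  apply/(measurable_wrtP _ (sG kn)); apply: measurable_funM.
    exact/(measurable_wrtP _ (sG kn))/c_wrt.
  exact/(measurable_wrtP _ (sG kn))/NG.
have E : \int[P]_w (c k w * N n w ^+ 2) =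
   \int[P]_w (c k w * N k w * N k w) +
   (2 * \int[P]_w ((N n w - N k w) * (c k w * N k w)) +
   \int[P]_w (c k w * (N n w - N k w) * (N n w - N k w))).
  rewrite -RintegralZl// -RintegralD//; last exact: integ_Z.
  rewrite -RintegralD//; last by apply: integ_D => //; exact: integ_Z.
  by apply: eq_Rintegral => w _; ring.
rewrite E mart// mulr0 add0r.
apply: (@le_trans _ _ (\int[P]_w (c k w * N k w * N k w))).
  rewrite -RintegralZl//; apply: le_Rintegral => //; first exact: integ_Z.
  move=> w _; rewrite /c.
  case: (exc01 k w) => ->; rewrite ?subrr ?mul0r ?mulr0// subr0 !mul1r.
  rewrite /ex indicE; case: (boolP (_ \in _)); rewrite ?mulr0 ?mul0r// inE /= => h.
  rewrite mulr1 mul1r -expr2 -(real_normK (num_real (N k w))).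
  by rewrite lerXn2r// ?nnegrE ?ltW.
rewrite lerDl; apply: Rintegral_ge0 => w _.
rewrite -mulrA -expr2 mulr_ge0 ?sqr_ge0//.
by case: (c01 k w) => ->.
Qed.

Let sum_c k w : \sum_(i < k) c i w = exceeded k w.
Proof.
elim: k => [|k IH]; first by rewrite big_ord0.
by rewrite big_ord_recr /= IH.
Qed.

Let exceededP w : (exists2 k, (k <= n)%N & delta < `|N k w|) -> exceeded n.+1 w = 1.
Proof.
move=> [k kn h].
have : exceeded k.+1 w = 1.
  have -> : exceeded k.+1 w = exceeded k w + (1 - exceeded k w) * ex k w by [].
  have -> : ex k w = 1 by rewrite /ex indicE mem_set.
  by rewrite mulr1 addrC subrK.
rewrite -ltnS in kn; move: kn; elim: (n.+1) => // m IH.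
rewrite ltnS leq_eqVlt => /orP[/eqP ->//|km] h1.
by rewrite /= (IH km h1) subrr mul0r addr0.
Qed.

(** Let [c k] be the indicator of a first passage at time [k]. The increment
[N_n - N_k] is orthogonal to [c k N_k], whence
[delta^2 E (c k) <= E (c k N_n^2)]. The passage events are disjoint, and the
bounds add up. *)
Lemma maximal_ineq B : measurable B ->
  B `<=` [set w | exists2 k, (k <= n)%N & delta < `|N k w|] ->
  (P B <= (delta ^- 2 * \int[P]_w (N n w ^+ 2))%:E)%E.
Proof.
move=> mB BE.
have ic (k : 'I_n.+1) : integ P (c k).
  by apply: (integ_le (c_meas _) (integ_cst P 1)) => [|w]; [rewrite -ltnS|exact: c_bdd].
have kn (k : 'I_n.+1) : (k <= n)%N by rewrite -ltnS.
have ie : integ P (exceeded n.+1).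
  apply: (@integ_eq _ _ _ _ (fun w => \sum_(k < n.+1) c k w)).
    exact: integ_sum.
  by move=> w; rewrite sum_c.
have iN := L2_sqr (NL2 (leqnn n)).
have i2 (k : 'I_n.+1) : integ P (fun w => c k w * N n w ^+ 2).
  apply: (integ_le _ iN).
    by apply: measurable_funM; [exact: c_meas|apply: measurable_funX; case: (NL2 (leqnn n))].
  move=> w; rewrite normrM (ger0_norm (sqr_ge0 _)).
  by rewrite ler_piMl ?sqr_ge0.
have key : delta ^+ 2 * \int[P]_w exceeded n.+1 w <= \int[P]_w (N n w ^+ 2).
  have -> : \int[P]_w exceeded n.+1 w = \sum_(k < n.+1) \int[P]_w c k w.
    by rewrite -Rint_sum//; apply: eq_Rintegral => w _; rewrite sum_c.
  rewrite mulr_sumr.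
  apply: (@le_trans _ _ (\sum_(k < n.+1) \int[P]_w (c k w * N n w ^+ 2))).
    by apply: ler_sum => k _; exact: step.
  rewrite -Rint_sum//; apply: le_Rintegral => //; first exact: integ_sum.
  move=> w _; rewrite -mulr_suml sum_c.
  by case: (exc01 n.+1 w) => ->; rewrite ?mul1r// mul0r sqr_ge0.
apply: (@le_trans _ _ (\int[P]_w exceeded n.+1 w)%:E).
  rewrite /Rintegral fineK; last exact: integrable_fin_num.
  rewrite -[B]setIT -integral_indic//.
  apply: ge0_le_integral => //.
  - by apply/measurable_EFinP; exact: measurable_indic.
  - by apply/measurable_EFinP; exact: integ_meas ie.
  - move=> w _; rewrite lee_fin indicE; case: (boolP (w \in B)) => h.
      by rewrite exceededP//; apply: BE; rewrite -inE.
    by case: (exc01 n.+1 w) => ->.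
by rewrite lee_fin mulrC ler_pdivlMr ?exprn_gt0// mulrC.
Qed.
End maximal.

Section martingale.
Context {d : measure_display} {Omega : measurableType d} {R : realType}.
Variables (P : probability Omega R) (F : R -> set (set Omega)) (T : R)
  (W : R -> Omega -> R).
Hypotheses (hF : filtration F T) (hW : wiener_process P F T W).
Notation elem := (elem F T).
Implicit Types (e : elem) (l : seq elem).

Lemma elem_inc_mart e s (Y : Omega -> R) : 0 <= s -> s <= ea e ->
  measurable_wrt (F s) Y -> L2 P Y -> \int[P]_w (elem_inc W e w * Y w) = 0.
Proof.
move=> s0 se mY LY.
have [lt|ge] := ltP (ea e) (eb e); last first.
  have eab : ea e = eb e by apply/eqP; rewrite eq_le ge ea_le.
  by apply: Rint_zero => w; rewrite /elem_inc eab subrr mulr0 mul0r.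
have [M hM] := ev_bdd e.
have eaT := ea_itv e.
have -> : \int[P]_w (elem_inc W e w * Y w) = \int[P]_w (ev e w * Y w * (W (eb e) w - W (ea e) w)).
  by apply: eq_Rintegral => w _; rewrite /elem_inc mulrAC.
have mevY : measurable_wrt (F (ea e)) (fun w => ev e w * Y w).
  apply: (wrt_M hF) => //; first exact: ev_wrt.
  by apply: (wrt_le hF s0 se) => //; case/andP: eaT.
have iY : integ P (fun w => ev e w * Y w).
  by apply: L2_integ; apply: (L2_bddM (ev_meas e) hM).
exact: (inc_mean0 hF hW (ea_ge0 e) (ea_le e) (eb_le e) mevY iY).2.
Qed.

Lemma step_int_mart s t (s0 : 0 <= s) (st : s <= t) (tT : t <= T) l (Y : Omega -> R) :
  measurable_wrt (F s) Y -> L2 P Y ->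
  \int[P]_w (step_int W (clampL hF s0 st tT l) w * Y w) = 0.
Proof.
move=> mY LY.
have -> : \int[P]_w (step_int W (clampL hF s0 st tT l) w * Y w) =
   \int[P]_w \sum_(e <- l) (elem_inc W (clampE hF s0 st tT e) w * Y w).
  by apply: eq_Rintegral => w _; rewrite /step_int big_map mulr_suml.
rewrite Rint_sum => [|e]; last by apply: L2M => //; exact: (elem_inc_L2 hF hW).
apply: big1 => e _; apply: (elem_inc_mart s0) => //.
exact: clamp_ge.
Qed.

Lemma step_int_clamp_wrt s t (s0 : 0 <= s) (st : s <= t) (tT : t <= T) l :
  measurable_wrt (F t) (step_int W (clampL hF s0 st tT l)).
Proof.
apply: (step_int_wrt hF hW) => [|e]; first by rewrite tT (le_trans s0).
elim: l => //= a l IH [<-|//]; exact: clamp_le.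
Qed.

Variables (H I : R -> Omega -> R) (hI : ito_integral P F T W H I).

(** Orthogonality holds for the simple approximants. In the limit, the inequality
[|a b| <= a^2 / kap + kap b^2] bounds the expectation by [kap E Y^2] for every
[kap > 0]. *)
Lemma ito_mart s t (s0 : 0 <= s) (st : s <= t) (tT : t <= T) l (Y : Omega -> R) :
  measurable_wrt (F s) Y -> L2 P Y ->
  \int[P]_w ((I t w - I s w - step_int W (clampL hF s0 st tT l) w) * Y w) = 0.
Proof.
move=> mY LY.
have [phi [_ c2]] := ito_approx hF hW hI.
have LI := Iinc_L2 hF hW hI s0 st tT.
have LJ l' := step_int_L2 hF hW (clampL hF s0 st tT l').
pose De k w := I t w - I s w - step_int W (clampL hF s0 st tT (phi k)) w.
have LDe k : L2 P (De k) by apply: L2B.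
set x := LHS.
have E k : x = \int[P]_w (De k w * Y w).
  rewrite /x.
  have -> : \int[P]_w ((I t w - I s w - step_int W (clampL hF s0 st tT l) w) * Y w) =
    \int[P]_w ((I t w - I s w) * Y w) - \int[P]_w (step_int W (clampL hF s0 st tT l) w * Y w).
    rewrite -RintegralB//; [|exact: L2M|exact: L2M].
    by apply: eq_Rintegral => w _; rewrite mulrBl.
  have -> : \int[P]_w (De k w * Y w) =
    \int[P]_w ((I t w - I s w) * Y w) - \int[P]_w (step_int W (clampL hF s0 st tT (phi k)) w * Y w).
    rewrite -RintegralB//; [|exact: L2M|exact: L2M].
    by apply: eq_Rintegral => w _; rewrite mulrBl.
  by rewrite !step_int_mart.
apply/eqP; rewrite -normr_le0.
have ey0 : 0 <= \int[P]_w (Y w ^+ 2) by apply: Rintegral_ge0 => w _; rewrite sqr_ge0.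
set y := \int[P]_w (Y w ^+ 2) in ey0.
have key kap k : 0 < kap -> `|x| <= kap^-1 * \int[P]_w (De k w ^+ 2) + kap * y.
  move=> k0; rewrite {1}(E k).
  apply: (le_trans (le_normr_Rintegral measurableT (L2M (LDe k) LY))).
  rewrite -!RintegralZl//; [|exact: L2_sqr|exact: L2_sqr].
  rewrite -RintegralD//; [|by apply: integ_Z; exact: L2_sqr|by apply: integ_Z; exact: L2_sqr].
  apply: le_Rintegral => //.
  - by apply: integrable_norm; exact: L2M.
  - by apply: integ_D; apply: integ_Z; exact: L2_sqr.
  - move=> w _; set a := De k w; set b := Y w.
    have h1 := sqr_ge0 (a - kap * b); have h2 := sqr_ge0 (a + kap * b).
    have h3 := sqr_ge0 a; have h4 := sqr_ge0 (kap * b).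
    rewrite -(ler_pM2l k0) mulrDr mulrA divff ?gt_eqF// mul1r.
    have -> : kap * `|a * b| = `|kap * a * b|.
      by rewrite -mulrA [RHS]normrM (gtr0_norm k0).
    by rewrite ler_norml; apply/andP; split; lra.
have c : \int[P]_w (De k w ^+ 2) @[k --> \oo] --> 0.
  exact: (fine_cvg (c2 s t s0 st tT)).
have key2 kap : 0 < kap -> `|x| <= kap * y.
  move=> k0.
  have c' : kap^-1 * \int[P]_w (De k w ^+ 2) + kap * y @[k --> \oo] --> kap^-1 * 0 + kap * y.
    by apply: cvgD; [apply: cvgMr|exact: cvg_cst].
  rewrite mulr0 add0r in c'.
  by apply: (cvgr_to_ge c'); apply: nearW => k; exact: key.
have [y0|y0] := eqVneq y 0; first by have := key2 1 ltr01; rewrite mul1r y0.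
apply/ler_addgt0Pr => z z0; rewrite add0r.
have := key2 (z / y); rewrite divfK//; apply.
by rewrite divr_gt0// lt_neqAle eq_sym y0.
Qed.
End martingale.

(** * Continuous paths and Gronwall's lemma *)

Section continuous_paths.
Context {R : realType}.

Lemma within_contP (A : set R) (f : R -> R) (s : R) :
  {within A, continuous f} -> A s -> forall e : R, 0 < e ->
  exists2 del : R, 0 < del & forall u : R, A u -> `|u - s| < del -> `|f u - f s| < e.
Proof.
move=> /subspace_continuousP cf As e e0.
have /cvgrPdist_lt /(_ e e0) [del /= del0 h] := cf s As.
exists del => // u Au us; rewrite distrC; apply: h => //=.
by rewrite distrC.
Qed.

Context {d : measure_display} {Omega : measurableType d}.
Variables (T : R) (T0 : 0 < T) (X : R -> Omega -> R).
Hypothesis mX : forall s, 0 <= s <= T -> measurable_fun setT (X s).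
Hypothesis cX : continuous_paths T X.

(** A process with continuous paths is the limit of its discretizations from
the left, which are jointly measurable. *)
Lemma joint_meas_continuous : joint_meas T X.
Proof.
pose h n : R := T / n.+1%:R.
have h0 n : 0 < h n by rewrite divr_gt0.
(* The minimum changes nothing, but makes the evaluation times visibly at most [T]. *)
pose f n (p : R * Omega) := \sum_(i < n.+2)
  \1_(`[i%:R * h n, i.+1%:R * h n[%classic) p.1 * X (Num.min (i%:R * h n) T) p.2.
apply: (@measurable_fun_cvg _ _ _ _ f).
  move=> n; apply: measurable_sum => i; apply: measurable_funM.
    by apply: measurable_funTS; apply: measurableT_comp => //; exact: measurable_indic.
  apply: measurable_funTS; apply: measurableT_comp => //; apply: mX.
  by rewrite le_min mulr_ge0 ?(ltW (h0 n))// (ltW T0) ge_min lexx orbT.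
move=> [s w] /= [/=]; rewrite in_itv /= => /andP[s0 sT] _.
pose i0 n := Num.truncn (s / h n).
have i0P n : (i0 n)%:R * h n <= s < (i0 n).+1%:R * h n.
  have := truncn_itv (divr_ge0 s0 (ltW (h0 n))).
  by rewrite ler_pdivlMr// ltr_pdivrMr.
have i0n n : (i0 n < n.+2)%N.
  rewrite -(ltr_nat R); have /andP[h1 _] := i0P n.
  rewrite -(ltr_pM2r (h0 n)); apply: (le_lt_trans h1); apply: (le_lt_trans sT).
  rewrite /h mulrA ltr_pdivlMr// mulrC ltr_pM2r// ltr_nat//.
have fE n : f n (s, w) = X ((i0 n)%:R * h n) w.
  rewrite /f (bigD1 (Ordinal (i0n n)))//= big1 ?addr0; last first.
    move=> i ii0; rewrite indicE memNset ?mul0r//= in_itv/= => hi.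
    case/negP: ii0; apply/eqP/val_inj => /=; apply/esym/eqP.
    rewrite truncn_eq; last by rewrite divr_ge0// ltW.
    by rewrite ler_pdivlMr// ltr_pdivrMr.
  have /andP[h1 h2] := i0P n.
  have -> : \1_(`[(i0 n)%:R * h n, (i0 n).+1%:R * h n[%classic) s = 1 :> R.
    by rewrite indicE mem_set//= in_itv/= h1 h2.
  by rewrite mul1r min_l// (le_trans h1).
rewrite (_ : f ^~ (s, w) = fun n => X ((i0 n)%:R * h n) w); last by apply/funext.
apply/cvgrPdist_lt => e e0.
have As : `[0, T]%classic s by rewrite /= in_itv /= s0.
have [del del0 hdel] := within_contP (@cX w) As e0.
have hc : h n @[n --> \oo] --> 0.
  rewrite /h (_ : 0 = T * 0); last by rewrite mulr0.
  by apply: cvgMr; exact: cvg_harmonic.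
have /cvgrPdist_lt /(_ _ del0) := hc; apply: filterS => n.
rewrite sub0r normrN gtr0_norm// => hn.
have /andP[h1 h2] := i0P n.
rewrite distrC; apply: hdel.
  by rewrite /= in_itv/= mulr_ge0 ?(ltW (h0 n))//= (le_trans h1).
rewrite distrC ger0_norm ?subr_ge0//; apply: lt_trans hn.
by move: h2; rewrite -natr1 mulrDl mul1r ltrBlDl.
Qed.

End continuous_paths.

Section gronwall.
Context {R : realType}.
Notation mu := (@lebesgue_measure R).

Lemma int_expR (L t : R) : 0 < L -> 0 < t ->
  (\int[mu]_(s in `[0%R, t]) (expR (L * s))%:E = ((expR (L * t) - 1) / L)%:E)%E.
Proof.
move=> L0 t0.
pose Fe s : R := L^-1 * expR (L * s).
have der (x : R) : is_derive x 1 Fe (expR (L * x)).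
  have d1 : is_derive x 1 ( *%R L) L.
    have := is_deriveZ L (is_derive_id x 1).
    by rewrite /GRing.scale /= mulr1.
  have d2 := is_derive1_comp (is_derive_expR (L * x)) d1.
  have := is_deriveZ L^-1 d2.
  by rewrite /GRing.scale /= mulrCA mulVf ?mulr1// gt_eqF.
have cF : continuous Fe.
  move=> x; apply/differentiable_continuous/derivable1_diffP.
  by have [] := der x.
rewrite (@continuous_FTC2 _ (fun s => expR (L * s)) Fe)//.
- by rewrite /Fe mulr0 expR0 -EFinB; congr EFin; rewrite mulr1 mulrBl mul1r mulrC.
- apply: continuous_subspaceT => s.
  apply: (@continuous_comp _ _ _ ( *%R L) expR); first exact: mulrl_continuous.
  exact: continuous_expR.
- split.
  + by move=> x _; have [] := der x.
  + by apply: cvg_at_right_filter; exact: cF.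
  + by apply: cvg_at_left_filter; exact: cF.
- by move=> x _; rewrite derive1E; have [_ ->] := der x.
Qed.

(** Nothing but boundedness of [g] is known beforehand. With [G] the supremum of
[exp(- 2 L s) g s], the hypothesis becomes [G <= A + G / 2]: the weight turns the
integral into a contraction. *)
Lemma gronwall (g : R -> R) (T A L M : R) : 0 < L -> 0 <= A ->
  measurable_fun `[0, T]%classic g ->
  (forall s, 0 <= s <= T -> 0 <= g s <= M) ->
  (forall t, 0 <= t <= T ->
     ((g t)%:E <= A%:E + L%:E * \int[mu]_(s in `[0%R, t]) (g s)%:E)%E) ->
  forall t, 0 <= t <= T -> g t <= 2 * A * expR (2 * L * T).
Proof.
move=> L0 A0 mg gM h t t0T.
have T0 : 0 <= T by case/andP: t0T; exact: le_trans.
have ts : 0 <= T <= T by rewrite T0 lexx.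
pose E := [set expR (- (2 * L * s)) * g s | s in `[0, T]%classic].
have L2 : 0 < 2 * L by rewrite mulr_gt0.
have le1 s : 0 <= s -> expR (- (2 * L * s)) <= 1.
  by move=> s0; rewrite -[leRHS]expR0 ler_expR oppr_le0 mulr_ge0 ?(ltW L2).
have hE : has_sup E.
  split; first by exists (expR (- (2 * L * T)) * g T), T => //=; rewrite in_itv/=.
  exists M; move=> y [s /=]; rewrite in_itv/= => sT <-.
  have /andP[g0 gm] := gM s sT; apply: le_trans gm.
  by rewrite ler_piMl// le1//; case/andP: sT.
pose G := sup E.
have gG s : 0 <= s <= T -> g s <= G * expR (2 * L * s).
  move=> sT; have : expR (- (2 * L * s)) * g s <= G.
    by apply: (sup_upper_bound hE); exists s => //=; rewrite in_itv/=.
  by rewrite expRN mulrC ler_pdivrMr ?expR_gt0.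
have G0 : 0 <= G.
  have := gG T ts; have /andP[g0 _] := gM T ts.
  by move=> /(le_trans g0); rewrite pmulr_lge0 ?expR_gt0.
have GA : G <= A + G / 2.
  apply: ge_sup; first by case: hE.
  move=> y [s /=]; rewrite in_itv/= => sT <-.
  have /andP[s0 sT'] := sT.
  have key : g s <= A + G / 2 * expR (2 * L * s).
    move: s0; rewrite le_eqVlt => /orP[/eqP s0|s0].
      have := h s sT; rewrite -s0 set_itv1 integral_set1 mule0 adde0 lee_fin => /le_trans; apply.
      by rewrite lerDl mulr_ge0 ?expR_ge0// divr_ge0.
    rewrite -lee_fin; apply: (le_trans (h s sT)).
    rewrite EFinD; apply: leeD2l.
    apply: (@le_trans _ _ (L%:E * \int[mu]_(u in `[0%R, s]) (G * expR (2 * L * u))%:E)%E).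
      apply: lee_wpmul2l; first by rewrite lee_fin ltW.
      have sub : `[0, s]%classic `<=` `[0, T]%classic.
        by move=> u /=; rewrite !in_itv/= => /andP[-> /le_trans]; apply.
      have mex : measurable_fun `[0, s]%classic (fun u => G * expR (2 * L * u)).
        by apply: measurable_funTS; apply: measurable_funM => //; apply: measurableT_comp => //; exact: mulrl_measurable.
      apply: ge0_le_integral => //.
      - move=> u /sub /=; rewrite in_itv/= => uT; rewrite lee_fin.
        by have /andP[] := gM u uT.
      - by apply/measurable_EFinP; apply: measurable_funS mg.
      - exact/measurable_EFinP.
      - move=> u /sub /=; rewrite in_itv/= => uT; rewrite lee_fin; exact: gG.
    under eq_integral do rewrite EFinM.
    have mE : measurable_fun `[0, s]%classic (fun u => (expR (2 * L * u))%:E).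
      by apply/measurable_EFinP; apply: measurable_funTS; apply: measurableT_comp => //; exact: mulrl_measurable.
    have e0 u : (0 <= (expR (2 * L * u))%:E)%E by rewrite lee_fin expR_ge0.
    rewrite ge0_integralZl//.
    rewrite int_expR// -!EFinM lee_fin.
    have -> : L * (G * ((expR (2 * L * s) - 1) / (2 * L))) = G / 2 * (expR (2 * L * s) - 1).
      by field; rewrite gt_eqF.
    by rewrite ler_wpM2l ?divr_ge0// gerBl.
  have e1 : expR (- (2 * L * s)) * expR (2 * L * s) = 1 by rewrite -expRD addNr expR0.
  have e0 := expR_gt0 (- (2 * L * s)).
  have := le1 s (andP sT).1 => e2.
  apply: (@le_trans _ _ (expR (- (2 * L * s)) * (A + G / 2 * expR (2 * L * s)))).
    by rewrite ler_pM2l.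
  rewrite mulrDr (mulrC (G / 2)) mulrA e1 mul1r lerD2r.
  by rewrite ler_piMl.
have GA' : G <= 2 * A by lra.
apply: (le_trans (gG t t0T)).
apply: ler_pM => //; try exact: expR_ge0.
by rewrite ler_expR ler_pM2l//; case/andP: t0T.
Qed.

End gronwall.

(** * Integrals over intervals and the deterministic path *)

Section ode.
Context {R : realType}.
Notation mu := (@lebesgue_measure R).

Lemma within_integrable (T r s : R) (g : R -> R) : {within `[0, T], continuous g} ->
  0 <= r -> s <= T -> mu.-integrable `[r, s] (EFin \o g).
Proof.
move=> cg r0 sT; apply: continuous_compact_integrable; first exact: segment_compact.
apply: continuous_subspaceW cg => u /=; rewrite !in_itv/= => /andP[h1 h2].
by rewrite (le_trans r0 h1) (le_trans h2 sT).
Qed.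

Lemma within_bounded (T : R) (g : R -> R) : 0 <= T -> {within `[0, T], continuous g} ->
  exists2 K : R, 0 <= K & forall s, 0 <= s <= T -> `|g s| <= K.
Proof.
move=> T0 cg.
have cn : {within `[0, T], continuous (fun s => `|g s|)}.
  apply: (@within_continuous_comp _ _ _ `[0, T]%classic g (fun x => `|x|)) => //.
  by move=> x _; exact: norm_continuous.
have [c _ h] := EVT_max T0 cn.
by exists `|g c| => // s sT; apply: h; rewrite in_itv.
Qed.

Lemma Rint_split (T r s : R) (g : R -> R) : {within `[0, T], continuous g} ->
  0 <= r -> r <= s -> s <= T ->
  \int[mu]_(u in `[0, s]) g u - \int[mu]_(u in `[0, r]) g u = \int[mu]_(u in `[r, s]) g u.
Proof.
move=> cg r0 rs sT.
have i1 := within_integrable cg (lexx 0) sT.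
rewrite Rintegral_itvB//.
rewrite Rintegral_itv_obnd_cbnd//.
apply: (@integrableS _ _ _ mu `[r, s]%classic) => //.
  by move=> u /=; rewrite !in_itv/= => /andP[/ltW -> ->].
exact: (within_integrable cg r0 sT).
Qed.

Lemma itv_cst_integrable (r s c : R) : mu.-integrable `[r, s] (EFin \o (fun=> c)).
Proof.
apply: continuous_compact_integrable; first exact: segment_compact.
by apply: continuous_subspaceT => ?; exact: cvg_cst.
Qed.

Lemma Rint_itv_cst (r s c : R) : r <= s -> \int[mu]_(u in `[r, s]) c = c * (s - r).
Proof.
move=> rs; have mrs : fine (mu `[r, s]%classic) = s - r.
  rewrite lebesgue_measure_itv/= lte_fin.
  by case: ltP => //= sr; apply/esym/eqP; rewrite subr_eq0 eq_le sr rs.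
by rewrite Rintegral_cst// [fine _]mrs.
Qed.

Lemma Rint_itv_bound (r s K : R) (f : R -> R) : r <= s ->
  mu.-integrable `[r, s] (EFin \o f) ->
  (forall u, r <= u <= s -> `|f u| <= K) ->
  `|\int[mu]_(u in `[r, s]) f u| <= K * (s - r).
Proof.
move=> rs i1 hK; apply: (le_trans (le_normr_Rintegral _ i1)) => //.
apply: (@le_trans _ _ (\int[mu]_(u in `[r, s]) K)); last by rewrite Rint_itv_cst.
by apply: le_Rintegral => //; [exact: integrable_norm|exact: itv_cst_integrable].
Qed.

(** Integrate [(g - c)^2 >= 0], where [c] is the mean value of [g]. *)
Lemma cauchy_schwarz (r s : R) (g : R -> R) : r <= s ->
  mu.-integrable `[r, s] (EFin \o g) ->
  mu.-integrable `[r, s] (EFin \o (fun u => g u ^+ 2)) ->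
  (\int[mu]_(u in `[r, s]) g u) ^+ 2 <= (s - r) * \int[mu]_(u in `[r, s]) (g u ^+ 2).
Proof.
rewrite le_eqVlt => /orP[/eqP ->|rs] ig ig2.
  by rewrite set_itv1 !Rintegral_set1 expr0n mulr0.
have m0 : 0 < s - r by rewrite subr_gt0.
set a := \int[mu]_(u in _) g u; set b := \int[mu]_(u in _) _.
pose c := a / (s - r).
have icst := itv_cst_integrable r s (c ^+ 2).
have i2 : mu.-integrable `[r, s] (EFin \o (fun u => (2 * c) * g u)).
  by apply: (integrableZl _ _ ig).
have i12 : mu.-integrable `[r, s] (EFin \o (fun u => g u ^+ 2 - (2 * c) * g u)).
  by apply: (integrableB _ ig2 i2).
have : 0 <= \int[mu]_(u in `[r, s]) (g u ^+ 2 - (2 * c) * g u + c ^+ 2).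
  apply: Rintegral_ge0 => u _; have := sqr_ge0 (g u - c); lra.
rewrite RintegralD// RintegralB// RintegralZl// (Rint_itv_cst _ (ltW rs)).
rewrite -/a -/b /c => h.
have : 0 <= (s - r) * (b - 2 * (a / (s - r)) * a + (a / (s - r)) ^+ 2 * (s - r)).
  by rewrite mulr_ge0// ltW.
have -> : (s - r) * (b - 2 * (a / (s - r)) * a + (a / (s - r)) ^+ 2 * (s - r)) =
   (s - r) * b - a ^+ 2 by field; rewrite gt_eqF.
by rewrite subr_ge0.
Qed.

Section solution.
Variables (T x0 : R) (S x : R -> R) (hx : ode_solution T x0 S x) (T0 : 0 < T)
  (cS : continuous S).

Lemma ode_quotient (u : R) : 0 <= u <= T -> forall e : R, 0 < e ->
  exists2 del : R, 0 < del & forall s, 0 <= s <= T -> s != u -> `|s - u| < del ->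
    `|(x s - x u) / (s - u) - S (x u)| < e.
Proof.
move=> uT e e0; case: hx => _ /(_ u); rewrite in_itv/= => /(_ uT).
move=> /cvgrPdist_lt /(_ e e0) [del /= del0 h].
exists del => // s sT su sd; rewrite distrC; apply: h => //=.
by rewrite distrC.
Qed.

Lemma ode_continuous : {within `[0, T], continuous x}.
Proof.
apply/subspace_continuousP => u /=; rewrite in_itv/= => uT.
have [del del0 h] := ode_quotient uT ltr01.
pose K := `|S (x u)| + 1; have K0 : 0 < K by rewrite ltr_wpDl.
apply/cvgrPdist_lt => e e0.
exists (Num.min del (e / K)) => /=; first by rewrite lt_min del0 divr_gt0.
move=> s /=; rewrite lt_min => /andP[h1 h2]; rewrite in_itv/= => sT.
have [->|su] := eqVneq s u; first by rewrite subrr normr0.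
rewrite distrC in h1 h2.
have q := h s sT su h1.
have su0 : 0 < `|s - u| by rewrite normr_gt0 subr_eq0.
have : `|(x s - x u) / (s - u)| < K.
  rewrite -[X in `|X|](subrK (S (x u))) (le_lt_trans (ler_normD _ _))//.
  by rewrite /K addrC ltrD2l.
rewrite normrM normfV ltr_pdivrMr// distrC => h3; apply: (lt_trans h3).
by rewrite mulrC -ltr_pdivlMr.
Qed.

(** The second fundamental theorem of calculus: inside the interval the equation
gives a two-sided derivative. *)
Lemma ode_integral t : 0 <= t <= T -> x t = x0 + \int[mu]_(s in `[0, t]) S (x s).
Proof.
move=> /andP[t0 tT]; have [x00 _] := hx.
move: t0; rewrite le_eqVlt => /orP[/eqP <-|t0].
  by rewrite set_itv1 Rintegral_set1 addr0.
have cSx : {within `[0, T], continuous (fun s => S (x s))}.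
  apply: (@within_continuous_comp _ _ _ `[0, T]%classic x S) => //.
  exact: ode_continuous.
have sub : `[0, t]%classic `<=` `[0, T]%classic.
  by move=> u /=; rewrite !in_itv/= => /andP[-> /le_trans]; apply.
have key u : u \in `]0, t[ -> h^-1 *: (x (h + u) - x u) @[h --> 0^'] --> S (x u).
  rewrite in_itv/= => /andP[u0 ut]; apply/cvgrPdist_lt => e e0.
  have uT : 0 <= u <= T by rewrite (ltW u0) (le_trans (ltW ut)).
  have [del del0 h] := ode_quotient uT e0.
  exists (Num.min del (Num.min u (t - u))) => /=.
    by rewrite !lt_min del0 u0 subr_gt0.
  move=> k /=; rewrite sub0r normrN !lt_min => /andP[k1 /andP[k2 k3]] k0.
  move: k2 k3; rewrite !ltr_norml => /andP[k2 k2'] /andP[k3 k3'].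
  have kT : 0 <= k + u <= T by apply/andP; split; lra.
  have ku : k + u != u by rewrite -subr_eq0 addrK.
  have kd : `|k + u - u| < del by rewrite addrK.
  have := h (k + u) kT ku kd; rewrite addrK.
  by rewrite -ltr_norml distrC /GRing.scale /= mulrC.
have := @continuous_FTC2 _ (fun s => S (x s)) x 0 t t0 (continuous_subspaceW sub cSx).
have /(continuous_within_itvP _ t0) [c1 c2 c3] := continuous_subspaceW sub ode_continuous.
move=> FTC.
have E : \int[mu]_(s in `[0, t]) S (x s) = x t - x 0.
  apply: (congr1 fine (FTC _ _)).
  - split => //.
    move=> u ut; apply/cvg_ex; exists (S (x u)).
    have -> : (fun h => h^-1 *: ((x \o shift u) (h *: 1) - x u)) =
        (fun h => h^-1 *: (x (h + u) - x u)).
      by apply/funext => h; rewrite /= /GRing.scale /= mulr1.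
    exact: key.
  - move=> u ut; rewrite /derive1; apply: cvg_lim => //; exact: key.
by rewrite E x00 addrC subrK.
Qed.

End solution.
End ode.

(** * Mean square of pathwise integrals *)

Section EI.
Context {d : measure_display} {Omega : measurableType d} {R : realType}.
Variables (P : probability Omega R) (T : R).
Notation mu := (@lebesgue_measure R).
Local Open Scope ereal_scope.
Local Notation E2 := (E2 P).
Local Notation D2 := (D2 P T).
Local Notation joint_meas := (joint_meas T).

Definition EI (r s : R) (K : R -> Omega -> R) := \int[mu]_(u in `[r, s]) E2 (K u).

Lemma joint_meas_sub r s (K : R -> Omega -> R) : joint_meas K -> (0 <= r)%R -> (s <= T)%R ->
  measurable_fun (`[r, s]%classic `*` [set: Omega]) (fun p : R * Omega => ((K p.1 p.2) ^+ 2)%:E).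
Proof.
move=> jK r0 sT; apply: measurable_funS (jmsqr jK).
  by apply: measurableX.
move=> [u w] /= [h _]; split => //; move: h; rewrite !in_itv/= => /andP[h1 h2].
by rewrite (le_trans r0 h1) (le_trans h2 sT).
Qed.

Let mI r s : measurable (`[r, s]%classic : set R). Proof. by []. Qed.
Let sq0 (K : R -> Omega -> R) s w : 0 <= ((K s w) ^+ 2)%:E.
Proof. by rewrite lee_fin sqr_ge0. Qed.

Section rs.
Variables (r s : R) (r0 : (0 <= r)%R) (sT : (s <= T)%R).

Lemma EI_swap (K : R -> Omega -> R) : joint_meas K ->
  \int[P]_w \int[mu]_(u in `[r, s]) ((K u w) ^+ 2)%:E = EI r s K.
Proof.
move=> jK; apply: (tonelli_swap P (mI r s) (g := fun u w => ((K u w) ^+ 2)%:E)) => //.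
exact: joint_meas_sub.
Qed.

Lemma EI_meas_w (K : R -> Omega -> R) : joint_meas K ->
  measurable_fun setT (fun w => \int[mu]_(u in `[r, s]) ((K u w) ^+ 2)%:E).
Proof.
move=> jK; apply: (tonelli_meas_w (mI r s) (g := fun u w => ((K u w) ^+ 2)%:E)) => //.
exact: joint_meas_sub.
Qed.

Lemma EI_meas_s (K : R -> Omega -> R) : joint_meas K -> measurable_fun `[r, s] (fun u => E2 (K u)).
Proof.
move=> jK; apply: (tonelli_meas_s P (mI r s) (g := fun u w => ((K u w) ^+ 2)%:E)) => //.
exact: joint_meas_sub.
Qed.

Lemma EI_le_cst (K : R -> Omega -> R) (M : R) : joint_meas K -> (r <= s)%R -> (0 <= M)%R ->
  (forall u, (r <= u <= s)%R -> E2 (K u) <= M%:E) -> EI r s K <= ((s - r) * M)%:E.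
Proof.
move=> jK rs M0 h.
apply: (@le_trans _ _ (\int[mu]_(u in `[r, s]) M%:E)).
  apply: ge0_le_integral => //.
  - by move=> u _; exact: E2_ge0.
  - exact: EI_meas_s.
rewrite integral_cst//= lebesgue_measure_itv/= lte_fin.
case: ltP => h'; first by rewrite -EFinD -EFinM mulrC.
by rewrite mule0 lee_fin mulr_ge0// subr_ge0.
Qed.

Lemma D2_window (K : R -> Omega -> R) : (r <= s)%R -> joint_meas K -> D2 (window r s K) <= EI r s K.
Proof.
move=> rs jK; rewrite -EI_swap//; apply: ge0_le_integral => //.
- by move=> w _; apply: integral_ge0.
- by apply: D2_meas; exact: joint_meas_window.
- exact: EI_meas_w.
- move=> w _.
  have -> : \int[mu]_(u in `[0%R, T]) ((window r s K u w) ^+ 2)%:E =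
     \int[mu]_(u in `[0%R, T] `&` `]r, s]) ((K u w) ^+ 2)%:E.
    rewrite [RHS]integral_mkcondr; apply: eq_integral => u _.
    rewrite patchE /window indicE; case: (_ \in _); first by rewrite mul1r.
    by rewrite mul0r expr0n.
  apply: ge0_subset_integral => //.
  + by apply: measurableI.
  + apply: (tonelli_section (mI r s) (g := fun u w => ((K u w) ^+ 2)%:E)) => //.
    exact: joint_meas_sub.
  + by move=> u /= [_]; rewrite !in_itv/= => /andP[/ltW -> ->].
Qed.

(** Cauchy-Schwarz along each path, then Tonelli. *)
Lemma path_int_E2 (K : R -> Omega -> R) (Z : Omega -> R) : (r <= s)%R -> joint_meas K -> continuous_paths T K ->
  measurable_fun setT Z ->
  {ae P, forall w, Z w = (\int[mu]_(u in `[r, s]) K u w)%R} ->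
  E2 Z <= (s - r)%:E * EI r s K.
Proof.
move=> rs jK cK mZ hZ; rewrite -EI_swap//.
rewrite -ge0_integralZl//; last 3 first.
- exact: EI_meas_w.
- by move=> w _; apply: integral_ge0.
- by rewrite lee_fin subr_ge0.
apply: ae_ge0_le_integral => //.
- by move=> w _; rewrite lee_fin sqr_ge0.
- exact: msqr.
- by move=> w _; rewrite mule_ge0// ?lee_fin ?subr_ge0//; apply: integral_ge0.
- by apply: emeasurable_funM; [exact: measurable_cst|exact: EI_meas_w].
apply: filterS hZ => w -> _.
have i1 := within_integrable (@cK w) r0 sT.
have c2 : {within `[0%R, T], continuous (fun u => K u w ^+ 2)%R}.
  apply: (@within_continuous_comp _ _ _ `[0%R, T]%classic (K ^~ w) (fun x => x ^+ 2)%R) => //.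
    by move=> x _; exact: exprn_continuous.
have i2 := within_integrable c2 r0 sT.
have := cauchy_schwarz rs i1 i2.
rewrite -lee_fin => /le_trans; apply.
by rewrite EFinM /Rintegral fineK//; exact: integrable_fin_num.
Qed.

End rs.

Lemma E2_scale_le (f g : Omega -> R) (c : R) : measurable_fun setT f ->
  measurable_fun setT g -> (forall w, (`|f w| <= c * `|g w|)%R) ->
  E2 f <= (c ^+ 2)%:E * E2 g.
Proof.
move=> mf mg h; rewrite /E2 -ge0_integralZl//; last 3 first.
- exact: msqr.
- by move=> w _; rewrite lee_fin sqr_ge0.
- by rewrite lee_fin sqr_ge0.
apply: ge0_le_integral => //.
- by move=> w _; rewrite lee_fin sqr_ge0.
- exact: msqr.
- by apply: emeasurable_funM; [exact: measurable_cst|exact: msqr].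
- move=> w _; rewrite -EFinM lee_fin -(real_normK (num_real (f w))).
  rewrite -(real_normK (num_real (g w))) -exprMn lerXn2r ?nnegrE//.
  exact: (le_trans _ (h w)).
Qed.

Lemma E2_cst (c : R) : E2 (fun=> c) = (c ^+ 2)%:E.
Proof. by rewrite /E2 integral_cst//= probability_setT mule1. Qed.

End EI.

(** * Distance to the deterministic path *)

Section estimates.
Context {d : measure_display} {Omega : measurableType d} {R : realType}.
Variables (P : probability Omega R) (F : R -> set (set Omega)) (T x0 : R)
  (W : R -> Omega -> R).
Hypotheses (T0 : 0 < T) (hF : filtration F T) (hW : wiener_process P F T W).
Variables (S sigma x : R -> R) (C : R).
Hypotheses (C0 : 0 < C)
  (lipS : forall a b, `|S a - S b| <= C * `|a - b|)
  (lips : forall a b, `|sigma a - sigma b| <= C * `|a - b|)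
  (hx : ode_solution T x0 S x).
Variables (Ks KS Kx : R).
Hypotheses (hKs : forall s, 0 <= s <= T -> `|sigma (x s)| <= Ks)
  (hKS : forall s, 0 <= s <= T -> `|S (x s)| <= KS)
  (hKx : forall s, 0 <= s <= T -> `|x s| <= Kx).
Notation mu := (@lebesgue_measure R).
Local Notation E2 := (E2 P).
Local Notation D2 := (D2 P T).
Local Notation joint_meas := (joint_meas T).
Local Notation EI := (EI P).

Lemma lip_continuous (f : R -> R) : (forall a b, `|f a - f b| <= C * `|a - b|) ->
  continuous f.
Proof.
move=> lf a; apply/cvgrPdist_lt => e e0.
exists (e / C) => /=; first by rewrite divr_gt0.
move=> b /= h; apply: (le_lt_trans (lf a b)).
by rewrite mulrC -ltr_pdivlMr.
Qed.

Section eps.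
Variables (eps : R) (e0 : 0 < eps) (e1 : eps <= 1) (X : R -> Omega -> R).
Hypotheses (hX : sde_solution P F T W x0 S sigma eps X)
  (A2 : bounded_second_moments P T X).

Lemma X_wrt s : 0 <= s <= T -> measurable_wrt (F s) (X s).
Proof. by move=> h; case: hX => + _ _; apply; rewrite in_itv. Qed.
Lemma X_meas s : 0 <= s <= T -> measurable_fun setT (X s).
Proof. by move=> h; apply: (wrt_measurable hF h); exact: X_wrt. Qed.
Lemma X_cont : continuous_paths T X.
Proof. by case: hX. Qed.

Lemma joint_meas_comp (f : R -> R) (y : R -> R) : continuous f ->
  {within `[0, T], continuous y} -> joint_meas (fun s w => f (X s w) - y s) /\
  continuous_paths T (fun s w => f (X s w) - y s).
Proof.
move=> cf cy.
have c : continuous_paths T (fun s w => f (X s w) - y s).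
  move=> w.
  have c1 : {within `[0, T], continuous (fun s => f (X s w))}.
    apply: (@within_continuous_comp _ _ _ `[0, T]%classic (X ^~ w) f) => //.
    exact: X_cont.
  by move=> s; apply: cvgB; [exact: c1|exact: cy].
split => //; apply: joint_meas_continuous => // s sT.
apply: measurable_funB => //; apply: measurableT_comp; last exact: X_meas.
exact: continuous_measurable_fun.
Qed.

Lemma cst_within (k : R) : {within `[0, T], continuous (fun _ : R => k)}.
Proof. by apply: continuous_subspaceT => ?; exact: cvg_cst. Qed.

Lemma joint_meas_comp0 (f : R -> R) : continuous f -> joint_meas (fun s w => f (X s w)) /\
  continuous_paths T (fun s w => f (X s w)).
Proof.
move=> cf; have := joint_meas_comp cf (@cst_within 0).
by under eq_fun do under eq_fun do rewrite subr0.
Qed.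

Let cS : continuous S := lip_continuous lipS.
Let cs : continuous sigma := lip_continuous lips.
Let cx : {within `[0, T], continuous x} := ode_continuous hx.

Let e s w := X s w - x s.

Lemma err_joint_meas : joint_meas e.
Proof. by have [] := @joint_meas_comp id x (fun a => cvg_id) cx. Qed.

Lemma err_meas s : 0 <= s <= T -> measurable_fun setT (e s).
Proof. by move=> h; apply: measurable_funB => //; exact: X_meas. Qed.

(** The a priori bound from which Gronwall's lemma starts. *)
Lemma err_bounded : exists M : R, forall s, 0 <= s <= T -> (E2 (e s) <= M%:E)%E.
Proof.
move: A2; rewrite /bounded_second_moments; set B := ereal_sup _ => hB.
have XB s : 0 <= s <= T -> (E2 (X s) <= B)%E.
  move=> sT; apply: ereal_sup_ubound; exists s; first by rewrite /= in_itv.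
  rewrite unlock; apply: eq_integral => w _.
  by rewrite real_normK// num_real.
have ts : 0 <= (0 : R) <= T by apply/andP; split => //; exact: ltW.
have B0 : (0 <= B)%E := le_trans (E2_ge0 P (X 0)) (XB 0 ts).
have Bf : B \is a fin_num by rewrite ge0_fin_numE.
exists (2 * fine B + 2 * Kx ^+ 2) => s sT.
rewrite EFinD !EFinM fineK//.
apply: (@le_trans _ _ (2%:E * E2 (X s) + 2%:E * E2 (fun=> x s))%E).
  apply: E2_le2 => //; [exact: err_meas|exact: X_meas|].
  move=> w; rewrite /e; have := sqr_ge0 (X s w + x s); lra.
apply: leeD; apply: lee_wpmul2l => //; first exact: XB.
rewrite E2_cst lee_fin -(real_normK (num_real (x s))).
by rewrite lerXn2r ?nnegrE ?(le_trans _ (hKx sT))// hKx.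
Qed.

Lemma E2_comp (f : R -> R) (K : R) s : (forall a b, `|f a - f b| <= C * `|a - b|) ->
  0 <= s <= T -> `|f (x s)| <= K ->
  (E2 (fun w => f (X s w)) <= (2 * C ^+ 2)%:E * E2 (e s) + (2 * K ^+ 2)%:E)%E.
Proof.
move=> lf sT hK.
have mfX : measurable_fun setT (fun w => f (X s w)).
  by apply: measurableT_comp (X_meas sT); exact: (continuous_measurable_fun (lip_continuous lf)).
apply: (@le_trans _ _ (2%:E * E2 (fun w => (f (X s w) - f (x s))%R) + 2%:E * E2 (fun=> f (x s)))%E).
  apply: E2_le2 => //; first exact: measurable_funB.
  move=> w; set a := f (X s w); set b := f (x s); have := sqr_ge0 (a - 2 * b); nra.
apply: leeD.
  rewrite EFinM -muleA; apply: lee_wpmul2l => //.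
  apply: E2_scale_le; [exact: measurable_funB|exact: err_meas|].
  by move=> w; exact: lf.
rewrite E2_cst -EFinM lee_fin ler_pM2l// -(real_normK (num_real (f (x s)))).
by rewrite lerXn2r ?nnegrE ?(le_trans _ hK).
Qed.

(** [I 0] vanishes almost surely. With [I s w - I 0 w], the equation involves only
increments of [I], and these are what the estimates control. *)
Lemma sde_ito : exists2 I, ito_integral P F T W (fun s w => sigma (X s w)) I &
  {ae P, forall w, I 0 w = 0 /\ forall s, 0 <= s <= T ->
    X s w = x0 + \int[mu]_(u in `[0, s]) S (X u w) + eps * (I s w - I 0 w)}.
Proof.
case: hX => _ _ [I hI ae1]; exists I => //.
have := I0_ae hF hI; move: ae1; apply: filterS2 => w h i0; split => // s sT.
by rewrite h ?in_itv// i0 subr0.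
Qed.

Variable I : R -> Omega -> R.
Hypotheses (hI : ito_integral P F T W (fun s w => sigma (X s w)) I)
  (aeX : {ae P, forall w, I 0 w = 0 /\ forall s, 0 <= s <= T ->
    X s w = x0 + \int[mu]_(u in `[0, s]) S (X u w) + eps * (I s w - I 0 w)}).

Lemma sigmaX_joint_meas : joint_meas (fun s w => sigma (X s w)).
Proof. by have [] := joint_meas_comp0 cs. Qed.

Lemma I_E2 r s : 0 <= r -> r <= s -> s <= T ->
  (E2 (fun w => (I s w - I r w)%R) <= (4 * gauss_var)%:E * EI r s (fun u w => sigma (X u w)))%E.
Proof.
move=> r0 rs sT.
have := ito_bound hF hW hI r0 rs sT [::].
rewrite (_ : (fun w => _ - step_int W (clampL hF r0 rs sT [::]) w) = (fun w => I s w - I r w)); last first.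
  by apply/funext => w; rewrite /step_int big_nil subr0.
move=> /le_trans; apply; apply: lee_wpmul2l; first by rewrite lee_fin mulr_ge0 ?gauss_var_ge0.
rewrite (_ : (fun u w => _ - step_proc _ u w) = (fun u w => sigma (X u w))); last first.
  by apply/funext => u; apply/funext => w; rewrite /step_proc big_nil subr0.
by apply: D2_window => //; exact: sigmaX_joint_meas.
Qed.

Let LG := 2 * T * C ^+ 2 + 16 * gauss_var * C ^+ 2.
Definition err_cst := 32 * gauss_var * Ks ^+ 2 * T * expR (2 * (2 * T * C ^+ 2 + 16 * gauss_var * C ^+ 2) * T).

(** In the difference of the two integral equations, the drift is bounded by the
integral of [E |X - x|^2] because [S] is Lipschitz; the noise is bounded, through
the isometry, by [eps^2] times a constant plus the same integral. *)
Lemma err_E2 s : 0 <= s <= T -> (E2 (e s) <= (err_cst * eps ^+ 2)%:E)%E.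
Proof.
have [M hM] := err_bounded.
have gauss_var0 := @gauss_var_ge0 R.
have efin u : 0 <= u <= T -> E2 (e u) \is a fin_num.
  by move=> uT; rewrite ge0_fin_numE ?E2_ge0// (le_lt_trans (hM u uT))// ltry.
(* Finite by [err_bounded], as Gronwall's lemma demands. *)
pose g u := fine (E2 (e u)).
have gE u : 0 <= u <= T -> (g u)%:E = E2 (e u) by move=> uT; rewrite fineK// efin.
have e2 : eps ^+ 2 <= 1 by rewrite expr_le1// ltW.
have LG0 : 0 < LG.
  by rewrite /LG ltr_pwDl// ?mulr_gt0 ?exprn_gt0// mulr_ge0 ?sqr_ge0// mulr_ge0.
pose A := 16 * eps ^+ 2 * gauss_var * Ks ^+ 2 * T.
have A0 : 0 <= A.
  rewrite /A; do 2 (apply: mulr_ge0; last by rewrite ?sqr_ge0 ?(ltW T0)).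
  by apply: mulr_ge0 => //; apply: mulr_ge0 => //; exact: sqr_ge0.
have mg : measurable_fun `[0, T]%classic g.
  apply: (@measurableT_comp _ _ _ _ _ _ fine).
    exact: fine_measurable.
  exact: (EI_meas_s P (lexx 0) (lexx T) err_joint_meas).
move=> sT; rewrite -gE// lee_fin.
have -> : err_cst * eps ^+ 2 = 2 * A * expR (2 * LG * T) by rewrite /err_cst /A /LG; ring.
apply: (@gronwall _ g T A LG M) => //.
  move=> u uT; rewrite fine_ge0 ?E2_ge0//=.
  by rewrite -lee_fin gE// hM.
move=> t tT; rewrite gE//.
have /andP[t0 tT'] := tT.
have -> : (\int[mu]_(u in `[0%R, t]) (g u)%:E = EI 0 t e)%E.
  apply: eq_integral => u; rewrite inE /= in_itv/= => /andP[u0 ut].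
  by rewrite gE// u0 (le_trans ut).
have mII : measurable_fun setT (fun w => I t w - I 0 w).
  by apply: measurable_funB; apply: (I_meas hF hI); rewrite ?lexx ?(ltW T0).
pose Z w := e t w - eps * (I t w - I 0 w).
have mZ : measurable_fun setT Z.
  by apply: measurable_funB; [exact: err_meas|exact: measurable_funM].
have cSx : {within `[0, T], continuous (fun u => S (x u))}.
  by apply: (@within_continuous_comp _ _ _ `[0, T]%classic x S) => //.
have [jK cK] := joint_meas_comp cS cSx.
have EIfin : (0 <= EI 0 t e)%E by apply: integral_ge0 => u _; exact: E2_ge0.
have EZ : (E2 Z <= (T * C ^+ 2)%:E * EI 0 t e)%E.
  have h1 : (E2 Z <= (t - 0)%:E * EI 0 t (fun u w => (S (X u w) - S (x u))%R))%E.
    apply: (path_int_E2 (lexx 0) tT' t0 jK cK mZ).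
    move: aeX; apply: filterS => w [_ h].
    rewrite /Z /e (h t tT) (ode_integral hx cS tT) RintegralB//.
    - by ring.
    - apply: (within_integrable _ (lexx 0) tT').
      by have [_ c] := joint_meas_comp0 cS; exact: c.
    - exact: (within_integrable cSx (lexx 0) tT').
  apply: (le_trans h1); rewrite subr0 EFinM -muleA.
  apply: lee_pmul => //.
  - by apply: integral_ge0 => u _; exact: E2_ge0.
  rewrite /EI -ge0_integralZl//; last 3 first.
  - exact: (EI_meas_s P (lexx 0) tT' err_joint_meas).
  - by move=> u _; exact: E2_ge0.
  - by rewrite lee_fin sqr_ge0.
  apply: ge0_le_integral => //.
  - by move=> u _; exact: E2_ge0.
  - exact: (EI_meas_s P (lexx 0) tT' jK).
  - apply: emeasurable_funM; first exact: measurable_cst.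
    exact: (EI_meas_s P (lexx 0) tT' err_joint_meas).
  - move=> u /=; rewrite in_itv/= => /andP[u0 ut].
    have uT : 0 <= u <= T by rewrite u0 (le_trans ut).
    apply: E2_scale_le; last by move=> w; exact: lipS.
      apply: measurable_funB => //; apply: measurableT_comp (X_meas uT).
      exact: continuous_measurable_fun.
    exact: err_meas.
have EIs : (EI 0 t (fun u w => sigma (X u w)) <=
    (2 * C ^+ 2)%:E * EI 0 t e + (2 * Ks ^+ 2 * T)%:E)%E.
  apply: (@le_trans _ _ (\int[mu]_(u in `[0%R, t]) ((2 * C ^+ 2)%:E * E2 (e u) + (2 * Ks ^+ 2)%:E))%E).
    apply: ge0_le_integral => //.
    - by move=> u _; exact: E2_ge0.
    - exact: (EI_meas_s P (lexx 0) tT' sigmaX_joint_meas).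
    - apply: emeasurable_funD => //; apply: emeasurable_funM; first exact: measurable_cst.
      exact: (EI_meas_s P (lexx 0) tT' err_joint_meas).
    - move=> u /=; rewrite in_itv/= => /andP[u0 ut].
      have uT : 0 <= u <= T by rewrite u0 (le_trans ut).
      by apply: E2_comp => //; exact: hKs.
  rewrite ge0_integralD//; last 3 first.
  - by move=> u _; rewrite mule_ge0 ?E2_ge0// lee_fin mulr_ge0 ?sqr_ge0.
  - apply: emeasurable_funM; first exact: measurable_cst.
    exact: (EI_meas_s P (lexx 0) tT' err_joint_meas).
  - by move=> u _; rewrite lee_fin mulr_ge0 ?sqr_ge0.
  apply: leeD.
    rewrite ge0_integralZl//.
    - exact: (EI_meas_s P (lexx 0) tT' err_joint_meas).
    - by move=> u _; exact: E2_ge0.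
    - by rewrite lee_fin mulr_ge0 ?sqr_ge0.
  rewrite integral_cst//= lebesgue_measure_itv/= lte_fin.
  case: ltP => _; last by rewrite mule0 lee_fin mulr_ge0 ?(ltW T0)// mulr_ge0 ?sqr_ge0.
  by rewrite -EFinD -EFinM lee_fin subr0 ler_wpM2l// mulr_ge0 ?sqr_ge0.
have EeI : (E2 (fun w => (eps * (I t w - I 0 w))%R) <=
    (4 * gauss_var * eps ^+ 2)%:E * EI 0 t (fun u w => sigma (X u w)))%E.
  rewrite (mulrC _ (eps ^+ 2)) EFinM -muleA.
  apply: (le_trans (E2_scale_le P (c := eps) _ mII _)).
  - exact: measurable_funM.
  - by move=> w; rewrite normrM gtr0_norm.
  - by apply: lee_wpmul2l; [rewrite lee_fin sqr_ge0|exact: I_E2].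
apply: (@le_trans _ _ (2%:E * E2 Z + 2%:E * E2 (fun w => (eps * (I t w - I 0 w))%R))%E).
  apply: E2_le2 => //; [exact: err_meas|exact: measurable_funM|].
  move=> w; rewrite /Z; set a := e t w; set b := eps * _; have := sqr_ge0 (a - 2 * b); nra.
have EIf : EI 0 t e \is a fin_num.
  have M0 : 0 <= Num.max 0 M by rewrite le_max lexx.
  have h u : 0 <= u <= t -> (E2 (e u) <= (Num.max 0 M)%:E)%E.
    move=> /andP[u0 ut]; apply: (le_trans (hM u _)); first by rewrite u0 (le_trans ut).
    by rewrite lee_fin le_max lexx orbT.
  rewrite ge0_fin_numE//.
  by apply: (le_lt_trans (EI_le_cst (lexx 0) tT' err_joint_meas t0 M0 h)); rewrite ltry.
set y := EI 0 t e in EIf EZ EIs EIfin *.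
have [y' yE] : exists y', y = y'%:E by exists (fine y); rewrite fineK.
rewrite yE -?EFinM -?EFinD in EZ EIs EIfin *.
rewrite lee_fin in EIfin.
apply: (@le_trans _ _ (2%:E * (T * C ^+ 2 * y')%:E +
    2%:E * ((4 * gauss_var * eps ^+ 2)%:E * (2 * C ^+ 2 * y' + 2 * Ks ^+ 2 * T)%:E))%E).
  apply: leeD; apply: lee_wpmul2l => //.
  apply: (le_trans EeI); apply: lee_wpmul2l => //.
  by rewrite lee_fin mulr_ge0 ?sqr_ge0// mulr_ge0.
rewrite -!EFinM -!EFinD lee_fin /A /LG.
have -> : 2 * (T * C ^+ 2 * y') + 2 * (4 * gauss_var * eps ^+ 2 * (2 * C ^+ 2 * y' + 2 * Ks ^+ 2 * T)) =
  16 * eps ^+ 2 * gauss_var * Ks ^+ 2 * T + (2 * T * C ^+ 2 * y' + eps ^+ 2 * (16 * gauss_var * C ^+ 2 * y')).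
  by ring.
set z := 16 * gauss_var * C ^+ 2 * y'.
have z0 : 0 <= z.
  apply: mulr_ge0 => //; apply: mulr_ge0; last exact: sqr_ge0.
  exact: mulr_ge0.
have hz : eps ^+ 2 * z <= z by rewrite ler_piMl.
have -> : (2 * T * C ^+ 2 + 16 * gauss_var * C ^+ 2) * y' = 2 * T * C ^+ 2 * y' + z by rewrite /z; ring.
lra.
Qed.

Definition sigma_cst := 2 * C ^+ 2 * err_cst + 2 * Ks ^+ 2.
Definition S_cst := 2 * C ^+ 2 * err_cst + 2 * KS ^+ 2.
Definition incr_cst := 2 * S_cst + 8 * gauss_var * sigma_cst.

Lemma err_cst_ge0 : 0 <= err_cst.
Proof.
have gauss_var0 := @gauss_var_ge0 R.
apply: mulr_ge0; last exact: expR_ge0.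
by apply: mulr_ge0; [apply: mulr_ge0; [exact: mulr_ge0|exact: sqr_ge0]|exact: ltW].
Qed.

Lemma sigma_cst_ge0 : 0 <= sigma_cst.
Proof.
by rewrite addr_ge0// mulr_ge0 ?sqr_ge0// ?err_cst_ge0// mulr_ge0 ?sqr_ge0.
Qed.

Lemma S_cst_ge0 : 0 <= S_cst.
Proof.
by rewrite addr_ge0// mulr_ge0 ?sqr_ge0// ?err_cst_ge0// mulr_ge0 ?sqr_ge0.
Qed.

Lemma incr_cst_ge0 : 0 <= incr_cst.
Proof.
by rewrite addr_ge0// mulr_ge0 ?S_cst_ge0 ?sigma_cst_ge0// mulr_ge0 ?gauss_var_ge0.
Qed.

Let eps2 : eps ^+ 2 <= 1. Proof. by rewrite expr_le1// ltW. Qed.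

Lemma E2_comp_le (f : R -> R) (K : R) s : (forall a b, `|f a - f b| <= C * `|a - b|) ->
  0 <= s <= T -> `|f (x s)| <= K ->
  (E2 (fun w => f (X s w)) <= (2 * C ^+ 2 * err_cst + 2 * K ^+ 2)%:E)%E.
Proof.
move=> lf sT hK; apply: (le_trans (E2_comp lf sT hK)).
rewrite EFinD; apply: leeD => //.
rewrite [X in (_ <= X)%E]EFinM; apply: lee_wpmul2l; first by rewrite lee_fin mulr_ge0 ?sqr_ge0.
by apply: (le_trans (err_E2 sT)); rewrite lee_fin ler_piMr// err_cst_ge0.
Qed.

Section rs.
Variables (r s : R) (r0 : 0 <= r) (rs : r <= s) (sT : s <= T) (mesh : s - r <= eps ^+ 2).

Let inT u : r <= u <= s -> 0 <= u <= T.
Proof. by move=> /andP[ru us]; rewrite (le_trans r0 ru) (le_trans us sT). Qed.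

Lemma EI_X_le (f : R -> R) (K : R) : (forall a b, `|f a - f b| <= C * `|a - b|) ->
  (forall u, 0 <= u <= T -> `|f (x u)| <= K) ->
  (EI r s (fun u w => f (X u w)) <= ((s - r) * (2 * C ^+ 2 * err_cst + 2 * K ^+ 2))%:E)%E.
Proof.
move=> lf hK; apply: (EI_le_cst r0 sT _ rs).
- by have [] := joint_meas_comp0 (lip_continuous lf).
- by rewrite addr_ge0// mulr_ge0 ?sqr_ge0// ?err_cst_ge0// mulr_ge0 ?sqr_ge0.
- by move=> u /inT uT; apply: E2_comp_le => //; exact: hK.
Qed.

Lemma I_rs_meas : measurable_fun setT (fun w => I s w - I r w).
Proof.
by apply: measurable_funB; apply: (I_meas hF hI); apply: inT; rewrite lexx rs.
Qed.

Lemma X_rs_meas : measurable_fun setT (fun w => X s w - X r w).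
Proof.
by apply: measurable_funB; apply: X_meas; apply: inT; rewrite lexx rs.
Qed.

(** The drift contributes [(s - r)^2] and the noise [eps^2 (s - r)], both at most
[eps^4] for a step of length at most [eps^2]. *)
Lemma incr_E2 : (E2 (fun w => (X s w - X r w)%R) <= (incr_cst * eps ^+ 4)%:E)%E.
Proof.
have sr0 : 0 <= s - r by rewrite subr_ge0.
have gauss_var0 := @gauss_var_ge0 R.
pose Z w := X s w - X r w - eps * (I s w - I r w).
have mZ : measurable_fun setT Z.
  by apply: measurable_funB; [exact: X_rs_meas|apply: measurable_funM => //; exact: I_rs_meas].
have [jK cK] := joint_meas_comp0 cS.
have EZ : (E2 Z <= ((s - r) ^+ 2 * S_cst)%:E)%E.
  have h : (E2 Z <= (s - r)%:E * EI r s (fun u w => S (X u w)))%E.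
    apply: (path_int_E2 r0 sT rs jK cK mZ).
    move: aeX; apply: filterS => w [_ h].
    rewrite /Z (h s) ?(inT _) ?lexx ?rs// (h r) ?(inT _) ?lexx ?rs//.
    rewrite -(Rint_split (@cK w) r0 rs sT).
    by ring.
  apply: (le_trans h); rewrite expr2 -mulrA EFinM; apply: lee_wpmul2l; first by rewrite lee_fin.
  exact: EI_X_le.
have EZ2 : (E2 (fun w => (eps * (I s w - I r w))%R) <= (eps ^+ 2 * (4 * gauss_var * ((s - r) * sigma_cst)))%:E)%E.
  apply: (le_trans (E2_scale_le P (c := eps) _ I_rs_meas _)).
  - by apply: measurable_funM => //; exact: I_rs_meas.
  - by move=> w; rewrite normrM gtr0_norm.
  rewrite [X in (_ <= X)%E]EFinM; apply: lee_wpmul2l; first by rewrite lee_fin sqr_ge0.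
  apply: (le_trans (I_E2 r0 rs sT)).
  rewrite [X in (_ <= X)%E]EFinM; apply: lee_wpmul2l; first by rewrite lee_fin mulr_ge0.
  exact: EI_X_le.
apply: (@le_trans _ _ (2%:E * E2 Z + 2%:E * E2 (fun w => (eps * (I s w - I r w))%R))%E).
  apply: E2_le2 => //; first exact: X_rs_meas.
    by apply: measurable_funM => //; exact: I_rs_meas.
  move=> w; rewrite /Z; set a := X s w - X r w; set b := eps * _.
  have := sqr_ge0 (a - 2 * b); nra.
apply: (@le_trans _ _ (2%:E * ((s - r) ^+ 2 * S_cst)%:E +
    2%:E * (eps ^+ 2 * (4 * gauss_var * ((s - r) * sigma_cst)))%:E)%E).
  by apply: leeD; apply: lee_wpmul2l.
rewrite -!EFinM -!EFinD lee_fin /incr_cst mulrDl.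
have h1 : (s - r) ^+ 2 <= eps ^+ 4.
  by rewrite (exprM eps 2 2) lerXn2r// nnegrE// sqr_ge0.
have h2 : eps ^+ 2 * (s - r) <= eps ^+ 4.
  by rewrite (exprM eps 2 2) [leRHS]expr2 ler_wpM2l// sqr_ge0.
have S_cst0 := S_cst_ge0; have sigma_cst0 := sigma_cst_ge0.
have h3 : S_cst * (s - r) ^+ 2 <= S_cst * eps ^+ 4 by rewrite ler_wpM2l.
have h4 : (gauss_var * sigma_cst) * (eps ^+ 2 * (s - r)) <= (gauss_var * sigma_cst) * eps ^+ 4.
  by rewrite ler_wpM2l// mulr_ge0.
lra.
Qed.

Definition drift_err w := X s w - X r w - eps * (I s w - I r w) - S (X r w) * (s - r).

Lemma SX_meas u : 0 <= u <= T -> measurable_fun setT (fun w => S (X u w)).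
Proof.
by move=> uT; apply: measurableT_comp (X_meas uT); exact: continuous_measurable_fun.
Qed.

Lemma drift_err_meas : measurable_fun setT drift_err.
Proof.
apply: measurable_funB.
  by apply: measurable_funB; [exact: X_rs_meas|apply: measurable_funM => //; exact: I_rs_meas].
by apply: measurable_funM => //; apply: SX_meas; apply: inT; rewrite lexx rs.
Qed.

End rs.

(** This is the right order: a drift error is [O((s - r) eps^2)] in mean, so that
the sum over the grid divided by [eps] is [O(eps)]. *)
Lemma drift_err_E2 r s : 0 <= r -> r <= s -> s <= T -> s - r <= eps ^+ 2 ->
  (E2 (drift_err r s) <= ((s - r) ^+ 2 * (C ^+ 2 * incr_cst * eps ^+ 4))%:E)%E.
Proof.
move=> r0 rs sT mesh.
have sr0 : 0 <= s - r by rewrite subr_ge0.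
have inT u : r <= u <= s -> 0 <= u <= T.
  by move=> /andP[ru us]; rewrite (le_trans r0 ru) (le_trans us sT).
have rT : 0 <= r <= T by apply: inT; rewrite lexx.
have [jK0 cK0] := joint_meas_comp0 cS.
have cK : continuous_paths T (fun u w => S (X u w) - S (X r w)).
  by move=> w u; apply: cvgB; [exact: cK0|exact: cvg_cst].
have jK : joint_meas (fun u w => S (X u w) - S (X r w)).
  apply: joint_meas_continuous => // u uT.
  by apply: measurable_funB; exact: SX_meas.
have incr_cst0 := incr_cst_ge0.
have h : (E2 (drift_err r s) <= (s - r)%:E * EI r s (fun u w => (S (X u w) - S (X r w))%R))%E.
  apply: (path_int_E2 r0 sT rs jK cK (drift_err_meas r0 rs sT)).
  move: aeX; apply: filterS => w [_ h].
  rewrite RintegralB//; last 2 first.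
  - exact: (within_integrable (@cK0 w) r0 sT).
  - by apply: (within_integrable _ r0 sT); exact: cst_within.
  rewrite Rint_itv_cst//.
  rewrite -(Rint_split (@cK0 w) r0 rs sT).
  rewrite /drift_err (h s) ?(inT _) ?lexx ?rs// (h r)//.
  by ring.
apply: (le_trans h); rewrite expr2 -mulrA EFinM; apply: lee_wpmul2l; first by rewrite lee_fin.
apply: (EI_le_cst r0 sT jK rs).
  by rewrite mulr_ge0 ?exprn_ge0 ?(ltW e0)// mulr_ge0 ?sqr_ge0.
move=> u /andP[ru us].
have uT : 0 <= u <= T by apply: inT; rewrite ru.
apply: (@le_trans _ _ ((C ^+ 2)%:E * E2 (fun w => (X u w - X r w)%R))%E).
  apply: E2_scale_le; last by move=> w; exact: lipS.
    by apply: measurable_funB; exact: SX_meas.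
  by apply: measurable_funB; exact: X_meas.
rewrite -mulrA [X in (_ <= X)%E]EFinM; apply: lee_wpmul2l; first by rewrite lee_fin sqr_ge0.
apply: incr_E2 => //; first by case/andP: uT.
by apply: le_trans mesh; rewrite lerB.
Qed.

(** * From the score to a Gaussian martingale *)

Let gauss_var0 := @gauss_var_ge0 R.
Let err_cst0 : 0 <= err_cst. Proof. exact: err_cst_ge0. Qed.
Let incr_cst0 : 0 <= incr_cst. Proof. exact: incr_cst_ge0. Qed.
Let KS0 : 0 <= KS.
Proof.
have h : 0 <= (0 : R) <= T by apply/andP; split => //; exact: ltW.
exact: le_trans (normr_ge0 _) (hKS h).
Qed.

Lemma x_lip r s : 0 <= r -> r <= s -> s <= T -> `|x s - x r| <= KS * (s - r).
Proof.
move=> r0 rs sT.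
have cSx : {within `[0, T], continuous (fun u => S (x u))}.
  by apply: (@within_continuous_comp _ _ _ `[0, T]%classic x S) => //.
rewrite (ode_integral hx cS) ?(le_trans r0 rs)// (ode_integral hx cS) ?r0 ?(le_trans rs)//.
have -> : x0 + \int[mu]_(u in `[0, s]) S (x u) - (x0 + \int[mu]_(u in `[0, r]) S (x u)) =
   \int[mu]_(u in `[r, s]) S (x u).
  by rewrite -(Rint_split cSx r0 rs sT); ring.
apply: Rint_itv_bound => //; first exact: (within_integrable cSx r0 sT).
by move=> u /andP[ru us]; apply: hKS; rewrite (le_trans r0 ru) (le_trans us).
Qed.

Section grid.
Variables (n : nat) (t : nat -> R) (t0 : t 0%N = 0) (tn : t n = T)
  (tlt : forall i, (i < n)%N -> t i < t i.+1)
  (tmesh : forall i, (i < n)%N -> t i.+1 - t i <= eps ^+ 2).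

Lemma grid_le i j : (i <= j)%N -> (j <= n)%N -> t i <= t j.
Proof.
by apply: le_of_steps => k kn; exact/ltW/tlt.
Qed.

Lemma grid_ge0 i : (i <= n)%N -> 0 <= t i.
Proof. by move=> h; rewrite -t0 grid_le. Qed.

Lemma grid_leT i : (i <= n)%N -> t i <= T.
Proof. by move=> h; rewrite -tn grid_le. Qed.

Lemma grid_in i : (i <= n)%N -> 0 <= t i <= T.
Proof. by move=> h; rewrite grid_ge0 ?grid_leT. Qed.

Section grid_elem.
Variable i : 'I_n.
Let c : Omega -> R := fun=> sigma (x (t i)).
Lemma grid_elem_bdd : exists M, forall w, `|c w| <= M. Proof. by exists `|sigma (x (t i))|. Qed.
Lemma grid_elem_wrt : t i < t i.+1 -> measurable_wrt (F (t i)) c.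
Proof. by move=> _; apply: (wrt_cst hF); apply: grid_in; exact: ltnW. Qed.
Lemma grid_elem_meas : measurable_fun setT c. Proof. exact: measurable_cst. Qed.
Definition grid_elem : elem F T := Elem (grid_ge0 (ltnW (ltn_ord i)))
  (ltW (tlt (ltn_ord i))) (grid_leT (ltn_ord i)) grid_elem_wrt grid_elem_meas grid_elem_bdd.
End grid_elem.

Definition grid_elems := map grid_elem (index_enum 'I_n).

(** The score without its errors: the diffusion coefficient is taken along the
deterministic path and frozen at the beginning of each step. *)
Definition gauss_mart k w := \sum_(i < k) sigma (x (t i)) * (W (t i.+1) w - W (t i) w).

Lemma step_int_grid k (kn : (k <= n)%N) w :
  step_int W (clampL hF (lexx 0) (grid_ge0 kn) (grid_leT kn) grid_elems) w = gauss_mart k w.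
Proof.
rewrite step_int_clamp big_map /gauss_mart (big_ord_widen _ (fun i => sigma (x (t i)) * (W (t i.+1) w - W (t i) w)) kn).
rewrite [RHS]big_mkcond /=; apply: eq_bigr => i _.
have i1 := grid_ge0 (ltn_ord i); have i0 := grid_ge0 (ltnW (ltn_ord i)).
rewrite (min_l i1) (min_l i0) subrr subr0.
case: ltnP => ik.
  have h1 : t i.+1 <= t k by rewrite grid_le.
  have h2 : t i <= t k by rewrite grid_le// ltnW.
  by rewrite (min_r h1) (min_r h2).
have h1 : t k <= t i by rewrite grid_le// ltnW.
have h2 : t k <= t i.+1 by rewrite grid_le// (leq_trans ik).
by rewrite (min_l h1) (min_l h2) subrr mulr0.
Qed.

Lemma step_proc_grid u w : 0 < u <= T -> exists2 i, (i < n)%N &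
  t i < u <= t i.+1 /\ step_proc grid_elems u w = sigma (x (t i)).
Proof.
move=> /andP[u0 uT].
have ex : exists i, u <= t i by exists n; rewrite tn.
pose m := ex_minn ex.
have mP : u <= t m by rewrite /m; case: ex_minnP.
have mmin j : (j < m)%N -> t j < u.
  rewrite /m; case: ex_minnP => m' _ hm' jm; rewrite ltNge; apply/negP => /hm'.
  by rewrite leqNgt jm.
have mn : (m <= n)%N by rewrite /m; case: ex_minnP => m' _; apply; rewrite tn.
case: m mP mmin mn => [|i] mP mmin mn; first by move: mP; rewrite t0 leNgt u0.
exists i => //; split; first by rewrite mmin// mP.
rewrite /step_proc big_map (bigD1 (Ordinal mn))//= big1 ?addr0.
  by rewrite indicE mem_set ?mul1r//= in_itv/= mmin.
move=> j ji; rewrite indicE memNset ?mul0r//= in_itv/= => /andP[h1 h2].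
case/negP: ji; apply/eqP/val_inj => /=; apply/eqP; rewrite eqn_leq; apply/andP; split.
  rewrite -ltnS ltnNge; apply/negP => ij.
  by move: h1; rewrite ltNge (le_trans mP)// grid_le// ltnW.
rewrite -ltnS ltnNge; apply/negP => ij.
by move: (mmin i (ltnSn i)); rewrite ltNge (le_trans h2)// grid_le// ltnW.
Qed.

Definition ito_err k w := I (t k) w - I 0 w - gauss_mart k w.

Definition ito_err_cst := 8 * gauss_var * T * C ^+ 2 * (err_cst + KS ^+ 2).

(** By the isometry bound it suffices to compare [sigma(X_u)] with
[sigma(x_{t_i})], through [sigma(x_u)]; here [u - t_i <= eps^2 <= eps]. *)
Lemma ito_err_E2 : (E2 (ito_err n) <= (ito_err_cst * eps ^+ 2)%:E)%E.
Proof.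
have := ito_bound hF hW hI (lexx 0) (grid_ge0 (leqnn n)) (grid_leT (leqnn n)) grid_elems.
rewrite (_ : (fun w => _ - _ - step_int W _ w) = ito_err n); last first.
  by apply/funext => w; rewrite step_int_grid.
move=> /le_trans; apply; rewrite tn.
have jX : joint_meas (fun u w => sigma (X u w) - sigma (x u)) /\
    continuous_paths T (fun u w => sigma (X u w) - sigma (x u)).
  apply: (joint_meas_comp cs).
  by apply: (@within_continuous_comp _ _ _ `[0, T]%classic x sigma).
have jsx : joint_meas (fun u (w : Omega) => sigma (x u)).
  apply: joint_meas_continuous => // w.
  by apply: (@within_continuous_comp _ _ _ `[0, T]%classic x sigma).
have jD : joint_meas (window 0 T (fun u w => sigma (x u) - step_proc grid_elems u w)).
  by apply: joint_meas_window; apply: joint_measB => //; exact: joint_meas_step_proc.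
have EI_D2 K : joint_meas K -> D2 K = EI 0 T K by exact: D2_swap.
apply: (@le_trans _ _ ((4 * gauss_var)%:E * (2%:E * D2 (fun u w => (sigma (X u w) - sigma (x u))%R) +
   2%:E * D2 (window 0 T (fun u w => (sigma (x u) - step_proc grid_elems u w)%R))))%E).
  apply: lee_wpmul2l; first by rewrite lee_fin mulr_ge0.
  apply: D2_le2 => //; last 2 first.
  - by case: jX.
  - move=> u w; rewrite /window indicE; set a := sigma (X u w); set b := sigma (x u); set c := step_proc _ _ _.
    case: (_ \in _); rewrite ?mul1r ?mul0r.
      have := sqr_ge0 (a - b - (b - c)); nra.
    by have := sqr_ge0 (a - b); nra.
  - apply: joint_meas_window; apply: joint_measB; last exact: joint_meas_step_proc.
    exact: (integrand_joint_meas hI).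
have T0' := ltW T0.
have h1 : (D2 (fun u w => (sigma (X u w) - sigma (x u))%R) <= (T * (C ^+ 2 * err_cst * eps ^+ 2))%:E)%E.
  rewrite EI_D2; last by case: jX.
  rewrite -[X in (X * _)%:E]subr0; apply: (EI_le_cst (lexx 0) (lexx T)) => //; first by case: jX.
    by rewrite mulr_ge0 ?sqr_ge0// mulr_ge0 ?sqr_ge0.
  move=> u uT.
  apply: (@le_trans _ _ ((C ^+ 2)%:E * E2 (e u))%E).
    apply: E2_scale_le; last by move=> w; exact: lips.
      apply: measurable_funB => //; apply: measurableT_comp (X_meas uT).
      exact: continuous_measurable_fun.
    by apply: measurable_funB => //; exact: X_meas.
  rewrite -mulrA [X in (_ <= X)%E]EFinM; apply: lee_wpmul2l; first by rewrite lee_fin sqr_ge0.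
  exact: err_E2.
have h2 : (D2 (window 0 T (fun u w => (sigma (x u) - step_proc grid_elems u w)%R)) <= (T * (C ^+ 2 * KS ^+ 2 * eps ^+ 2))%:E)%E.
  rewrite EI_D2//.
  rewrite -[X in (X * _)%:E]subr0; apply: (EI_le_cst (lexx 0) (lexx T)) => //.
    by rewrite mulr_ge0 ?sqr_ge0// mulr_ge0 ?sqr_ge0.
  move=> u uT.
  apply: (@le_trans _ _ (E2 (fun=> C * (KS * eps)))); last first.
    by rewrite E2_cst lee_fin !exprMn mulrA.
  rewrite -[leRHS]mul1e -[1%E]/((1:R)%:E) -[1](expr1n _ 2).
  apply: E2_scale_le => //.
    apply: measurable_funM => //; apply: measurable_funB => //.
    apply: measurable_sum => i; apply: measurable_funM => //; exact: ev_meas.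
  move=> w; rewrite mul1r [leRHS]ger0_norm; last by rewrite !mulr_ge0// ltW.
  rewrite /window indicE; case: (boolP (_ \in _)); rewrite ?mul0r ?normr0; last first.
    by rewrite !mulr_ge0// ltW.
  rewrite inE /= in_itv /= mul1r => uT'.
  have [i ni [/andP[i1 i2] ->]] := step_proc_grid w uT'.
  apply: (le_trans (lips _ _)); rewrite ler_pM2l//.
  apply: (le_trans (x_lip _ (ltW i1) _)); rewrite ?grid_ge0//; [exact: ltnW|by case/andP: uT|].
  apply: ler_wpM2l => //.
  apply: (@le_trans _ _ (eps ^+ 2)); last by rewrite expr2 ler_piMl// ltW.
  by apply: le_trans (tmesh ni); rewrite lerB.
apply: (@le_trans _ _ ((4 * gauss_var)%:E * (2%:E * (T * (C ^+ 2 * err_cst * eps ^+ 2))%:E +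
    2%:E * (T * (C ^+ 2 * KS ^+ 2 * eps ^+ 2))%:E))%E).
  apply: lee_wpmul2l; first by rewrite lee_fin mulr_ge0.
  by apply: leeD; apply: lee_wpmul2l.
rewrite -?EFinM -?EFinD -?EFinM -?EFinD -?EFinM lee_fin /ito_err_cst le_eqVlt.
by apply/orP; left; apply/eqP; ring.
Qed.

Definition score_sum k w := \sum_(i < k)
  (X (t i.+1) w - X (t i) w - S (X (t i) w) * (t i.+1 - t i)).

Lemma score_sum_decomp k w : eps^-1 * score_sum k w =
  eps^-1 * (\sum_(i < k) drift_err (t i) (t i.+1) w) + ito_err k w + gauss_mart k w.
Proof.
have -> : score_sum k w = \sum_(i < k) drift_err (t i) (t i.+1) w +
   eps * (I (t k) w - I 0 w).
  rewrite -{2}t0 -(telescope_sumr (fun i => I (t i) w) (leq0n k)) big_mkord.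
  rewrite mulr_sumr -big_split /=; apply: eq_bigr => i _.
  by rewrite /drift_err; ring.
by rewrite mulrDr mulrA mulVf ?gt_eqF// mul1r /ito_err; ring.
Qed.

Lemma ito_err_wrt k : (k <= n)%N -> measurable_wrt (F (t k)) (ito_err k).
Proof.
move=> kn; have kT := grid_in kn.
have T00 : 0 <= (0 : R) <= T by apply/andP; split => //; exact: ltW.
apply: (wrt_B hF) => //.
  apply: (wrt_B hF) => //; first exact: (I_wrt hI).
  apply: (wrt_le hF (lexx 0)); [by case/andP: kT|by case/andP: kT|].
  exact: (I_wrt hI).
have <- : step_int W (clampL hF (lexx 0) (grid_ge0 kn) (grid_leT kn) grid_elems) = gauss_mart k.
  by apply/funext => w; exact: step_int_grid.
exact: (step_int_clamp_wrt hF hW).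
Qed.

Lemma ito_err_L2 k : (k <= n)%N -> L2 P (ito_err k).
Proof.
move=> kn; apply: L2B.
  exact: (Iinc_L2 hF hW hI (lexx 0) (grid_ge0 kn) (grid_leT kn)).
have <- : step_int W (clampL hF (lexx 0) (grid_ge0 kn) (grid_leT kn) grid_elems) = gauss_mart k.
  by apply/funext => w; exact: step_int_grid.
exact: (step_int_L2 hF hW).
Qed.

Lemma ito_err_mart k (Y : Omega -> R) : (k <= n)%N -> measurable_wrt (F (t k)) Y -> L2 P Y ->
  \int[P]_w ((ito_err n w - ito_err k w) * Y w) = 0.
Proof.
move=> kn mY LY.
have tkn : t k <= t n by exact: grid_le.
rewrite -(ito_mart hF hW hI (grid_ge0 kn) tkn (grid_leT (leqnn n)) grid_elems mY LY).
apply: eq_Rintegral => w _; congr (_ * _).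
have -> : step_int W (clampL hF (grid_ge0 kn) tkn (grid_leT (leqnn n)) grid_elems) w = gauss_mart n w - gauss_mart k w.
  rewrite -(step_int_grid (leqnn n)) -(step_int_grid kn) !step_int_clamp -sumrB; apply: eq_bigr => el _.
  rewrite (min_l (ea_ge0 el)) (min_l (le_trans (ea_ge0 el) (ea_le el))) subrr !subr0.
  by rewrite mulrBr.
by rewrite /ito_err; ring.
Qed.

Definition qvar k := \sum_(i < k) sigma (x (t i)) ^+ 2 * (t i.+1 - t i).

(** A Riemann sum with mesh at most [eps^2], of a Lipschitz function of time. *)
Lemma qvar_approx :
  `|qvar n - \int[mu]_(s in `[0, T]) sigma (x s) ^+ 2| <= 2 * Ks * C * KS * T * eps ^+ 2.
Proof.
have cg : {within `[0, T], continuous (fun s => sigma (x s) ^+ 2)}.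
  have cs2 : continuous (fun a => sigma a ^+ 2).
    by move=> a; rewrite /continuous_at expr2; apply: cvgM; exact: cs.
  exact: (@within_continuous_comp _ _ _ `[0, T]%classic x (fun a => sigma a ^+ 2)).
have h0 : 0 <= (0 : R) <= T by apply/andP; split => //; exact: ltW.
have Ks0 : 0 <= Ks := le_trans (normr_ge0 _) (hKs h0).
have -> : \int[mu]_(s in `[0, T]) sigma (x s) ^+ 2 =
    \sum_(i < n) \int[mu]_(s in `[t i, t i.+1]) sigma (x s) ^+ 2.
  have := telescope_sumr (fun i => \int[mu]_(s in `[0, t i]) sigma (x s) ^+ 2) (leq0n n).
  rewrite tn t0 set_itv1 Rintegral_set1 subr0 big_mkord => <-; apply: eq_bigr => i _.
  have /andP[i0 _] := grid_in (ltnW (ltn_ord i)).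
  have /andP[_ i1] := grid_in (ltn_ord i).
  by rewrite (Rint_split cg i0 (ltW (tlt (ltn_ord i))) i1).
rewrite /qvar -sumrB; apply: (le_trans (ler_norm_sum _ _ _)).
apply: (@le_trans _ _ (\sum_(i < n) 2 * Ks * C * KS * eps ^+ 2 * (t i.+1 - t i))).
  apply: ler_sum => i _.
  have /andP[i0 _] := grid_in (ltnW (ltn_ord i)).
  have /andP[_ i1] := grid_in (ltn_ord i).
  have ti := ltW (tlt (ltn_ord i)).
  set c := sigma (x (t i)) ^+ 2.
  have ig := within_integrable cg i0 i1.
  have ic := itv_cst_integrable (t i) (t i.+1) c.
  rewrite -(Rint_itv_cst c ti) -RintegralB//; apply: Rint_itv_bound => //.
    by apply: (integrableB _ ic ig).
  move=> u /andP[iu ui].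
  have u1 : 0 <= u <= T by rewrite (le_trans i0) ?(le_trans ui).
  have j1 : 0 <= t i <= T by exact: (grid_in (ltnW (ltn_ord i))).
  rewrite /c subr_sqr normrM.
  have -> : 2 * Ks * C * KS * eps ^+ 2 = (C * (KS * eps ^+ 2)) * (Ks + Ks) by ring.
  apply: ler_pM => //; last by rewrite (le_trans (ler_normD _ _))// lerD// hKs.
  apply: (le_trans (lips _ _)); rewrite ler_pM2l// distrC.
  have u2 : u <= T by case/andP: u1.
  apply: (le_trans (x_lip i0 iu u2)); apply: ler_wpM2l => //.
  by apply: le_trans (tmesh (ltn_ord i)); rewrite lerD2r.
rewrite -mulr_sumr -(big_mkord xpredT (fun i => t i.+1 - t i)) telescope_sumr// tn t0 subr0.
by rewrite le_eqVlt; apply/orP; left; apply/eqP; ring.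
Qed.

Variables (delta : R) (delta0 : 0 < delta).

Definition bad_ito := \bigcup_(k in [set k | (k <= n)%N]) [set w | delta < `|ito_err k w|].

Lemma measurable_gt (f : Omega -> R) : measurable_fun setT f -> measurable [set w | delta < f w].
Proof.
move=> mf; have := mf measurableT `]delta, +oo[%classic (measurable_itv _).
rewrite setTI (_ : _ @^-1` _ = [set w | delta < f w])//.
by apply/seteqP; split => w /=; rewrite in_itv/= andbT.
Qed.

Lemma bad_ito_meas : measurable bad_ito.
Proof.
apply: bigcup_measurable => k /= kn; apply: measurable_gt.
by apply: measurableT_comp => //; case: (ito_err_L2 kn).
Qed.

Lemma bad_ito_prob : (P bad_ito <= (ito_err_cst * eps ^+ 2 / delta ^+ 2)%:E)%E.
Proof.
apply: (le_trans (@maximal_ineq _ _ _ P n (fun k => F (t k)) ito_err delta _ _ _ _ _ _ delta0 bad_ito bad_ito_meas _)).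
- by move=> k kn; apply: (filt_sigma hF); exact: grid_in.
- by move=> k kn; apply: (filt_meas hF); exact: grid_in.
- move=> j k jk kn; case: hF => _ _; apply.
  + by apply: grid_ge0; exact: leq_trans kn.
  + exact: grid_le.
  + exact: grid_leT.
- exact: ito_err_wrt.
- exact: ito_err_L2.
- exact: ito_err_mart.
- by move=> w [k kn h]; exists k.
- rewrite lee_fin mulrC ler_wpM2r// ?invr_ge0 ?exprn_ge0 ?(ltW delta0)//.
  rewrite -lee_fin /Rintegral fineK; first exact: ito_err_E2.
  by apply: integrable_fin_num => //; exact/L2_sqr/ito_err_L2.
Qed.

Definition bad_drift := [set w | delta < eps^-1 * \sum_(i < n) `|drift_err (t i) (t i.+1) w|].

Let dr (i : 'I_n) := drift_err (t i) (t i.+1).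

Let dr_meas i : measurable_fun setT (dr i).
Proof.
apply: drift_err_meas; [by apply: grid_ge0; exact: ltnW|exact/ltW/tlt|exact: grid_leT].
Qed.

Let dr_E2 i : (E2 (dr i) <= ((t i.+1 - t i) ^+ 2 * (C ^+ 2 * incr_cst * eps ^+ 4))%:E)%E.
Proof.
apply: drift_err_E2; [by apply: grid_ge0; exact: ltnW|exact/ltW/tlt|exact: grid_leT|exact: tmesh].
Qed.

Let dr_L2 i : L2 P (dr i).
Proof. by split => //; apply: (le_lt_trans (dr_E2 i)); rewrite ltry. Qed.

Lemma bad_drift_meas : measurable bad_drift.
Proof.
apply: measurable_gt; apply: measurable_funM => //; apply: measurable_sum => i.
by apply: measurableT_comp => //; exact: dr_meas.
Qed.

Definition drift_err_cst := T * (C ^+ 2 * incr_cst + 1) / 2.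

(** Markov's inequality for the first moments, which are bounded by the second
ones through [|a| <= a^2 / (2 k) + k / 2], with [k = (t_{i+1} - t_i) eps^2] the
order of the drift error. *)
Lemma bad_drift_prob : (P bad_drift <= (drift_err_cst * eps / delta)%:E)%E.
Proof.
pose D i := t i.+1 - t i.
have D0 (i : 'I_n) : 0 < D i by rewrite subr_gt0 tlt.
have e20 : 0 < eps ^+ 2 by rewrite exprn_gt0.
pose h (i : 'I_n) w := (2 * D i * eps ^+ 2)^-1 * dr i w ^+ 2 + D i * eps ^+ 2 / 2.
have ih i : integ P (h i).
  by apply: integ_D; [apply: integ_Z; exact: (L2_sqr (dr_L2 i))|exact: integ_cst].
have hd i w : `|dr i w| <= h i w.
  rewrite /h; set a := dr i w; set k := D i * eps ^+ 2.
  have k0 : 0 < k by rewrite mulr_gt0.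
  rewrite -(mulrA 2 (D i)) -/k.
  have -> : (2 * k)^-1 * a ^+ 2 + k / 2 = ((k ^+ 2 + `|a| ^+ 2)) / (2 * k).
    by rewrite real_normK ?num_real//; field; rewrite gt_eqF.
  rewrite ler_pdivlMr ?mulr_gt0//; have := sqr_ge0 (`|a| - k); nra.
have Eh i : \int[P]_w h i w <= D i * eps ^+ 2 * (C ^+ 2 * incr_cst + 1) / 2.
  rewrite RintegralD//; [|by apply: integ_Z; exact: (L2_sqr (dr_L2 i))|exact: integ_cst].
  rewrite [X in _ + X]Rintegral_cst// [X in X + _]RintegralZl//; last exact: (L2_sqr (dr_L2 i)).
  have -> : fine (P [set: Omega]) = 1 by rewrite (@probability_setT _ _ _ P).
  rewrite mulr1.
  have h2 : \int[P]_w dr i w ^+ 2 <= D i ^+ 2 * (C ^+ 2 * incr_cst * eps ^+ 4).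
    rewrite -lee_fin /Rintegral fineK; first exact: dr_E2.
    by apply: integrable_fin_num => //; exact: (L2_sqr (dr_L2 i)).
  apply: (@le_trans _ _ ((2 * D i * eps ^+ 2)^-1 * (D i ^+ 2 * (C ^+ 2 * incr_cst * eps ^+ 4)) + D i * eps ^+ 2 / 2)).
    by rewrite lerD2r ler_wpM2l// invr_ge0 !mulr_ge0// ltW.
  rewrite le_eqVlt; apply/orP; left; apply/eqP; field.
  by rewrite !gt_eqF.
pose H w := (delta * eps)^-1 * \sum_(i < n) h i w.
have iH : integ P H by apply: integ_Z; exact: integ_sum.
apply: (@le_trans _ _ (\int[P]_w (H w)%:E)%E).
  rewrite -[bad_drift]setIT -integral_indic//; last exact: bad_drift_meas.
  apply: ge0_le_integral => //.
  - by apply/measurable_EFinP; apply: measurable_indic; exact: bad_drift_meas.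
  - by apply/measurable_EFinP; exact: integ_meas iH.
  - move=> w _; rewrite lee_fin.
    have hs : \sum_(i < n) `|dr i w| <= \sum_(i < n) h i w by apply: ler_sum => i _.
    have hs0 : 0 <= \sum_(i < n) `|dr i w| by apply: sumr_ge0.
    rewrite /H indicE; case: (boolP (w \in bad_drift)) => hw; last first.
      by rewrite mulr_ge0 ?invr_ge0 ?mulr_ge0 ?(ltW delta0) ?(ltW e0)// (le_trans hs0).
    rewrite inE /bad_drift /= in hw.
    rewrite mulrC ler_pdivlMr ?mulr_gt0// mul1r.
    apply: le_trans hs; apply: ltW.
    by rewrite -ltr_pdivlMr// mulrC.
rewrite -[X in (X <= _)%E]fineK; last exact: integrable_fin_num.
rewrite lee_fin -[X in X <= _]/(\int[P]_w H w) RintegralZl//; last exact: integ_sum.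
rewrite Rint_sum//.
apply: (@le_trans _ _ ((delta * eps)^-1 * \sum_(i < n) D i * eps ^+ 2 * (C ^+ 2 * incr_cst + 1) / 2)).
  rewrite ler_wpM2l ?invr_ge0 ?mulr_ge0 ?(ltW delta0) ?(ltW e0)//.
  by apply: ler_sum => i _; exact: Eh.
have -> : \sum_(i < n) D i * eps ^+ 2 * (C ^+ 2 * incr_cst + 1) / 2 =
   T * (eps ^+ 2 * (C ^+ 2 * incr_cst + 1) / 2).
  have -> : T = \sum_(i < n) D i.
    by have := telescope_sumr t (leq0n n); rewrite big_mkord tn t0 subr0 => <-.
  rewrite mulr_suml.
  by apply: eq_bigr => i _; rewrite /D; ring.
rewrite le_eqVlt; apply/orP; left; apply/eqP; rewrite /drift_err_cst; field.
by rewrite !gt_eqF.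
Qed.

Lemma score_gauss_close w k : (k <= n)%N -> ~ bad_ito w -> ~ bad_drift w ->
  `|eps^-1 * score_sum k w - gauss_mart k w| <= 2 * delta.
Proof.
move=> kn hN hD; rewrite score_sum_decomp addrK (le_trans (ler_normD _ _))//.
rewrite mulr_natl mulr2n; apply: lerD.
  rewrite leNgt; apply/negP => h; apply: hD; rewrite /bad_drift /=.
  apply: (lt_le_trans h); rewrite normrM gtr0_norm ?invr_gt0//.
  rewrite ler_pM2l ?invr_gt0//; apply: (le_trans (ler_norm_sum _ _ _)).
  rewrite (big_ord_widen _ (fun i => `|drift_err (t i) (t i.+1) w|) kn).
  by rewrite big_mkcond /=; apply: ler_sum => i _; case: ifP.
by rewrite leNgt; apply/negP => h; apply: hN; exists k.
Qed.

End grid.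
End eps.
End estimates.

(** * Running maxima of independent increments *)

Definition psum {R : realType} {Omega : Type} (y : nat -> Omega -> R) k w :=
  \sum_(i < k) y i w.
(** With this recursion, each increment updates the pair formed by the partial
sum and the running maximum. *)
Fixpoint maxabs {R : realType} (a : nat -> R) k : R :=
  if k is k'.+1 then Num.max (maxabs a k') `|a k| else `|a 0%N|.

Lemma maxabsS {R : realType} (a : nat -> R) k :
  maxabs a k.+1 = Num.max (maxabs a k) `|a k.+1|.
Proof. by []. Qed.

Lemma maxabs0 {R : realType} (a : nat -> R) : maxabs a 0 = `|a 0%N|.
Proof. by []. Qed.

Lemma maxabs_ge {R : realType} (a : nat -> R) n k : (k <= n)%N -> `|a k| <= maxabs a n.
Proof.
elim: n => [|n IH]; first by rewrite leqn0 => /eqP ->.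
rewrite leq_eqVlt => /orP[/eqP ->|kn]; first by rewrite maxabsS le_max lexx orbT.
by rewrite maxabsS le_max IH.
Qed.

Lemma maxabs_ex {R : realType} (a : nat -> R) n : exists2 k, (k <= n)%N & maxabs a n = `|a k|.
Proof.
elim: n => [|n [k kn IH]]; first by exists 0%N.
rewrite maxabsS; case: leP => h; first by exists n.+1.
by exists k => //; exact: leqW.
Qed.

Lemma maxabs_ge0 {R : realType} (a : nat -> R) n : 0 <= maxabs a n.
Proof. by have [k _ ->] := maxabs_ex a n. Qed.

Lemma maxabs_dist {R : realType} (a b : nat -> R) n e :
  (forall k, (k <= n)%N -> `|a k - b k| <= e) -> `|maxabs a n - maxabs b n| <= e.
Proof.
move=> h; have [i ni ai] := maxabs_ex a n; have [j nj bj] := maxabs_ex b n.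
have h1 := h i ni; have h2 := h j nj.
have h3 := maxabs_ge a nj; have h4 := maxabs_ge b ni.
rewrite ler_norml; apply/andP; split.
  have := ler_distD 0 (a j) (b j); rewrite ai bj in h3 h4 *.
  have := lerB_dist (b j) (a j); rewrite distrC in h2; lra.
have := lerB_dist (a i) (b i); rewrite ai bj in h3 h4 *; lra.
Qed.

Lemma maxabsZ {R : realType} (a : nat -> R) n (c : R) : 0 <= c ->
  maxabs (fun k => c * a k) n = c * maxabs a n.
Proof.
move=> c0; elim: n => [|n IH]; first by rewrite !maxabs0 normrM (ger0_norm c0).
by rewrite !maxabsS IH normrM (ger0_norm c0) maxr_pMr.
Qed.

Lemma eq_maxabs {R : realType} (a b : nat -> R) n :
  (forall k, (k <= n)%N -> a k = b k) -> maxabs a n = maxabs b n.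
Proof.
elim: n => [|n IH] h; first by rewrite !maxabs0 h.
by rewrite !maxabsS h// IH// => k kn; apply: h; exact: leqW.
Qed.

Lemma maxabs_measurable {R : realType} {d} {Omega : measurableType d}
  (a : nat -> Omega -> R) n : (forall k, (k <= n)%N -> measurable_fun setT (a k)) ->
  measurable_fun setT (fun w => maxabs (a ^~ w) n).
Proof.
elim: n => [|n IH] h; first by apply: measurableT_comp => //; exact: h.
apply: measurable_maxr; first by apply: IH => k kn; apply: h; exact: leqW.
by apply: measurableT_comp => //; exact: h.
Qed.

Section chain.
Context {d : measure_display} {Omega : measurableType d} {R : realType}.
Variables (n : nat) (G : nat -> set (set Omega)) (y : nat -> Omega -> R).
Hypotheses
  (sG : forall k, (k <= n)%N -> sigma_algebra setT (G k))
  (Gle : forall k, (k < n)%N -> G k `<=` G k.+1)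
  (yG : forall i, (i < n)%N -> measurable_wrt (G i.+1) (y i)).

Lemma chain_upgrade k (f : Omega -> R) : (k < n)%N ->
  @measurable_fun _ _ (g_sigma_algebraType (G k)) _ setT f ->
  @measurable_fun _ _ (g_sigma_algebraType (G k.+1)) _ setT f.
Proof.
move=> kn /(measurable_wrtP _ (sG (ltnW kn))) h.
by apply/(measurable_wrtP _ (sG kn)) => B mB; apply: (Gle kn); exact: h.
Qed.

Lemma chain_wrt k : (k <= n)%N ->
  @measurable_fun _ _ (g_sigma_algebraType (G k)) _ setT (psum y k) /\
  @measurable_fun _ _ (g_sigma_algebraType (G k)) _ setT (fun w => maxabs (psum y ^~ w) k).
Proof.
elim: k => [|k IH] kn.
  have -> : psum y 0 = fun=> 0 by apply/funext => w; rewrite /psum big_ord0.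
  split; first exact: measurable_cst.
  have -> : (fun w => maxabs (psum y ^~ w) 0) = fun=> 0.
    by apply/funext => w; rewrite maxabs0 /psum big_ord0 normr0.
  exact: measurable_cst.
have [h1 h2] := IH (ltnW kn).
have m1 : @measurable_fun _ _ (g_sigma_algebraType (G k.+1)) _ setT (psum y k.+1).
  have -> : psum y k.+1 = (fun w => psum y k w + y k w).
    by apply/funext => w; rewrite /psum big_ord_recr.
  apply: measurable_funD; first exact: chain_upgrade.
  by apply/(measurable_wrtP _ (sG kn)); exact: yG.
split => //.
have -> : (fun w => maxabs (psum y ^~ w) k.+1) =
  (fun w => Num.max (maxabs (psum y ^~ w) k) `|psum y k.+1 w|).
  by apply/funext => w; rewrite maxabsS.
apply: measurable_maxr; first exact: chain_upgrade.
exact: (measurableT_comp (@normr_measurable R setT) m1).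
Qed.

End chain.

Section chain_law.
Context {d d' : measure_display} {Omega : measurableType d}
  {Omega' : measurableType d'} {R : realType}.
Variables (P : probability Omega R) (Q : probability Omega' R).
Variables (n : nat) (G : nat -> set (set Omega)) (y : nat -> Omega -> R)
  (G' : nat -> set (set Omega')) (y' : nat -> Omega' -> R).
Hypotheses
  (sG : forall k, (k <= n)%N -> sigma_algebra setT (G k))
  (Gm : forall k, (k <= n)%N -> G k `<=` measurable)
  (Gle : forall k, (k < n)%N -> G k `<=` G k.+1)
  (yG : forall i, (i < n)%N -> measurable_wrt (G i.+1) (y i))
  (yind : forall i, (i < n)%N -> independent_of P (G i) (y i)).
Hypotheses
  (sG' : forall k, (k <= n)%N -> sigma_algebra setT (G' k))
  (Gm' : forall k, (k <= n)%N -> G' k `<=` measurable)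
  (Gle' : forall k, (k < n)%N -> G' k `<=` G' k.+1)
  (yG' : forall i, (i < n)%N -> measurable_wrt (G' i.+1) (y' i))
  (yind' : forall i, (i < n)%N -> independent_of Q (G' i) (y' i)).
Hypothesis law : forall i, (i < n)%N -> forall B : set R, measurable B ->
  P (y i @^-1` B) = Q (y' i @^-1` B).

(** By induction on [k]: the next increment is independent of the current pair,
so that after freezing the expectation depends only on the law of the increment
and on the law of the pair. *)
Lemma chain_law_pair k (g : R * R -> \bar R) : (k <= n)%N ->
  measurable_fun [set: R * R] g -> (forall p, (0 <= g p)%E) ->
  (\int[P]_w g (psum y k w, maxabs (psum y ^~ w) k) =
   \int[Q]_w g (psum y' k w, maxabs (psum y' ^~ w) k))%E.
Proof.
elim: k g => [|k IH] g kn mg g0.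
  have E1 w : (psum y 0 w, maxabs (psum y ^~ w) 0) = (0, 0).
    by rewrite maxabs0 /psum big_ord0 normr0.
  have E2 w : (psum y' 0 w, maxabs (psum y' ^~ w) 0) = (0, 0).
    by rewrite maxabs0 /psum big_ord0 normr0.
  under eq_integral do rewrite E1; under [RHS]eq_integral do rewrite E2.
  by rewrite !integral_cst//= !probability_setT.
have kn' := ltnW kn.
pose gt (p : (R * R) * R) := g (p.1.1 + p.2, Num.max p.1.2 `|p.1.1 + p.2|).
have mgt : measurable_fun [set: (R * R) * R] gt.
  apply: measurableT_comp mg _; apply/measurable_fun_pairP; split => /=.
    by apply: measurable_funD => //; exact: measurableT_comp.
  apply: measurable_maxr; first exact: measurableT_comp.
  apply: measurableT_comp => //.
  by apply: measurable_funD => //; exact: measurableT_comp.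
have gt0 p : (0 <= gt p)%E by exact: g0.
have E w : g (psum y k.+1 w, maxabs (psum y ^~ w) k.+1) =
   gt ((psum y k w, maxabs (psum y ^~ w) k), y k w).
  by rewrite /gt /= /psum big_ord_recr.
have E' w : g (psum y' k.+1 w, maxabs (psum y' ^~ w) k.+1) =
   gt ((psum y' k w, maxabs (psum y' ^~ w) k), y' k w).
  by rewrite /gt /= /psum big_ord_recr.
under eq_integral do rewrite E; under [RHS]eq_integral do rewrite E'.
have pm : @measurable_fun _ _ (g_sigma_algebraType (G k)) _ setT
   (fun w => (psum y k w, maxabs (psum y ^~ w) k)).
  by apply/measurable_fun_pairP; exact: (chain_wrt sG Gle yG kn').
have pm' : @measurable_fun _ _ (g_sigma_algebraType (G' k)) _ setT
   (fun w => (psum y' k w, maxabs (psum y' ^~ w) k)).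
  by apply/measurable_fun_pairP; exact: (chain_wrt sG' Gle' yG' kn').
have my := wrt_meas (sG kn) (Gm kn) (yG kn).
have my' := wrt_meas (sG' kn) (Gm' kn) (yG' kn).
rewrite (freezing (sG kn') (Gm kn') pm my (yind kn) mgt gt0).2.
rewrite (freezing (sG' kn') (Gm' kn') pm' my' (yind' kn) mgt gt0).2.
pose phi z := (\int[Q]_w gt ((psum y' k w, maxabs (psum y' ^~ w) k), z))%E.
transitivity (\int[P]_v phi (y k v))%E.
  apply: eq_integral => v _; apply: (IH (fun p => gt (p, y k v))) => //.
  by apply: measurableT_comp => //; exact: measurable_pair2.
rewrite (@same_law_integral _ _ _ _ _ P Q (y k) (y' k) phi)//.
- exact: law.
- have mp' := sub_sigma_measurable (sG' kn') (Gm' kn') pm'.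
  have mg2 : measurable_fun [set: Omega' * R] (fun p => gt ((psum y' k p.1, maxabs (psum y' ^~ p.1) k), p.2)).
    apply: measurableT_comp mgt _; apply/measurable_fun_pairP; split.
      exact: (measurableT_comp mp' measurable_fst).
    exact: measurable_snd.
  exact: (measurable_fun_fubini_tonelli_G (m1 := Q) _ mg2).
- by move=> z; apply: integral_ge0.
Qed.

Lemma chain_law (f : R -> \bar R) : measurable_fun setT f -> (forall x, (0 <= f x)%E) ->
  (\int[P]_w f (maxabs (psum y ^~ w) n) = \int[Q]_w f (maxabs (psum y' ^~ w) n))%E.
Proof.
move=> mf f0; apply: (chain_law_pair (g := fun p => f p.2)) => //.
exact: measurableT_comp.
Qed.

End chain_law.

(** * Comparison with Brownian motion *)

Section const.
Context {d : measure_display} {Omega : measurableType d} {R : realType}.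
Variable P : probability Omega R.

Lemma indep_cst (G : set (set Omega)) (f : Omega -> R) (c : R) : (forall w, f w = c) ->
  independent_of P G f.
Proof.
move=> h A B _ _; have -> : f = cst c by apply/funext.
rewrite preimage_cst; case: ifPn => _.
  by rewrite setIT probability_setT mule1.
by rewrite setI0 measure0 mule0.
Qed.

Lemma cst_law (f : Omega -> R) (c : R) (B : set R) : (forall w, f w = c) ->
  P (f @^-1` B) = (if c \in B then 1 else 0)%E.
Proof.
move=> h; have -> : f = cst c by apply/funext.
by rewrite preimage_cst; case: ifPn => _; rewrite ?probability_setT ?measure0.
Qed.

End const.

Section natural.
Context {d : measure_display} {Omega : measurableType d} {R : realType}.
Variables (Q : probability Omega R) (T : R) (B : R -> Omega -> R).

Lemma natural_filtrationP : (forall t, t \in `[0, T] -> measurable_fun setT (B t)) ->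
  filtration (natural_filtration B) T.
Proof.
move=> mB; split.
- by move=> t _; exact: smallest_sigma_algebra.
- move=> t tT; apply: smallest_sub; first exact: sigma_algebra_measurable.
  move=> _ [s [D [st mD ->]]].
  have sT : s \in `[0, T].
    by move: st tT; rewrite !in_itv/= => /andP[-> s1] /andP[_ /(le_trans s1)].
  by have := mB s sT measurableT D mD; rewrite setTI.
- move=> s t s0 st tT; apply: smallest_sub; first exact: smallest_sigma_algebra.
  move=> _ [u [D [us mD ->]]]; apply: sub_sigma_algebra; exists u, D; split => //.
  by move: us; rewrite !in_itv/= => /andP[-> /le_trans]; apply.
Qed.
End natural.

Section law.
Context {d d' : measure_display} {Omega : measurableType d}
  {Omega' : measurableType d'} {R : realType}.
Variables (P : probability Omega R) (F : R -> set (set Omega)) (T : R)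
  (W : R -> Omega -> R).
Hypotheses (hF : filtration F T) (hW : wiener_process P F T W).
Variables (Q : probability Omega' R) (B : R -> Omega' -> R).
Hypothesis hB : brownian_motion Q 1 B.
Variables (n : nat) (t a : nat -> R) (c : nat -> R).
Hypotheses (t0 : forall k, (k <= n)%N -> 0 <= t k <= T)
  (a0 : forall k, (k <= n)%N -> 0 <= a k <= 1)
  (tlt : forall i, (i < n)%N -> t i < t i.+1)
  (ac : forall i, (i < n)%N -> a i.+1 - a i = c i ^+ 2 * (t i.+1 - t i)).

Let FB := natural_filtration B.
Let hFB : filtration FB 1.
Proof. by apply: natural_filtrationP; case: hB. Qed.
Let hWB : wiener_process Q FB 1 B. Proof. by case: hB. Qed.

Let y i w := c i * (W (t i.+1) w - W (t i) w).
Let y' i w := B (a i.+1) w - B (a i) w.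

Let ale i : (i < n)%N -> a i <= a i.+1.
Proof.
by move=> ni; rewrite -subr_ge0 ac// mulr_ge0 ?sqr_ge0// subr_ge0 ltW// tlt.
Qed.

Let law i (D : set R) : (i < n)%N -> measurable D -> P (y i @^-1` D) = Q (y' i @^-1` D).
Proof.
move=> ni mD; have /andP[ti0 _] := t0 (ltnW ni); have /andP[_ ti1] := t0 ni.
have /andP[ai0 _] := a0 (ltnW ni); have /andP[_ ai1] := a0 ni.
have tl := tlt ni.
have [c0|c0] := eqVneq (c i) 0.
  have ae : a i.+1 = a i by apply/eqP; rewrite -subr_eq0 ac// c0 expr0n mul0r.
  rewrite (cst_law P D (c := 0)); last by move=> w; rewrite /y c0 mul0r.
  by rewrite (cst_law Q D (c := 0))// => w; rewrite /y' ae subrr.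
have al : a i < a i.+1.
  by rewrite -subr_gt0 ac// mulr_gt0 ?subr_gt0// exprn_even_gt0.
have sq0 : 0 < Num.sqrt (t i.+1 - t i) by rewrite sqrtr_gt0 subr_gt0.
have h1 := normal_law_scale (inc_meas hF hW ti0 (ltW tl) ti1) sq0 c0 (inc_law hW ti0 ti1 tl).
have h2 := inc_law hWB ai0 ai1 al.
rewrite (h1 D mD) (h2 D mD) ac// sqrtrM ?sqr_ge0// sqrtr_sqr.
by [].
Qed.

(** The factor [c i] gives the increment of [W] the variance of the increment of
[B] over the corresponding interval; when it is 0 both variables vanish. *)
Lemma brownian_inc_max_law (f : R -> \bar R) : measurable_fun setT f -> (forall x, (0 <= f x)%E) ->
  (\int[P]_w f (maxabs (psum y ^~ w) n) = \int[Q]_w f (maxabs (fun k => (B (a k) w - B (a 0%N) w)%R) n))%E.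
Proof.
move=> mf f0.
rewrite (@chain_law _ _ _ _ _ P Q n (fun k => F (t k)) y (fun k => FB (a k)) y')//.
- apply: eq_integral => w _; congr f; apply: eq_maxabs => k kn.
  by rewrite /psum /y' -(telescope_sumr (fun i => B (a i) w) (leq0n k)) big_mkord.
- by move=> k kn; apply: (filt_sigma hF); exact: t0.
- by move=> k kn; apply: (filt_meas hF); exact: t0.
- move=> k kn; have /andP[? _] := t0 (ltnW kn); have /andP[_ ?] := t0 kn.
  by case: hF => _ _; apply => //; exact/ltW/tlt.
- move=> i ni; have /andP[h1 _] := t0 (ltnW ni); have /andP[_ h2] := t0 ni.
  apply: (wrt_M hF); [exact: t0|apply: (wrt_cst hF); exact: t0|].
  by apply: (inc_wrt hF hW h1 _ h2); exact/ltW/tlt.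
- move=> i ni; have /andP[h1 _] := t0 (ltnW ni); have /andP[_ h2] := t0 ni.
  apply: (indep_comp (f := *%R (c i))); first exact: mulrl_measurable.
  by apply: (inc_indep hW h1 h2); exact: tlt.
- by move=> k kn; apply: (filt_sigma hFB); exact: a0.
- by move=> k kn; apply: (filt_meas hFB); exact: a0.
- move=> k kn; have /andP[? _] := a0 (ltnW kn); have /andP[_ ?] := a0 kn.
  by case: hFB => _ _; apply => //; exact: ale.
- move=> i ni; have /andP[h1 _] := a0 (ltnW ni); have /andP[_ h2] := a0 ni.
  by apply: (inc_wrt hFB hWB h1 _ h2); exact: ale.
- move=> i ni; have /andP[h1 _] := a0 (ltnW ni); have /andP[_ h2] := a0 ni.
  have := ale ni; rewrite le_eqVlt => /orP[/eqP e|al]; last exact: (inc_indep hWB h1 h2).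
  by apply: (@indep_cst _ _ _ _ _ _ 0) => w; rewrite /y' e subrr.
- by move=> i ni D mD; exact: law.
Qed.

(** [B] starts at 0 only almost surely, hence a second comparison of integrals. *)
Lemma brownian_max_law (f : R -> \bar R) : a 0%N = 0 -> measurable_fun setT f -> (forall x, (0 <= f x)%E) ->
  (\int[P]_w f (maxabs (psum y ^~ w) n) = \int[Q]_w f (maxabs (fun k => B (a k) w) n))%E.
Proof.
move=> a00 mf f0; rewrite brownian_inc_max_law//.
have mBa k : (k <= n)%N -> measurable_fun setT (B (a k)).
  by move=> kn; case: hB => h _; apply: h; rewrite in_itv/=; exact: a0.
apply: ae_eq_integral => //.
- apply: measurableT_comp mf _; apply: (maxabs_measurable (a := fun k w => B (a k) w - B (a 0%N) w)) => k kn.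
  by apply: measurable_funB; exact: mBa.
- by apply: measurableT_comp mf _; exact: (maxabs_measurable (a := fun k => B (a k))).
- case: hB => _ [_ _ h _ _]; apply: filterS h => w h _; congr f.
  by apply: eq_maxabs => k kn; rewrite a00 h subr0.
Qed.

End law.

(** * Supremum of the score *)

Section sup.
Context {R : realType}.

Lemma sup_max (A : set R) m : A m -> ubound A m -> sup A = m.
Proof.
move=> Am uA; apply/eqP; rewrite eq_le; apply/andP; split.
  by apply: ge_sup => //; exists m.
by apply: ub_le_sup => //; exists m.
Qed.

Variables (n : nat) (t : nat -> R) (D : nat -> R).
Hypotheses (t0 : t 0%N = 0) (tlt : forall i, (i < n)%N -> t i < t i.+1).

Lemma stopped_sum u k : (k <= n)%N -> t k <= u ->
  (forall i, (k < i)%N -> (i <= n)%N -> u < t i) ->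
  \sum_(i < n) \1_(`[0, u]%classic) (t i.+1) * D i = \sum_(i < k) D i.
Proof.
move=> kn ku uk; rewrite (big_ord_widen _ D kn) [RHS]big_mkcond /=.
apply: eq_bigr => i _; rewrite indicE; case: ltnP => ik.
  rewrite mem_set ?mul1r//= in_itv/= (le_trans (grid_le tlt ik kn) ku) andbT.
  by rewrite -t0; exact: (grid_le tlt).
rewrite memNset ?mul0r//= in_itv/= => /andP[_]; rewrite leNgt.
by rewrite uk.
Qed.

Lemma stopped_sum_ex u : 0 <= u -> exists2 k, (k <= n)%N &
  \sum_(i < n) \1_(`[0, u]%classic) (t i.+1) * D i = \sum_(i < k) D i.
Proof.
move=> u0.
have ex : exists k, (k <= n)%N && (t k <= u) by exists 0%N; rewrite t0 u0.
have ub k : (k <= n)%N && (t k <= u) -> (k <= n)%N by case/andP.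
case: (ex_maxnP ex ub) => k /andP[kn ku] kmax; exists k => //.
apply: stopped_sum => // i ki ni; rewrite ltNge; apply/negP => iu.
by have := kmax i; rewrite ni iu => /(_ isT); rewrite leqNgt ki.
Qed.

Lemma stopped_sum_grid k : (k <= n)%N ->
  \sum_(i < n) \1_(`[0, t k]%classic) (t i.+1) * D i = \sum_(i < k) D i.
Proof.
move=> kn; apply: stopped_sum => // i ki ni.
by apply: (lt_le_trans (tlt _) (grid_le tlt ki ni)); exact: leq_trans ni.
Qed.

End sup.

(** The score is a step function of [u] whose values are all attained at the
observation times. *)
Lemma sup_score {d} {Omega : measurableType d} {R : realType} (T : R) (S : R -> R)
  (n : R -> nat) (t : R -> nat -> R) (X : R -> R -> Omega -> R) (eps : R) w : t eps 0%N = 0 -> t eps (n eps) = T ->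
  (forall i, (i < n eps)%N -> t eps i < t eps i.+1) ->
  sup [set `|score_process S n t X eps u w| | u in `[0, T]] =
  maxabs (fun k => eps^-1 * score_sum S (X eps) (t eps) k w) (n eps).
Proof.
move=> t0 tn tlt.
pose D i := X eps (t eps i.+1) w - X eps (t eps i) w - S (X eps (t eps i) w) * (t eps i.+1 - t eps i).
have sE u : score_process S n t X eps u w =
    eps^-1 * \sum_(i < n eps) \1_(`[0, u]%classic) (t eps i.+1) * D i.
  rewrite /score_process; congr (_ * _); apply: eq_bigr => i _.
  by rewrite (@gtr0_norm _ (t eps i.+1 - t eps i))// subr_gt0 tlt.
apply: sup_max.
  have [k kn ->] := maxabs_ex (fun k => eps^-1 * score_sum S (X eps) (t eps) k w) (n eps).
  exists (t eps k); last by rewrite sE (stopped_sum_grid _ t0 tlt).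
  by rewrite /= in_itv /=; exact: (grid_in t0 tn tlt).
move=> z [u /=]; rewrite in_itv/= => /andP[u0 _] <- {z}.
have [k kn h] := stopped_sum_ex D t0 tlt u0.
rewrite sE h.
exact: (maxabs_ge (fun k => eps^-1 * score_sum S (X eps) (t eps) k w) kn).
Qed.

(** * Elementary real analysis *)

Section real.
Context {R : realType}.

(** Uniform continuity near a compact interval, to which [u] alone is confined. *)
Lemma heine (f : R -> R) (K g : R) : continuous f -> 0 < g ->
  exists2 del : R, 0 < del & forall u v : R, `|u| <= K -> `|u - v| < del -> `|f u - f v| <= g.
Proof.
move=> cf g0.
have /compact_near_coveringP cov : compact `[- K, K]%classic by exact: segment_compact.
have H : \forall del \near (0 : R)^'+, `[- K, K]%classic `<=`
    (fun u => forall v, `|u - v| < del -> `|f u - f v| <= g).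
  apply: (cov R _ (fun del u => forall v, `|u - v| < del -> `|f u - f v| <= g)) => u _.
  have g2 : 0 < g / 2 by rewrite divr_gt0.
  have /cvgrPdist_lt /(_ _ g2) [r /= r0 h] := cf u.
  have r2 : 0 < r / 2 by rewrite divr_gt0.
  exists (ball u (r / 2), [set del | del < r / 2]) => /=.
    split; first exact: nbhsx_ballx.
    exact: nbhs_right_lt.
  move=> [u' del] /= [uu' dr] v uv.
  have h1 := h u'; have h2 := h v; rewrite /ball_ /= in h1 h2.
  have {}uu' : `|u - u'| < r / 2 by exact: uu'.
  have {}dr : del < r / 2 by exact: dr.
  have {}h1 : `|f u - f u'| < g / 2 by apply: h1; lra.
  have {}h2 : `|f u - f v| < g / 2.
    by apply: h2; have := ler_distD u' u v; lra.
  by have := ler_distD (f u) (f u') (f v); rewrite (distrC (f u') (f u)); lra.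
have [del [del0 hdel]] : exists del : R, 0 < del /\ forall u, `[- K, K]%classic u ->
    forall v, `|u - v| < del -> `|f u - f v| <= g.
  near (0 : R)^'+ => del; exists del; split; first by near: del; exact: nbhs_right_gt.
  by near: del; exact: H.
by exists del => // u v uK; apply: hdel; rewrite /= in_itv/= -ler_norml.
Unshelve. all: end_near. Qed.

(** [x / (x^2 + 1 / (k + 1))] is continuous and tends to [x^-1], also at 0, where
the inverse is 0 by convention. *)
Lemma inv_measurable : measurable_fun [set: R] (fun x : R => x^-1).
Proof.
apply: (@measurable_fun_cvg _ (measurableTypeR R) R setT (fun (k : nat) (x : R) => x / (x ^+ 2 + k.+1%:R^-1))).
  move=> k; apply: continuous_measurable_fun => x.
  have p0 : x ^+ 2 + k.+1%:R^-1 != 0 :> R.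
    by rewrite gt_eqF// ltr_wpDl ?sqr_ge0// invr_gt0.
  apply: cvgM => //; apply: cvgV => //; apply: cvgD; last exact: cvg_cst.
  by rewrite expr2; apply: cvgM.
move=> x _.
have [->|x0] := eqVneq x 0.
  by under eq_fun do rewrite mul0r; rewrite invr0; exact: cvg_cst.
have x20 : x ^+ 2 != 0 by rewrite expf_neq0.
have -> : x^-1 = x * (x ^+ 2 + 0)^-1 by rewrite addr0 expr2 invfM mulrA mulfV ?mul1r.
apply: cvgM; first exact: cvg_cst.
apply: cvgV; first by rewrite addr0.
by apply: cvgD; [exact: cvg_cst|exact: cvg_harmonic].
Qed.

(** [m / v - z / h = ((m - z) + (m / v) (h - v)) / h], where [h >= Sig / 2]. *)
Lemma ratio_close (Sig delta z m h v K : R) : 0 < Sig -> 0 <= delta -> delta <= Sig / 2 ->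
  `|z - m| <= 2 * delta -> `|h - Sig| <= delta -> `|v - Sig| <= delta ->
  0 <= m -> m / v <= K -> `|m / v - z / h| <= (4 + 4 * K) * delta / Sig.
Proof.
move=> S0 d0 dS zm; rewrite !ler_norml => /andP[h1 h2] /andP[v1 v2] m0 mK.
have h0 : 0 < h by lra.
have v0 : 0 < v by lra.
have mv0 : 0 <= m / v by rewrite divr_ge0// ltW.
set L := m / v in mK mv0 *.
have -> : L - z / h = ((m - z) + L * (h - v)) / h.
  by rewrite /L; field; rewrite !gt_eqF.
have mz : `|m - z| <= 2 * delta by rewrite distrC.
have hv : `|h - v| <= 2 * delta by rewrite ler_norml; apply/andP; split; lra.
rewrite -ler_norml normrM normfV (gtr0_norm h0) ler_pdivrMr//.
apply: (le_trans (ler_normD _ _)); rewrite normrM (ger0_norm mv0).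
have : L * `|h - v| <= K * (2 * delta) by apply: ler_pM.
have K0 : 0 <= K by exact: le_trans mK.
have : (4 + 4 * K) * delta * (Sig^-1 * (Sig / 2)) <= (4 + 4 * K) * delta / Sig * h.
  rewrite mulrA ler_wpM2l; last by lra.
    by [].
  by rewrite divr_ge0 ?(ltW S0)// mulr_ge0// addr_ge0// mulr_ge0.
have -> : Sig^-1 * (Sig / 2) = 1 / 2 by field; rewrite gt_eqF.
by nra.
Qed.
End real.

(** * Comparison of expectations *)

Section expectation.
Context {d : measure_display} {Omega : measurableType d} {R : realType}.
Variable P : probability Omega R.

Lemma bounded_integ (f : Omega -> R) (M : R) : measurable_fun setT f ->
  (forall w, `|f w| <= M) -> integ P f.
Proof.
move=> mf hM; apply: (@integ_le _ _ _ P f (fun=> M)) => //.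
  exact: integ_cst.
Qed.

Lemma expectE (f : Omega -> R) : integ P f -> 'E_P[f]%E = (\int[P]_w f w)%:E.
Proof. by move=> jf; rewrite unlock /Rintegral fineK//; exact: integrable_fin_num. Qed.

Lemma expect_close (Y L : Omega -> R) (G : set Omega) (M g p : R) :
  measurable_fun setT Y -> measurable_fun setT L -> measurable G ->
  (forall w, `|Y w| <= M) -> (forall w, `|L w| <= M) -> 0 <= g ->
  (P G <= p%:E)%E -> (forall w, ~ G w -> `|L w - Y w| <= g) ->
  `|\int[P]_w L w - \int[P]_w Y w| <= g + 2 * M * p.
Proof.
move=> mY mL mG bY bL g0 PG h.
have iY := bounded_integ mY bY; have iL := bounded_integ mL bL.
have iG : integ P (fun w => \1_G w).
  apply: (@bounded_integ _ 1) => [|w]; first exact: measurable_indic.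
  by rewrite indicE; case: (_ \in _); rewrite ?normr1 ?normr0.
have M0 : 0 <= M.
  have [[w _]|h0] := pselect (exists w : Omega, True).
    exact: le_trans (normr_ge0 _) (bY w).
  have : P setT = 0%E.
    rewrite (_ : setT = set0) ?measure0//; apply/seteqP; split => // w _; apply: h0.
    by exists w.
  by rewrite probability_setT => /eqP; rewrite onee_eq0.
rewrite -RintegralB//.
have iB : integ P (fun w => L w - Y w) by apply: (integrableB _ iL iY).
apply: (le_trans (le_normr_Rintegral _ iB)) => //.
have iH : integ P (fun w => g + 2 * M * \1_G w).
  by apply: integ_D; [exact: integ_cst|exact: integ_Z].
apply: (@le_trans _ _ (\int[P]_w (g + 2 * M * \1_G w))).
  apply: le_Rintegral => //; first exact: integrable_norm.
  move=> w _; rewrite indicE; case: (boolP (w \in G)) => hw.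
    rewrite mulr1; apply: (le_trans (ler_normB _ _)).
    by have := bY w; have := bL w; lra.
  by rewrite mulr0 addr0; apply: h => hG; rewrite notin_setE in hw.
rewrite RintegralD//; [|exact: integ_cst|exact: integ_Z].
rewrite RintegralZl// Rintegral_cst//= [fine _](_ : _ = 1); last first.
  by rewrite [X in fine X]probability_setT.
rewrite mulr1 lerD2l ler_wpM2l ?mulr_ge0//.
rewrite /Rintegral integral_indic// setIT -lee_fin fineK// fin_num_measure//.
Qed.

Lemma tail_small (Z : Omega -> R) (g : R) : measurable_fun setT Z -> 0 < g ->
  exists2 K : R, 0 <= K & (P [set w | (K < Z w)%R] <= g%:E)%E.
Proof.
move=> mZ g0.
pose Z' : {RV P >-> R} := HB.pack Z (isMeasurableFun.Build _ _ _ _ Z mZ).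
have := @cvg_ccdfy0 _ _ _ P Z'.
move=> /fine_cvgP[h1 /cvgrPdist_lt /(_ g g0) h2].
near (pinfty_nbhs R) => K.
have K0 : 0 <= K by near: K; exact: nbhs_pinfty_ge.
exists K => //.
have -> : [set w | K < Z w] = Z @^-1` `]K, +oo[%classic.
  by apply/seteqP; split => w /=; rewrite in_itv/= andbT.
have f1 : ccdf Z' K \is a fin_num by near: K; exact: h1.
rewrite -[X in (X <= _)%E]/(ccdf Z' K) -(fineK f1) lee_fin.
have : `|0 - fine (ccdf Z' K)| < g by near: K.
by rewrite sub0r normrN => /ltW; apply: le_trans; exact: ler_norm.
Unshelve. all: end_near. Qed.

End expectation.

(** * The supremum of a Brownian path *)

Section path_sup.
Context {R : realType}.
Variable (b : R -> R).
Hypothesis cb : {within `[0, 1], continuous b}.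

Lemma path_sup_max : exists2 c : R, 0 <= c <= 1 & sup [set `|b s| | s in `[0, 1]] = `|b c| /\
  forall s, 0 <= s <= 1 -> `|b s| <= `|b c|.
Proof.
have cn : {within `[0, 1], continuous (fun s => `|b s|)}.
  apply: (@within_continuous_comp _ _ _ `[(0 : R), 1]%classic b (fun x => `|x|)) => //.
  by move=> x _; exact: norm_continuous.
have [c c01 h] := EVT_max ler01 cn.
have {}h s : 0 <= s <= 1 -> `|b s| <= `|b c| by move=> s01; apply: h; rewrite in_itv.
exists c; first by move: c01; rewrite in_itv.
split => //; apply: sup_max; first by exists c.
by move=> z [s /=]; rewrite in_itv/= => s01 <- {z}; exact: h.
Qed.

Definition unit_grid (n : nat) (a : nat -> R) (del : R) :=
  [/\ a 0%N = 0, a n = 1, forall i, (i < n)%N -> a i <= a i.+1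
    & forall i, (i < n)%N -> a i.+1 - a i <= del].

Lemma unit_grid_in n a del k : unit_grid n a del -> (k <= n)%N -> 0 <= a k <= 1.
Proof.
move=> [a0 a1 ale _] kn.
by apply/andP; split; [rewrite -a0|rewrite -a1]; exact: (le_of_steps ale).
Qed.

Lemma maxabs_le_sup n a del : unit_grid n a del ->
  maxabs (fun k => b (a k)) n <= sup [set `|b s| | s in `[0, 1]].
Proof.
move=> ha; have [c _ [-> h]] := path_sup_max.
by have [k kn ->] := maxabs_ex (fun k => b (a k)) n; apply: h; exact: unit_grid_in ha kn.
Qed.

Lemma unit_grid_near n a del c : 0 <= del -> unit_grid n a del -> 0 <= c <= 1 ->
  exists2 k, (k <= n)%N & `|a k - c| <= del.
Proof.
move=> del0 [a0 a1 ale astep] /andP[c0 c1].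
have ex : exists i, c <= a i by exists n; rewrite a1.
case: (ex_minnP ex) => m cm mmin.
have mn : (m <= n)%N by apply: mmin; rewrite a1.
case: m cm mmin mn => [|i] cm mmin mn.
  exists 0%N => //; rewrite a0 in cm *.
  by have -> : c = 0 by [apply/eqP; rewrite eq_le cm]; rewrite subrr normr0.
exists i.+1 => //; rewrite ger0_norm ?subr_ge0//.
have : a i < c by rewrite ltNge; apply/negP => /mmin; rewrite ltnn.
by have := astep i mn; lra.
Qed.

(** The supremum is attained, and the grid comes close to the point where it is. *)
Lemma sup_le_maxabs e : 0 < e -> exists2 del, 0 < del & forall n a, unit_grid n a del ->
  sup [set `|b s| | s in `[0, 1]] - e <= maxabs (fun k => b (a k)) n.
Proof.
move=> e0; have [c c01 [-> _]] := path_sup_max.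
have cA : `[0, 1]%classic c by rewrite /= in_itv.
have [del del0 h] := within_contP cb cA e0.
have del2 : 0 < del / 2 by rewrite divr_gt0.
exists (del / 2) => // n a ha.
have [k kn kc] := unit_grid_near (ltW del2) ha c01.
have := maxabs_ge (fun k => b (a k)) kn; apply: le_trans.
have : `|b (a k) - b c| < e.
  apply: h; first by rewrite /= in_itv/=; exact: unit_grid_in ha kn.
  by apply: le_lt_trans kc _; lra.
have := ler_distD (b (a k)) (b c) 0; rewrite !subr0 (distrC (b c)) /=; lra.
Qed.

End path_sup.

Section brownian_supremum.
Context {d : measure_display} {Omega : measurableType d} {R : realType}.
Variables (Q : probability Omega R) (B : R -> Omega -> R).
Hypothesis hB : brownian_motion Q 1 B.

Definition brownian_sup w := sup [set `|B s w| | s in `[0, 1]].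

Let cB w : {within `[0, 1], continuous (B^~ w)}.
Proof. by case: hB => _ [_ c _ _ _]; exact: c. Qed.

Lemma maxabs_grid_measurable n a del : unit_grid n a del ->
  measurable_fun setT (fun w => maxabs (fun k => B (a k) w) n).
Proof.
move=> ha; apply: (maxabs_measurable (a := fun k => B (a k))) => k kn.
by case: hB => h _; apply: h; rewrite in_itv/=; exact: unit_grid_in ha kn.
Qed.

Lemma maxabs_grid_cvg (n : nat -> nat) (a : nat -> nat -> R) (del : nat -> R) w :
  (\forall j \near \oo, unit_grid (n j) (a j) (del j)) -> del j @[j --> \oo] --> (0 : R) ->
  maxabs (fun k => B (a j k) w) (n j) @[j --> \oo] --> brownian_sup w.
Proof.
move=> ha /cvgrPdist_lt dl; apply/cvgrPdist_le => e e0.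
have [r r0 h] := sup_le_maxabs (@cB w) e0.
have := dl r r0; apply: filterS2 ha => j ha; rewrite sub0r normrN => dr.
have ha' : unit_grid (n j) (a j) r.
  case: ha => a0 a1 ale ad; split => // i ni; apply: le_trans (ad i ni) _.
  by apply: ltW; apply: le_lt_trans dr; exact: ler_norm.
have h1 := h _ _ ha'; have h2 := maxabs_le_sup (@cB w) ha.
by rewrite /brownian_sup; rewrite ger0_norm; [lra|rewrite subr_ge0].
Qed.

Lemma uniform_grid j : unit_grid j.+1 (fun k => k%:R / j.+1%:R) (j.+1%:R^-1 : R).
Proof.
split.
- by rewrite mul0r.
- by rewrite mulfV.
- by move=> i _; rewrite ler_pM2r ?invr_gt0// ler_nat.
- by move=> i _; rewrite -mulrBl -natrB// subSnn mul1r.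
Qed.

Lemma brownian_sup_measurable : measurable_fun setT brownian_sup.
Proof.
apply: (@measurable_fun_cvg _ _ _ setT (fun j w => maxabs (fun k => B (k%:R / j.+1%:R) w) j.+1)).
  by move=> j; exact: maxabs_grid_measurable (uniform_grid j).
move=> w _; apply: (maxabs_grid_cvg (del := fun j => j.+1%:R^-1)); last exact: cvg_harmonic.
by near=> j; exact: uniform_grid.
Unshelve. all: end_near. Qed.

(** Dominated convergence along every sequence tending to 0. Until the sequence is
below [e1], the integrand is replaced by its limit, which is measurable too. *)
Lemma brownian_grid_expect (f : R -> R) (M e1 : R) (n : R -> nat) (a : R -> nat -> R) (del : R -> R) :
  continuous f -> (forall x, `|f x| <= M) -> 0 < e1 ->
  (forall eps, 0 < eps -> eps < e1 -> unit_grid (n eps) (a eps) (del eps)) ->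
  del eps @[eps --> (0 : R)^'+] --> (0 : R) ->
  \int[Q]_w f (maxabs (fun k => B (a eps k) w) (n eps)) @[eps --> (0 : R)^'+] -->
    \int[Q]_w f (brownian_sup w).
Proof.
move=> cf fM e10 ha del0.
have mf : measurable_fun [set: R] f by exact: continuous_measurable_fun.
apply/cvg_at_rightP => u [u0 ul].
have ue : \forall j \near \oo, u j < e1.
  by move/cvgrPdist_lt : ul => /(_ e1 e10); apply: filterS => j; rewrite sub0r normrN gtr0_norm.
have iZ : integ Q (fun w => f (brownian_sup w)).
  by apply: (@bounded_integ _ _ _ _ _ M) => // ; exact: measurableT_comp mf brownian_sup_measurable.
pose Fj j w := if u j < e1 then f (maxabs (fun k => B (a (u j) k) w) (n (u j))) else f (brownian_sup w).
have mF j : measurable_fun setT (Fj j).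
  rewrite /Fj; case h : (u j < e1); last exact: measurableT_comp mf brownian_sup_measurable.
  by apply: measurableT_comp mf _; exact: maxabs_grid_measurable (ha _ (u0 j) h).
have FM j w : `|Fj j w| <= M by rewrite /Fj; case: ifP.
have iF j : integ Q (Fj j) by exact: bounded_integ (mF j) (FM j).
have Fcvg w : Fj j w @[j --> \oo] --> f (brownian_sup w).
  have hc : f (maxabs (fun k => B (a (u j) k) w) (n (u j))) @[j --> \oo] --> f (brownian_sup w).
    apply: continuous_cvg; first exact: cf.
    apply: (maxabs_grid_cvg (n := fun j => n (u j)) (a := fun j => a (u j)) (del := fun j => del (u j))).
      by apply: filterS ue => j h; exact: ha.
    by move/cvg_at_rightP : del0; apply.
  apply: cvg_trans hc; apply: near_eq_cvg.
  by apply: filterS ue => j h; rewrite /Fj h.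
have dc : (\int[Q]_w (Fj j w)%:E)%E @[j --> \oo] --> (\int[Q]_w (f (brownian_sup w))%:E)%E.
  have mg : measurable_fun setT (fun w => (f (brownian_sup w))%:E).
    by apply/measurable_EFinP; exact: measurableT_comp mf brownian_sup_measurable.
  have mFj j : measurable_fun setT (fun w => (Fj j w)%:E) by exact/measurable_EFinP.
  have pc w : setT w -> (Fj j w)%:E @[j --> \oo] --> (f (brownian_sup w))%:E.
    by move=> _; apply: cvg_EFin; [exact: nearW|exact: Fcvg].
  have [_ _] := @dominated_convergence _ _ _ Q setT measurableT
     (fun j w => (Fj j w)%:E) (fun w => (f (brownian_sup w))%:E) (fun=> M%:E) mFj mg
     (aeW _ pc) (integ_cst _ _)
     (aeW _ (fun w j _ => FM j w)).
  by [].
move: dc; rewrite -[X in _ --> X -> _]fineK; last exact: integrable_fin_num.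
move=> /fine_cvg; apply: cvg_trans; apply: near_eq_cvg.
apply: filterS ue => j h; rewrite /= /Rintegral; congr fine; apply: eq_integral => w _.
by rewrite /Fj h.
Qed.
End brownian_supremum.

(** * Law of the normalized Gaussian maximum *)

Section law_transfer.
Context {d d' : measure_display} {Omega : measurableType d}
  {Omega' : measurableType d'} {R : realType}.
Variables (P : probability Omega R) (Q : probability Omega' R).
Variables (L : Omega -> R) (L' : Omega' -> R).
Hypotheses (mL : measurable_fun setT L) (mL' : measurable_fun setT L').
Hypothesis law : forall g : R -> \bar R, measurable_fun setT g -> (forall x, (0 <= g x)%E) ->
  (\int[P]_w g (L w) = \int[Q]_w g (L' w))%E.

(** The equality of laws is stated for non-negative functions, such as [f + M]. *)
Lemma transfer_expect (f : R -> R) (M : R) : measurable_fun setT f -> (forall x, `|f x| <= M) ->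
  \int[P]_w f (L w) = \int[Q]_w f (L' w).
Proof.
move=> mf fM.
have f0 x : (0 <= (f x + M)%:E)%E by rewrite lee_fin; have := fM x; rewrite ler_norml => /andP[]; lra.
have iL : integ P (fun w => f (L w)) 
  by apply: (@bounded_integ _ _ _ _ _ M) => //; exact: measurableT_comp mf mL.
have iL' : integ Q (fun w => f (L' w)) 
  by apply: (@bounded_integ _ _ _ _ _ M) => //; exact: measurableT_comp mf mL'.
have mg : measurable_fun setT (fun x => (f x + M)%:E).
  by apply/measurable_EFinP; exact: measurable_funD.
have e : \int[P]_w (f (L w) + M) = \int[Q]_w (f (L' w) + M).
  by congr fine; exact: (law mg f0).
have eP : \int[P]_w (f (L w) + M) = \int[P]_w f (L w) + \int[P]_w (fun=> M) w.
  by apply: RintegralD => //; exact: integ_cst.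
have eQ : \int[Q]_w (f (L' w) + M) = \int[Q]_w f (L' w) + \int[Q]_w (fun=> M) w.
  by apply: RintegralD => //; exact: integ_cst.
have cP : \int[P]_w (fun=> M) w = M.
  rewrite Rintegral_cst// [X in M * X](_ : _ = 1) ?mulr1//.
  by rewrite -[RHS]/(fine 1%E) -(@probability_setT _ _ _ P).
have cQ : \int[Q]_w (fun=> M) w = M.
  rewrite Rintegral_cst// [X in M * X](_ : _ = 1) ?mulr1//.
  by rewrite -[RHS]/(fine 1%E) -(@probability_setT _ _ _ Q).
by move: e; rewrite eP eQ cP cQ; exact: addIr.
Qed.

Lemma transfer_tail (K : R) : P [set w | K < L w] = Q [set w | K < L' w].
Proof.
have mK : measurable [set x : R | K < x].
  by rewrite (_ : [set x | K < x] = `]K, +oo[%classic)//; apply/seteqP; split => x /=; rewrite in_itv/= andbT.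
have := law (g := fun x => (\1_[set x : R | K < x] x)%:E) _ _.
have -> : (fun w => (\1_[set x | K < x] (L w))%:E) = (fun w => (\1_[set w | K < L w] w)%:E).
  by [].
have -> : (fun w => (\1_[set x | K < x] (L' w))%:E) = (fun w => (\1_[set w | K < L' w] w)%:E).
  by [].
rewrite !integral_indic ?setIT//; last 2 first.
- by have := mL' measurableT mK; rewrite setTI.
- by have := mL measurableT mK; rewrite setTI.
apply => //; apply/measurable_EFinP; exact: measurable_indic.
Qed.
End law_transfer.

Section normalized.
Context {d d' : measure_display} {Omega : measurableType d}
  {Omega' : measurableType d'} {R : realType}.
Variables (P : probability Omega R) (F : R -> set (set Omega)) (T : R)
  (W : R -> Omega -> R).
Hypotheses (hF : filtration F T) (hW : wiener_process P F T W).
Variables (Q : probability Omega' R) (B : R -> Omega' -> R).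
Hypothesis hB : brownian_motion Q 1 B.
Variables (sigma x : R -> R) (Ks eps : R).
Hypothesis hKs : forall s, 0 <= s <= T -> `|sigma (x s)| <= Ks.
Variables (n : nat) (t : nat -> R) (t0 : t 0%N = 0) (tn : t n = T)
  (tlt : forall i, (i < n)%N -> t i < t i.+1)
  (tmesh : forall i, (i < n)%N -> t i.+1 - t i <= eps ^+ 2).
Local Notation qv := (qvar sigma x t).
Hypothesis V0 : 0 < qv n.

Definition gauss_sup w := maxabs (fun k => gauss_mart W sigma x t k w) n / Num.sqrt (qv n).
(** The share of the quadratic variation accumulated in [k] steps: the
deterministic time change that turns the Gaussian martingale into Brownian motion. *)
Definition clock k := qv k / qv n.

Lemma clock_step i : clock i.+1 - clock i =
  (sigma (x (t i)) / Num.sqrt (qv n)) ^+ 2 * (t i.+1 - t i).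
Proof.
rewrite /clock -mulrBl /qvar big_ord_recr /= addrAC subrr add0r.
by rewrite exprMn exprVn sqr_sqrtr ?(ltW V0)// mulrAC.
Qed.

Lemma clock_grid : unit_grid n clock (Ks ^+ 2 * eps ^+ 2 / qv n).
Proof.
split.
- by rewrite /clock /qvar big_ord0 mul0r.
- by rewrite /clock mulfV// gt_eqF.
- move=> i ni; rewrite -subr_ge0 clock_step mulr_ge0 ?sqr_ge0//.
  by rewrite subr_ge0 ltW// tlt.
- move=> i ni; rewrite clock_step exprMn exprVn sqr_sqrtr ?(ltW V0)// mulrAC.
  rewrite ler_pM2r ?invr_gt0//.
  have ti := grid_in t0 tn tlt (ltnW ni).
  apply: ler_pM => //; first exact: sqr_ge0.
  - by rewrite subr_ge0 ltW// tlt.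
  - by rewrite -real_normK ?num_real// lerXn2r ?nnegrE ?hKs// (le_trans _ (hKs ti)).
  - exact: tmesh.
Qed.

Lemma gauss_sup_measurable : measurable_fun setT gauss_sup.
Proof.
apply: measurable_funM; last exact: measurable_cst.
apply: (maxabs_measurable (a := fun k => gauss_mart W sigma x t k)) => k kn.
apply: measurable_sum => i; apply: measurable_funM => //.
have ik := leq_trans (ltn_ord i) kn.
by apply: measurable_funB; apply: (W_meas hF hW); apply: (grid_in t0 tn tlt) => //; exact: ltnW.
Qed.

Lemma gauss_sup_law (g : R -> \bar R) : measurable_fun setT g -> (forall x, (0 <= g x)%E) ->
  (\int[P]_w g (gauss_sup w) = \int[Q]_w g (maxabs (fun k => B (clock k) w) n))%E.
Proof.
move=> mg g0.
pose c i := sigma (x (t i)) / Num.sqrt (qv n).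
rewrite -(@brownian_max_law _ _ _ _ _ P F T W hF hW Q B hB n t clock c)//.
- apply: eq_integral => w _; congr g; rewrite /gauss_sup mulrC -maxabsZ ?invr_ge0 ?sqrtr_ge0//.
  apply: eq_maxabs => k _; rewrite /psum /gauss_mart mulr_sumr; apply: eq_bigr => i _.
  by rewrite /c mulrA; congr (_ * _); exact: mulrC.
- by move=> k kn; exact: (grid_in t0 tn tlt).
- by move=> k kn; exact: (unit_grid_in clock_grid).
- by move=> i ni; exact: clock_step.
- by rewrite /clock /qvar big_ord0 mul0r.
Qed.

Lemma gauss_sup_expect (f : R -> R) (M : R) : measurable_fun setT f -> (forall x, `|f x| <= M) ->
  \int[P]_w f (gauss_sup w) = \int[Q]_w f (maxabs (fun k => B (clock k) w) n).
Proof.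
exact: (transfer_expect gauss_sup_measurable (maxabs_grid_measurable hB clock_grid) gauss_sup_law).
Qed.

(** Tightness comes from the Brownian path, uniformly over all grids. *)
Lemma gauss_sup_tail (K : R) : (P [set w | (K < gauss_sup w)%R] <= Q [set w | (K < brownian_sup B w)%R])%E.
Proof.
have mL' := maxabs_grid_measurable hB clock_grid.
rewrite (transfer_tail gauss_sup_measurable mL' gauss_sup_law); apply: le_measure; rewrite ?inE.
- exact: measurable_gt.
- by apply: measurable_gt; exact: brownian_sup_measurable hB.
- move=> w /= /lt_le_trans; apply; apply: maxabs_le_sup clock_grid.
  by case: hB => _ [_ c0 _ _ _]; exact: c0.
Qed.
End normalized.

(** * Studentization *)

Section one_noise_level.
Context {d d' : measure_display} {Omega : measurableType d}
  {Omega' : measurableType d'} {R : realType}.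
Variables (P : probability Omega R) (F : R -> set (set Omega)) (T x0 : R)
  (W : R -> Omega -> R).
Hypotheses (T0 : 0 < T) (hF : filtration F T) (hW : wiener_process P F T W).
Variables (Q : probability Omega' R) (B : R -> Omega' -> R).
Hypothesis hB : brownian_motion Q 1 B.
Variables (S sigma x : R -> R) (C : R).
Hypotheses (C0 : 0 < C)
  (lipS : forall a b, `|S a - S b| <= C * `|a - b|)
  (lips : forall a b, `|sigma a - sigma b| <= C * `|a - b|)
  (hx : ode_solution T x0 S x).
Variables (Ks KS Kx : R).
Hypotheses (hKs : forall s, 0 <= s <= T -> `|sigma (x s)| <= Ks)
  (hKS : forall s, 0 <= s <= T -> `|S (x s)| <= KS)
  (hKx : forall s, 0 <= s <= T -> `|x s| <= Kx).
Variables (eps : R) (e0 : 0 < eps) (e1 : eps <= 1) (X : R -> Omega -> R).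
Hypotheses (hX : sde_solution P F T W x0 S sigma eps X)
  (A2 : bounded_second_moments P T X).
Variables (n : nat) (t : nat -> R) (t0 : t 0%N = 0) (tn : t n = T)
  (tlt : forall i, (i < n)%N -> t i < t i.+1)
  (tmesh : forall i, (i < n)%N -> t i.+1 - t i <= eps ^+ 2).
Variable h : Omega -> R.
Hypothesis mh : measurable_fun setT h.

Definition studentized w := maxabs (fun k => eps^-1 * score_sum S X t k w) n / h w.

Lemma studentized_measurable : measurable_fun setT studentized.
Proof.
apply: measurable_funM; last exact: measurableT_comp (@inv_measurable R) mh.
apply: (maxabs_measurable (a := fun k w => eps^-1 * score_sum S X t k w)) => k kn.
apply: measurable_funM => //; apply: measurable_sum => i.
have ik := leq_trans (ltn_ord i) kn.
have m1 := X_meas hF hX (grid_in t0 tn tlt ik).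
have m0 := X_meas hF hX (grid_in t0 tn tlt (ltnW ik)).
apply: measurable_funB; first exact: measurable_funB.
apply: measurable_funM => //; apply: measurableT_comp m0.
exact: continuous_measurable_fun (lip_continuous C0 lipS).
Qed.

Variables (Sig delta K g del M ph pK : R) (f : R -> R).
Hypotheses (Sig0 : 0 < Sig) (delta0 : 0 < delta) (deltaS : delta <= Sig / 2)
  (vS : `|Num.sqrt (qvar sigma x t n) - Sig| <= delta)
  (hS : (P [set w | (delta < `|h w - Sig|)%R] <= ph%:E)%E)
  (hK : (Q [set w | (K < brownian_sup B w)%R] <= pK%:E)%E)
  (cf : continuous f) (fM : forall u, `|f u| <= M) (g0 : 0 <= g)
  (uf : forall u v : R, `|u| <= K -> `|u - v| < del -> `|f u - f v| <= g)
  (ddel : (4 + 4 * K) * delta / Sig < del).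

(** Slutsky's argument at a fixed noise level. The four probabilities are those of
a large Ito error, a large drift error, a bad estimate of [Sig] and a large
Gaussian maximum; outside these events the two arguments of [f] are close. *)
Lemma studentized_close :
  `|\int[Q]_w f (maxabs (fun k => B (clock sigma x n t k) w) n) - \int[P]_w f (studentized w)|
  <= g + 2 * M * (ito_err_cst T C Ks KS * eps ^+ 2 / delta ^+ 2 + drift_err_cst T C Ks KS * eps / delta + ph + pK).
Proof.
have V0 : 0 < qvar sigma x t n.
  rewrite -sqrtr_gt0; move: vS; rewrite ler_norml => /andP[v1 v2].
  by move: Sig0 deltaS v1 v2; set v := Num.sqrt _; lra.
have mf : measurable_fun [set: R] f by exact: continuous_measurable_fun.
have mL := gauss_sup_measurable hF hW sigma x t0 tn tlt.
rewrite -(gauss_sup_expect hF hW hB hKs t0 tn tlt tmesh V0 mf fM).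
have [I hI aeX] := sde_ito hF hX.
pose G1 := bad_ito W sigma x I n t delta; pose G2 := bad_drift S eps X I n t delta.
pose G3 := [set w | delta < `|h w - Sig|].
pose G4 := [set w | K < gauss_sup W sigma x n t w].
have mG1 : measurable G1 by exact: (bad_ito_meas hF hW x hI).
have mG2 : measurable G2 by exact: (bad_drift_meas hF C0 lipS hX hI).
have mG3 : measurable G3.
  apply: measurable_gt; apply: measurableT_comp => //; exact: measurable_funB.
have mG4 : measurable G4 by exact: measurable_gt.
have p1 : (P G1 <= (ito_err_cst T C Ks KS * eps ^+ 2 / delta ^+ 2)%:E)%E.
  exact: (bad_ito_prob T0 hF hW C0 lipS lips hx hKs hKS hKx e0 e1 hX A2 hI aeX).
have p2 : (P G2 <= (drift_err_cst T C Ks KS * eps / delta)%:E)%E.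
  exact: (bad_drift_prob T0 hF hW C0 lipS lips hx hKs hKS hKx e0 e1 hX A2 hI aeX).
have p4 : (P G4 <= pK%:E)%E.
  exact: le_trans (gauss_sup_tail hF hW hB hKs t0 tn tlt tmesh V0 K) hK.
apply: (@expect_close _ _ _ P _ _ (G1 `|` G2 `|` G3 `|` G4)) => //.
- exact: measurableT_comp mf studentized_measurable.
- exact: measurableT_comp mf mL.
- by do !apply: measurableU.
- rewrite !EFinD; apply: le_trans (measureU2 _ _ _) _ => //; first by do !apply: measurableU.
  apply: leeD => //; apply: le_trans (measureU2 _ _ _) _ => //; first by do !apply: measurableU.
  by apply: leeD => //; apply: le_trans (measureU2 _ _ _) _ => //; apply: leeD.
- move=> w hw.
  have n1 : ~ G1 w by move=> z; apply: hw; left; left; left.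
  have n2 : ~ G2 w by move=> z; apply: hw; left; left; right.
  have n3 : `|h w - Sig| <= delta by rewrite leNgt; apply/negP => z; apply: hw; left; right.
  have n4 : gauss_sup W sigma x n t w <= K by rewrite leNgt; apply/negP => z; apply: hw; right.
  have L0 : 0 <= gauss_sup W sigma x n t w by rewrite divr_ge0 ?maxabs_ge0 ?sqrtr_ge0.
  apply: uf; first by rewrite ger0_norm.
  apply: le_lt_trans ddel; apply: ratio_close => //.
  + exact: ltW.
  + by apply: maxabs_dist => k kn; exact: (score_gauss_close e0 t0 kn n1 n2).
  + exact: maxabs_ge0.
Qed.

End one_noise_level.

(** * Convergence as the noise vanishes *)

Section near_zero.
Context {R : realType}.

Lemma near0_small (c e : R) : 0 < e -> \forall eps \near (0 : R)^'+, c * eps <= e.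
Proof.
move=> e0; have c1 : 0 < `|c| + 1 by rewrite ltr_wpDl.
near=> eps.
have p0 : 0 < eps by near: eps; exact: nbhs_right_gt.
have p1 : eps < e / (`|c| + 1) by near: eps; apply: nbhs_right_lt; exact: divr_gt0.
rewrite ltr_pdivlMr// in p1; apply: ltW; apply: le_lt_trans p1.
rewrite mulrC ler_pM2l//; have := ler_norm c; lra.
Unshelve. all: end_near. Qed.

Lemma near0_interval (A : R -> Prop) : (\forall eps \near (0 : R)^'+, A eps) ->
  exists2 e1 : R, 0 < e1 & forall eps, 0 < eps -> eps < e1 -> A eps.
Proof.
move=> [e1 /= e10 h]; exists e1 => // eps e0 ee; apply: h => //=.
by rewrite sub0r normrN gtr0_norm.
Qed.

Lemma mesh_near0 (T : R) (n : R -> nat) (t : R -> nat -> R) : sampling_scheme T n t ->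
  \forall eps \near (0 : R)^'+, forall i, (i < n eps)%N -> t eps i.+1 - t eps i <= eps ^+ 2.
Proof.
move=> [ht /eqoP /(_ 1 ltr01)]; apply: filterS2 (nbhs_right_gt 0) => eps e0.
rewrite mul1r (ger0_norm (sqr_ge0 eps)) => hm i ni.
apply: le_trans hm; apply: le_trans (ler_norm _); apply: (le_trans (ler_norm _)).
exact: (le_bigmax 0 (fun i : 'I_(n eps) => `|t eps i.+1 - t eps i|) (Ordinal ni)).
Qed.

Lemma unit_grid_le n (a : nat -> R) d1 d2 : d1 <= d2 -> unit_grid n a d1 -> unit_grid n a d2.
Proof.
move=> dd [a0 a1 ale ad]; split => // i ni.
by apply: le_trans dd; exact: ad.
Qed.

End near_zero.

Theorem theorem6 (R : realType) (T x0 : R) (hT : 0 < T)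
    (d : measure_display) (Omega : measurableType d) (P : probability Omega R)
    (F : R -> set (set Omega)) (hF : filtration F T)
    (W : R -> Omega -> R) (hW : wiener_process P F T W)
    (S0 sigma xS : R -> R) (X : R -> R -> Omega -> R)
    (hX : forall eps : R, 0 < eps -> sde_solution P F T W x0 S0 sigma eps (X eps))
    (hxS : ode_solution T x0 S0 xS)
    (A1 : lipschitz_coefficients S0 sigma)
    (A2 : forall eps : R, 0 < eps -> bounded_second_moments P T (X eps))
    (A3 : 0 < limit_sd T sigma xS)
    (n : R -> nat) (t : R -> nat -> R) (ht : sampling_scheme T n t)
    (hatSigma : R -> {RV P >-> R})
    (hhat : cvg_in_probability P (fun eps => hatSigma eps : Omega -> R)
              (limit_sd T sigma xS))
    (d' : measure_display) (Omega' : measurableType d')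
    (Q : probability Omega' R) (B : R -> Omega' -> R)
    (hB : brownian_motion Q 1 B) :
  cvg_in_distribution P
    (fun eps w =>
       sup [set `|score_process S0 n t X eps u w| | u in `[0, T]]
       / hatSigma eps w)
    Q (fun w => sup [set `|B s w| | s in `[0, 1]]).
Proof.
have [C C0 lip] := A1.
have lipS a b : `|S0 a - S0 b| <= C * `|a - b| by case: (lip a b).
have lips a b : `|sigma a - sigma b| <= C * `|a - b| by case: (lip a b).
have cx := ode_continuous hxS.
have T0 := ltW hT.
have cS : continuous S0 := lip_continuous C0 lipS.
have cs : continuous sigma := lip_continuous C0 lips.
have [Kx _ hKx] := within_bounded T0 cx.
have [Ks Ks0 hKs] : exists2 K : R, 0 <= K & forall s, 0 <= s <= T -> `|sigma (xS s)| <= K.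
  apply: within_bounded T0 _.
  by apply: (@within_continuous_comp _ _ _ `[0, T]%classic xS sigma) => //.
have [KS _ hKS] : exists2 K : R, 0 <= K & forall s, 0 <= s <= T -> `|S0 (xS s)| <= K.
  apply: within_bounded T0 _.
  by apply: (@within_continuous_comp _ _ _ `[0, T]%classic xS S0) => //.
move=> f cf [M fM].
have mf : measurable_fun [set: R] f by exact: continuous_measurable_fun.
have M0 : 0 <= M := le_trans (normr_ge0 _) (fM 0).
set Sig := limit_sd T sigma xS in A3 hhat *.
pose q eps := qvar sigma xS (t eps) (n eps).
have ht0 eps : 0 < eps -> t eps 0%N = 0 by case: ht => h _ /h[].
have htn eps : 0 < eps -> t eps (n eps) = T by case: ht => h _ /h[].
have htlt eps : 0 < eps -> forall i, (i < n eps)%N -> t eps i < t eps i.+1 by case: ht => h _ /h[].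
have mesh0 := mesh_near0 ht.
have SigE : Sig ^+ 2 = \int[@lebesgue_measure R]_(s in `[0, T]) sigma (xS s) ^+ 2.
  rewrite /Sig /limit_sd sqr_sqrtr// leNgt; apply/negP => /ltW h.
  by move: A3; rewrite /Sig /limit_sd ler0_sqrtr// ltxx.
have sqrtV delta : 0 < delta -> \forall eps \near (0 : R)^'+, `|Num.sqrt (q eps) - Sig| <= delta.
  move=> delta0; near=> eps.
  have e0 : 0 < eps by near: eps; exact: nbhs_right_gt.
  have e1 : eps <= 1 by near: eps; exact: nbhs_right_le.
  have hm : forall i, (i < n eps)%N -> t eps i.+1 - t eps i <= eps ^+ 2 by near: eps.
  have := qvar_approx hT C0 lipS lips hxS hKs hKS (ht0 _ e0) (htn _ e0) (htlt _ e0) hm.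
  rewrite -SigE -/(q eps); set Kv := 2 * Ks * C * KS * T => hq.
  have q0 : 0 <= q eps.
    apply: sumr_ge0 => i _; rewrite mulr_ge0 ?sqr_ge0// subr_ge0 ltW//.
    exact: htlt.
  have sq := sqr_sqrtr q0; set v := Num.sqrt (q eps) in sq *.
  have v0 : 0 <= v by exact: sqrtr_ge0.
  have : `|v - Sig| * Sig <= Kv * eps ^+ 2.
    apply: le_trans hq; rewrite -sq subr_sqr normrM ler_wpM2l//.
    by rewrite ger0_norm ?addr_ge0// ?(ltW A3)// lerDr.
  have ee : eps ^+ 2 <= eps by rewrite expr2 ler_piMr// ltW.
  have : `|Kv| * eps <= delta * Sig by near: eps; apply: near0_small; exact: mulr_gt0.
  have : Kv * eps ^+ 2 <= `|Kv| * eps.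
    apply: (@le_trans _ _ (`|Kv| * eps ^+ 2)); first by rewrite ler_wpM2r ?sqr_ge0// ler_norm.
    by rewrite ler_wpM2l.
  by move=> h1 h2 h3; rewrite -(ler_pM2r A3); lra.
pose stt eps := studentized S0 eps (X eps) (n eps) (t eps) (hatSigma eps).
have mstat eps : 0 < eps -> measurable_fun setT (stt eps).
  move=> e0; apply: (studentized_measurable hF C0 lipS (hX _ e0) (ht0 _ e0) (htn _ e0) (htlt _ e0)).
  exact: measurable_funPT.
pose gridB eps := \int[Q]_w f (maxabs (fun k => B (clock sigma xS (n eps) (t eps) k) w) (n eps)).
have real_cvg : \int[P]_w f (stt eps w) @[eps --> (0 : R)^'+] --> \int[Q]_w f (brownian_sup B w).
  have S2 : 0 < Sig / 2 by rewrite divr_gt0.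
  (* Below [e1] the quadratic variation stays above [(Sig / 2)^2], so that the
     mesh of the time change is [O(eps)]. *)
  have [e1 e10 he1] := near0_interval (filterI (sqrtV _ S2) (filterI mesh0 (nbhs_right_le (@ltr01 R)))).
  pose dl eps := Ks ^+ 2 / (Sig / 2) ^+ 2 * eps.
  have cvgB := @brownian_grid_expect _ _ _ Q B hB f M e1 n
    (fun eps => clock sigma xS (n eps) (t eps)) dl cf fM e10.
  have {}cvgB : gridB eps @[eps --> (0 : R)^'+] --> \int[Q]_w f (brownian_sup B w).
    apply: cvgB; last first.
      rewrite -[X in _ --> X](mulr0 (Ks ^+ 2 / (Sig / 2) ^+ 2)); apply: cvgM; first exact: cvg_cst.
      by apply: cvg_at_right_filter; exact: cvg_id.
    move=> eps e0 ee; have [h1 [h2 h3]] := he1 eps e0 ee.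
    have vS : Sig / 2 <= Num.sqrt (q eps) by move: h1; rewrite ler_norml => /andP[]; lra.
    have V0 : 0 < q eps by rewrite -sqrtr_gt0; lra.
    apply: unit_grid_le (clock_grid hKs (ht0 _ e0) (htn _ e0) (htlt _ e0) h2 V0).
    rewrite /dl [X in _ <= X]mulrAC; apply: ler_pM.
    - by rewrite mulr_ge0 ?sqr_ge0.
    - by rewrite invr_ge0 ltW.
    - by rewrite ler_wpM2l ?sqr_ge0// expr2 ler_piMr// ltW.
    - by rewrite -/(q eps) lef_pV2 ?posrE ?exprn_gt0// -(sqr_sqrtr (ltW V0)) lerXn2r ?nnegrE ?sqrtr_ge0// ltW.
  apply/cvgrPdist_le => g g0.
  have g4 : 0 < g / 4 by rewrite divr_gt0.
  have M1 : 0 < 32 * (M + 1) by rewrite mulr_gt0// ltr_wpDl.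
  (* Each of the four exceptional probabilities is made at most [p]; together
     they contribute [8 M p <= g / 4]. *)
  pose p := g / (32 * (M + 1)).
  have p0 : 0 < p by rewrite divr_gt0.
  have [K K0 hK] := tail_small Q (brownian_sup_measurable hB) p0.
  have [del del0 uf] := heine K cf g4.
  (* The factor 2 makes the closeness bound strictly smaller than [del]. *)
  pose delta := Num.min (Sig / 2) (del * Sig / (2 * (4 + 4 * K))).
  have K4 : 0 < 4 + 4 * K by lra.
  have delta0 : 0 < delta.
    by rewrite lt_min S2 /= divr_gt0 ?mulr_gt0.
  have deltaS : delta <= Sig / 2 by rewrite ge_min lexx.
  have ddel : (4 + 4 * K) * delta / Sig < del.
    rewrite ltr_pdivrMr//.
    have : delta <= del * Sig / (2 * (4 + 4 * K)) by rewrite ge_min lexx orbT.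
    rewrite ler_pdivlMr ?mulr_gt0//; have := mulr_gt0 del0 A3; lra.
  have hh : \forall eps \near (0 : R)^'+, (P [set w | (delta < `|hatSigma eps w - Sig|)%R] <= p%:E)%E.
    have /fine_cvgP[h1 /cvgrPdist_le /(_ p p0)] := hhat delta delta0.
    apply: filterS2 h1 => eps f1; rewrite sub0r normrN => h.
    by rewrite -(fineK f1) lee_fin; apply: le_trans h; exact: ler_norm.
  have g2 : 0 < g / 2 by rewrite divr_gt0.
  move/cvgrPdist_le : cvgB => /(_ _ g2) cvgB.
  near=> eps.
  have e0 : 0 < eps by near: eps; exact: nbhs_right_gt.
  have e1' : eps <= 1 by near: eps; exact: nbhs_right_le.
  have hm : forall i, (i < n eps)%N -> t eps i.+1 - t eps i <= eps ^+ 2 by near: eps.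
  have vS : `|Num.sqrt (q eps) - Sig| <= delta by near: eps; exact: sqrtV.
  have b1 : `|\int[Q]_w f (brownian_sup B w) - gridB eps| <= g / 2 by near: eps.
  have hS : (P [set w | (delta < `|hatSigma eps w - Sig|)%R] <= p%:E)%E by near: eps.
  have b2 : `|gridB eps - \int[P]_w f (stt eps w)| <=
      g / 4 + 2 * M * (ito_err_cst T C Ks KS * eps ^+ 2 / delta ^+ 2 + drift_err_cst T C Ks KS * eps / delta + p + p).
    apply: (studentized_close hT hF hW hB C0 lipS lips hxS hKs hKS hKx e0 e1' (hX _ e0)
      (A2 _ e0) (ht0 _ e0) (htn _ e0) (htlt _ e0) hm (measurable_funPT (hatSigma eps)) A3
      delta0 deltaS vS hS hK cf fM (ltW g4) uf ddel).
  have k6 : ito_err_cst T C Ks KS * eps ^+ 2 / delta ^+ 2 <= p.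
    rewrite ler_pdivrMr ?exprn_gt0//.
    have : `|ito_err_cst T C Ks KS| * eps <= p * delta ^+ 2.
      by near: eps; apply: near0_small; rewrite mulr_gt0 ?exprn_gt0.
    apply: le_trans; apply: (@le_trans _ _ (`|ito_err_cst T C Ks KS| * eps ^+ 2)).
      by rewrite ler_wpM2r ?sqr_ge0// ler_norm.
    by rewrite ler_wpM2l// expr2 ler_piMr// ltW.
  have k7 : drift_err_cst T C Ks KS * eps / delta <= p.
    rewrite ler_pdivrMr//; near: eps; apply: near0_small; exact: mulr_gt0.
  have hp : p * (32 * (M + 1)) = g by rewrite /p divfK// gt_eqF.
  have hb : 2 * M * (ito_err_cst T C Ks KS * eps ^+ 2 / delta ^+ 2 + drift_err_cst T C Ks KS * eps / delta + p + p) <= g / 4.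
    apply: (@le_trans _ _ (2 * M * (4 * p))); first by rewrite ler_wpM2l ?mulr_ge0//; lra.
    by nra.
  have := ler_distD (gridB eps) (\int[Q]_w f (brownian_sup B w)) (\int[P]_w f (stt eps w)).
  by lra.
have iZ : integ Q (fun w => f (brownian_sup B w)).
  by apply: (@bounded_integ _ _ _ _ _ M) => //; exact: measurableT_comp mf (brownian_sup_measurable hB).
rewrite expectE//.
apply: cvg_trans (cvg_EFin (f := fun eps => (\int[P]_w f (stt eps w))%:E) _ real_cvg); last exact: nearW.
apply: near_eq_cvg; near=> eps.
have e0 : 0 < eps by near: eps; exact: nbhs_right_gt.
rewrite -expectE; last first.
  by apply: (@bounded_integ _ _ _ _ _ M) => //; exact: measurableT_comp mf (mstat _ e0).
congr ('E_P[_])%E; apply/funext => w.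
by rewrite /stt /studentized -(@sup_score _ _ _ T S0 n t X eps w (ht0 _ e0) (htn _ e0) (htlt _ e0)).
Unshelve. all: end_near. Qed.
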